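(* Let $K$ be a field, let $Q$ be a finite loop-free quiver, $S$ a potential on $Q$, and $k\in Q_0$. If no $2$-cycle of $Q$ is incident to $k$, then $\mu_k(Q^{\rm op},S^{\rm op})=(\mu_k(Q)^{\rm op},\mu_k(S)^{\rm op})$ as QPs (where $\mu_k(Q,S)=(\mu_k(Q),\mu_k(S))$ denotes the mutated QP), and for any decorated $\mathcal P(Q,S)$-module $\mathcal M=(M,V)$ (no finite-dimensionality assumed), the decorated $\mathcal P(\mu_k(Q^{\rm op},S^{\rm op}))$-modules $\mu_k(\mathcal M^\vee)$ and $\mu_k(\mathcal M)^\vee$ are isomorphic.
   Context: **Quivers and potentials.** $K$ is an arbitrary field; modules are left modules. A quiver $Q=(Q_0,Q_1,h,t)$ is finite and loop-free; an arrow $a$ goes from $t(a)$ to $h(a)$. Paths are composed as functions: $c_1c_2\cdots c_d$ is a path if $t(c_i)=h(c_{i+1})$. $e_j$ is the length-$0$ path at $j$. $K\langle Q\rangle$ is the path algebra, $K\langle\langle Q\rangle\rangle$ the complete path algebra (possibly infinite linear combinations of paths), $\mathfrak m$ its ideal generated by the arrows, with the $\mathfrak m$-adic topology. $K^{Q_0}=\prod_{j\in Q_0}K$; a $K^{Q_0}$-ring homomorphism is a $K$-algebra homomorphism fixing all $e_j$. A potential $S$ is a possibly infinite linear combination of cyclic paths of positive length; $(Q,S)$ is a QP. For a cyclic path, $\partial_a(c_1\cdots c_d)=\sum_{i:c_i=a}c_{i+1}\cdots c_dc_1\cdots c_{i-1}$, and for arrows $a,b$ with $h(a)=t(b)$,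 $\partial_{ba}(c_1\cdots c_d)=\sum_{i:\,c_ic_{i+1}=ba}c_{i+2}\cdots c_dc_1\cdots c_{i-1}$ (indices mod $d$); both are extended linearly and continuously. $J(S)$ is the $\mathfrak m$-adic closure of the two-sided ideal generated by all $\partial_a(S)$, and $\mathcal P(Q,S)=K\langle\langle Q\rangle\rangle/J(S)$. Two potentials are cyclically equivalent if their difference lies in the closure of the span of the elements $c_1\cdots c_d-c_2\cdots c_dc_1$. A decorated $\mathcal P(Q,S)$-module is a pair $(M,V)$ with $M$ a left $\mathcal P(Q,S)$-module and $V$ a left $K^{Q_0}$-module; $M_j=e_jM$, and $u_M$ is the action of $u$ on $M$. An isomorphism $(M,V)\to(N,W)$ is a pair consisting of a module isomorphism $M\to N$ and a $K^{Q_0}$-module isomorphism $V\to W$. **Premutation of QPs.** $\widetilde\mu_k(Q)$ has vertex set $Q_0$; its arrows are: the arrows of $Q$ not incident to $k$; an arrow $[ba]:t(a)\to h(b)$ for each pair $a,b\in Q_1$ with $h(a)=k=t(b)$; and an arrow $c^*$ opposite to $c$ for each $c\in Q_1$ incident to $k$. $\widetilde\mu_k(S)=[S]+\sum_{h(a)=k=t(b)}b^*[ba]a^*$, where $[S]$ is obtained from $S$ (replaced if necessary by a cyclically equivalent potential none of whose cycles starts at $k$) by replacing each occurrence of $ba$ with $h(a)=k=t(b)$ by the arrow $[ba]$. $\widetilde\mu_k(Q,S)=(\widetilde\mu_k(Q),\widetilde\mu_k(S))$. **Triangle.** Let $a_1,\dots,a_s$ (resp. $b_1,\dots,b_r$)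 be the arrows of $Q$ ending (resp. starting) at $k$. Put $M_{\rm in}=\bigoplus_iM_{t(a_i)}$, $M_{\rm out}=\bigoplus_jM_{h(b_j)}$, $\alpha=[(a_1)_M\cdots(a_s)_M]:M_{\rm in}\to M_k$, $\beta=[(b_1)_M\cdots(b_r)_M]^{T}:M_k\to M_{\rm out}$, and $\gamma:M_{\rm out}\to M_{\rm in}$ with $(i,j)$ entry $(\partial_{b_ja_i}(S))_M$. One has $\alpha\gamma=0=\gamma\beta$. Fix a linear retraction $\rho:M_{\rm out}\to\ker\gamma$ of the inclusion and a linear section $\sigma:\ker\alpha/\operatorname{im}\gamma\to\ker\alpha$ of the projection. $\iota$ denotes inclusions into $M_{\rm in}$; $p:M_{\rm out}\to\operatorname{coker}\beta$ is the projection (also its restriction $\ker\gamma\to\ker\gamma/\operatorname{im}\beta$); $\overline\gamma:\operatorname{coker}\beta\to M_{\rm in}$ is induced by $\gamma$. **$(\overline M,\overline V)$.** $\overline M_j=M_j$, $\overline V_j=V_j$ for $j\ne k$; $\overline V_k=\ker\beta/(\ker\beta\cap\operatorname{im}\alpha)$; and $\overline M_k$, $\overline\alpha:M_{\rm out}\to\overline M_k$, $\overline\beta:\overline M_k\to M_{\rm in}$ are given by any one of the following (mutually isomorphic) descriptions: (A) $\overline M_k=\frac{\ker\gamma}{\operatorname{im}\beta}\oplus\operatorname{im}\gamma\oplus\frac{\ker\alpha}{\operatorname{im}\gamma}\oplus V_k$, $\overline\alpha=[-p\rho,\,-\gamma,\,0,\,0]^T$, $\overline\beta=[0,\ \iota,\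 \iota\sigma,\ 0]$; (B) $\overline M_k=\frac{\ker\gamma}{\operatorname{im}\beta}\oplus\ker\alpha\oplus V_k$, $\overline\alpha=[-p\rho,\,-\gamma,\,0]^T$, $\overline\beta=[0,\ \iota,\ 0]$; (C) $\overline M_k=\operatorname{coker}\beta\oplus\frac{\ker\alpha}{\operatorname{im}\gamma}\oplus V_k$, $\overline\alpha=[-p,\,0,\,0]^T$, $\overline\beta=[\overline\gamma,\ \iota\sigma,\ 0]$. Put $\overline M=\bigoplus_j\overline M_j$, $\overline V=\bigoplus_j\overline V_j$. $\overline M$ is a representation of $\widetilde\mu_k(Q)$: arrows $c$ of $Q$ not incident to $k$ act as $c_M$, $[ba]$ acts as $b_Ma_M$, and $(a_i^* )_{\overline M}:\overline M_k\to M_{t(a_i)}$, $(b_j^* )_{\overline M}:M_{h(b_j)}\to\overline M_k$ are the components of $\overline\beta$ and $\overline\alpha$. Let $\eta:K\langle\widetilde\mu_k(Q)\rangle\to\operatorname{End}_K(\overline M)$ be the corresponding action. **The action $\widetilde\eta$ of $A:=K\langle\langle\widetilde\mu_k(Q)\rangle\rangle$ on $\overline M$.** Let $e_{\widehat k}=1-e_k$. For a quiver $Q'$ on $Q_0$, $e_{\widehat k}Q'e_{\widehat k}$ is $Q'$ with $k$ and all arrows incident to $k$ deleted. $\kappa:e_{\widehat k}Ae_{\widehat k}\to K\langle\langle e_{\widehat k}\widetilde\mu_k^2(Q)e_{\widehat k}\rangle\rangle$ is the algebra isomorphism replacing each occurrence of a length-$2$ path $a^*b^*$ ($h(a)=k=t(b)$)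 by the arrow $[a^*b^*]$. $\psi:K\langle\langle e_{\widehat k}\widetilde\mu_k^2(Q)e_{\widehat k}\rangle\rangle\to e_{\widehat k}K\langle\langle Q\rangle\rangle e_{\widehat k}$ is the unique algebra homomorphism fixing each $e_j$ ($j\neq k$) with $\psi(c)=c$ for $c\in Q_1$ not incident to $k$, $\psi([ba])=ba$, $\psi([a^*b^*])=-\partial_{ba}(S)$. $\widetilde\rho$ is the action $e_{\widehat k}K\langle\langle Q\rangle\rangle e_{\widehat k}\to\operatorname{End}_K(e_{\widehat k}M)$. $\theta:\operatorname{End}_K(e_{\widehat k}M)\to\operatorname{End}_K(\overline M)$ sends $f$ to $\overline M\twoheadrightarrow e_{\widehat k}M\xrightarrow{f}e_{\widehat k}M\hookrightarrow\overline M$. Every $u\in A$ is uniquely $u=ze_k+u_{\widehat k}+\sum_iv_ia_i^*+\sum_jb_j^*w_j+\sum_{i,j}b_j^*x_{ij}a_i^*$ with $z\in K$, $u_{\widehat k}\in e_{\widehat k}Ae_{\widehat k}$, $v_i\in e_{\widehat k}Ae_{t(a_i)}$, $w_j\in e_{h(b_j)}Ae_{\widehat k}$, $x_{ij}\in e_{h(b_j)}Ae_{t(a_i)}$. With $\Theta:=\theta\widetilde\rho\psi\kappa$, $$\widetilde\eta(u)=\eta(ze_k)+\Theta(u_{\widehat k})+\sum_i\Theta(v_i)\eta(a_i^* )+\sum_j\eta(b_j^* )\Theta(w_j)+\sum_{i,j}\eta(b_j^* )\Theta(x_{ij})\eta(a_i^* ).$$ This makes $\overline M$ a $\mathcal P(\widetilde\mu_k(Q,S))$-module.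 **Reduction and mutation.** A right-equivalence $(Q',S')\to(Q,S)$ of QPs on the same vertex set is a $K^{Q_0}$-ring isomorphism $K\langle\langle Q'\rangle\rangle\to K\langle\langle Q\rangle\rangle$ sending $S'$ to a potential cyclically equivalent to $S$. $(Q',S')\oplus(Q'',S'')$ has arrow set $Q'_1\sqcup Q''_1$ and potential $S'+S''$. A QP is reduced if the degree-$2$ component of its potential is zero, and trivial if its potential $S$ is homogeneous of degree $2$ and every arrow is a $K$-linear combination of the $\partial_a(S)$. By the Derksen-Weyman-Zelevinsky splitting theorem every QP $(Q,S)$ with $Q$ loop-free admits a splitting, i.e. a right-equivalence $\varphi:(Q_{\rm red},S_{\rm red})\oplus(Q_{\rm triv},S_{\rm triv})\to(Q,S)$ with $Q=Q_{\rm red}\oplus Q_{\rm triv}$, first summand reduced and second trivial. For a $\mathcal P(Q,S)$-module $N$, $\varphi^{\#}(N)$ is $N$ with $u\in K\langle\langle Q_{\rm red}\rangle\rangle$ acting by $u\star_\varphi n:=\varphi(u)\cdot n$; it is a $\mathcal P(Q_{\rm red},S_{\rm red})$-module. Given a splitting $\varphi$ of $\widetilde\mu_k(Q,S)$, $\mu_k(Q,S):=(\widetilde\mu_k(Q)_{\rm red},\widetilde\mu_k(S)_{\rm red})$ and $\mu_k(\mathcal M):=(\varphi^{\#}(\overline M),\overline V)$. **Duality.** $Q^{\rm op}$ has the same vertices and an arrow $c^{\rm op}:h(c)\to t(c)$ for each $c\in Q_1$; $u\mapsto u^{\rm op}$ is the induced (path-reversing) anti-isomorphism $K\langle\langle Q\rangle\rangle\to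 K\langle\langle Q^{\rm op}\rangle\rangle$, and $S^{\rm op}$ is the image of $S$. With $?^\vee=\operatorname{Hom}_K(?,K)$, $\mathcal M^\vee=(M^\vee,V^\vee)$ is the decorated $\mathcal P(Q^{\rm op},S^{\rm op})$-module with $M^\vee_j=(M_j)^\vee$ and $u^{\rm op}$ acting as the transpose of $u_M$. The quivers $\widetilde\mu_k(Q^{\rm op})$ and $\widetilde\mu_k(Q)^{\rm op}$ are identified via $(c^{\rm op})^*=(c^* )^{\rm op}$, $[a^{\rm op}b^{\rm op}]=[ba]^{\rm op}$. If mutations of $(Q,S)$ and its modules are taken with respect to a splitting $\varphi$ of $\widetilde\mu_k(Q,S)$, those of $(Q^{\rm op},S^{\rm op})$ are taken with respect to the opposite splitting $u^{\rm op}\mapsto\varphi(u)^{\rm op}$ of $\widetilde\mu_k(Q^{\rm op},S^{\rm op})$. *)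

(* Defs.v *)
From HB Require Import structures.
From mathcomp Require Import all_boot all_order all_algebra.
From mathcomp Require Import boolp functions.

Set Implicit Arguments.
Unset Strict Implicit.
Unset Printing Implicit Defensive.

Import GRing.Theory.
Local Open Scope ring_scope.
Local Open Scope quotient_scope.

Section MkLin.
Variables (K : fieldType) (U V : lmodType K) (f : U -> V) (lf : linear f).
Definition mklin_fun of linear f : U -> V := f.
HB.instance Definition _ :=
  GRing.isLinear.Build K U V *:%R (mklin_fun lf) lf.
Definition mklin : {linear U -> V} := mklin_fun lf.
End MkLin.

Record subspace (K : fieldType) (V : lmodType K) := Subspace {
  sp_mem :> {pred V};
  sp_closed : submod_closed sp_mem }.

HB.instance Definition _ (K : fieldType) (V : lmodType K) (P : subspace V) :=
  GRing.isSubmodClosed.Build K V (sp_mem P) (sp_closed P).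

Section Sub.
Variables (K : fieldType) (V : lmodType K) (P : subspace V).
Record sub := InSub { incl : V; _ : incl \in sp_mem P }.
HB.instance Definition _ := [isSub for incl].
HB.instance Definition _ := [Choice of sub by <:].
HB.instance Definition _ := [SubChoice_isSubLmodule of sub by <:].
Lemma incl_is_linear : linear incl.
Proof. by move=> a x y; rewrite -[incl]/(val) linearP. Qed.
HB.instance Definition _ := GRing.isLinear.Build K sub V *:%R incl incl_is_linear.
End Sub.

Section Quo.
Variables (K : fieldType) (V : lmodType K) (P : subspace V).
Definition quo : Type := Quotient.quot (sp_mem P).
HB.instance Definition _ := GRing.Zmodule.on quo.
Definition qproj (x : V) : quo := \pi_(Quotient.quot (sp_mem P)) x.
Definition qrepr (x : quo) : V := repr (x : Quotient.quot (sp_mem P)).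

Lemma qreprK : cancel qrepr qproj.
Proof. by move=> x; rewrite /qproj reprK. Qed.

Lemma qproj_eqP x y : reflect (qproj x = qproj y) (x - y \in sp_mem P).
Proof. by rewrite Quotient.idealrBE; exact: eqP. Qed.

Lemma qprojD : {morph qproj : x y / x + y}.
Proof. by move=> x y; rewrite /qproj !piE. Qed.

Definition quo_scale (a : K) (x : quo) : quo := qproj (a *: qrepr x).

Lemma quo_scaleE a x : quo_scale a (qproj x) = qproj (a *: x).
Proof. by apply/qproj_eqP; rewrite -scalerBr rpredZ //; apply/qproj_eqP/qreprK. Qed.

Fact quo_scaleA a b x : quo_scale a (quo_scale b x) = quo_scale (a * b) x.
Proof. by rewrite -[x]qreprK !quo_scaleE scalerA. Qed.
Fact quo_scale1 : left_id 1 quo_scale.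
Proof. by move=> x; rewrite -[x]qreprK quo_scaleE scale1r. Qed.
Fact quo_scaleDr : right_distributive quo_scale +%R.
Proof.
move=> a x y; rewrite -[x]qreprK -[y]qreprK -qprojD !quo_scaleE -qprojD.
by rewrite scalerDr.
Qed.
Fact quo_scaleDl x : {morph quo_scale^~ x : a b / a + b}.
Proof. by move=> a b; rewrite -[x]qreprK !quo_scaleE scalerDl qprojD. Qed.
HB.instance Definition _ := GRing.Zmodule_isLmodule.Build K quo
  quo_scaleA quo_scale1 quo_scaleDr quo_scaleDl.

Lemma qproj_is_linear : linear qproj.
Proof. by move=> a x y; rewrite qprojD -quo_scaleE. Qed.
HB.instance Definition _ := GRing.isLinear.Build K V quo *:%R qproj qproj_is_linear.
End Quo.

Section SubspaceConstructions.
Variables (K : fieldType) (U V : lmodType K).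

Lemma ker_closed (f : {linear U -> V}) : submod_closed [pred x | f x == 0].
Proof.
split=> [|a x y]; rewrite !inE ?linear0 // => /eqP fx /eqP fy.
by rewrite linearP fx fy scaler0 addr0.
Qed.
Definition ker f := Subspace (ker_closed f).

Lemma im_closed (f : {linear U -> V}) :
  submod_closed [pred y | `[< exists x, f x = y >]].
Proof.
split=> [|a x y]; rewrite !inE; first by apply/asboolP; exists 0; rewrite linear0.
move=> /asboolP[x' <-] /asboolP[y' <-]; apply/asboolP.
by exists (a *: x' + y'); rewrite linearP.
Qed.
Definition im f := Subspace (im_closed f).

Lemma im_proof (f : {linear U -> V}) x : f x \in sp_mem (im f).
Proof. by rewrite inE; apply/asboolP; exists x. Qed.

Fact toim_linear (f : {linear U -> V}) :
  linear (fun x => InSub (im_proof f x) : sub (im f)).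
Proof. by move=> a x y; apply: val_inj; rewrite /= linearP. Qed.
Definition toim f := mklin (toim_linear f).

End SubspaceConstructions.

(* R :&: P, as a subspace of P *)
Section Within.
Variables (K : fieldType) (V : lmodType K) (R P : subspace V).
Lemma within_closed : submod_closed [pred x : sub P | incl x \in sp_mem R].
Proof.
split=> [|a x y]; rewrite !inE ?linear0 ?rpred0 // => Rx Ry.
by rewrite linearP; apply: rpredD => //; apply: rpredZ.
Qed.
Definition within := Subspace within_closed.
End Within.

(* The linear map induced by f on V / P; it is meaningful when f vanishes on P, *)
(* and is 0 by convention otherwise.                                            *)
Section Induced.
Variables (K : fieldType) (U V : lmodType K) (P : subspace V).
Variable f : {linear V -> U}.
Definition induced_fun (x : quo P) : U :=
  if `[< forall y, y \in sp_mem P -> f y = 0 >] then f (qrepr x) else 0.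
Fact induced_linear : linear induced_fun.
Proof.
move=> a x y; rewrite /induced_fun; case: asboolP => [fP|_]; last first.
  by rewrite scaler0 addr0.
rewrite -linearP; apply/eqP; rewrite -subr_eq0 -linearB; apply/eqP/fP.
by apply/qproj_eqP; rewrite qproj_is_linear !qreprK.
Qed.
Definition induced := mklin induced_linear.
End Induced.

(* f with its codomain restricted to P; it is meaningful when f takes its       *)
(* values in P, and is 0 by convention otherwise.                               *)
Section Corestrict.
Variables (K : fieldType) (U V : lmodType K) (P : subspace V).
Variable f : {linear U -> V}.
Definition corestrict_fun (x : U) : sub P :=
  if `[< forall y, f y \in sp_mem P >] then insubd 0 (f x) else 0.
Fact corestrict_linear : linear corestrict_fun.
Proof.
move=> a x y; rewrite /corestrict_fun; case: asboolP => [fP|_]; last first.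
  by rewrite scaler0 addr0.
have E z : incl (insubd (0 : sub P) (f z)) = f z.
  by rewrite -[incl _]/(val _) val_insubd fP.
apply: val_inj; rewrite -[LHS]/(incl _) -[RHS]/(incl _) incl_is_linear.
by rewrite !E linearP.
Qed.
Definition corestrict := mklin corestrict_linear.
End Corestrict.

Section DSum.
Variables (K : fieldType) (T : finType) (V : T -> lmodType K).
Definition dsum : Type := forall i, V i.
HB.instance Definition _ := Choice.on dsum.
Implicit Types x y z : dsum.
Let add x y : dsum := fun i => x i + y i.
Let opp x : dsum := fun i => - x i.
Let scale (a : K) x : dsum := fun i => a *: x i.
Let eqd x y : (forall i, x i = y i) -> x = y.
Proof. exact: functional_extensionality_dep. Qed.
Fact dsum_addA : associative add.
Proof. by move=> x y z; apply: eqd => i; exact: addrA. Qed.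
Fact dsum_addC : commutative add.
Proof. by move=> x y; apply: eqd => i; exact: addrC. Qed.
Fact dsum_add0 : left_id (fun i => 0) add.
Proof. by move=> x; apply: eqd => i; exact: add0r. Qed.
Fact dsum_addN : left_inverse (fun i => 0) opp add.
Proof. by move=> x; apply: eqd => i; exact: addNr. Qed.
HB.instance Definition _ :=
  GRing.isZmodule.Build dsum dsum_addA dsum_addC dsum_add0 dsum_addN.
Fact dsum_scaleA a b x : scale a (scale b x) = scale (a * b) x.
Proof. by apply: eqd => i; exact: scalerA. Qed.
Fact dsum_scale1 : left_id 1 scale.
Proof. by move=> x; apply: eqd => i; exact: scale1r. Qed.
Fact dsum_scaleDr : right_distributive scale +%R.
Proof. by move=> a x y; apply: eqd => i; exact: scalerDr. Qed.
Fact dsum_scaleDl x : {morph scale^~ x : a b / a + b}.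
Proof. by move=> a b; apply: eqd => i; exact: scalerDl. Qed.
HB.instance Definition _ := GRing.Zmodule_isLmodule.Build K dsum
  dsum_scaleA dsum_scale1 dsum_scaleDr dsum_scaleDl.

Variable W : lmodType K.
(* [f_1 ... f_s] : V_1 (+) ... (+) V_s -> W *)
Fact row_linear (f : forall i, {linear V i -> W}) :
  linear (fun x : dsum => \sum_i f i (x i)).
Proof.
move=> a x y; rewrite scaler_sumr -big_split; apply: eq_bigr => i _ /=.
by rewrite -linearP.
Qed.
Definition row_map f := mklin (row_linear f).
(* [f_1 ... f_r]^T : W -> V_1 (+) ... (+) V_r *)
Fact col_linear (f : forall i, {linear W -> V i}) :
  linear (fun w => (fun i => f i w) : dsum).
Proof. by move=> a x y; apply: eqd => i; exact: linearP. Qed.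
Definition col_map f := mklin (col_linear f).
Fact component_linear i : linear (fun x : dsum => x i).
Proof. by []. Qed.
Definition component i := mklin (component_linear i).
End DSum.
Arguments component {K T V} i.

Section Inj.
Variables (K : fieldType) (U V : lmodType K).
Fact inj1_linear : linear (fun x => (x, 0) : U * V).
Proof. by move=> a x y; congr (_, _); rewrite /= scaler0 addr0. Qed.
Definition inj1 := mklin inj1_linear.
Fact inj2_linear : linear (fun x => (0, x) : U * V).
Proof. by move=> a x y; congr (_, _); rewrite /= scaler0 addr0. Qed.
Definition inj2 := mklin inj2_linear.
End Inj.

Section Dual.
Variables (K : fieldType) (M : lmodType K).
Lemma dual_closed : submod_closed [pred f : M -> K^o | `[< linear f >]].
Proof.
split=> [|a f g]; rewrite !inE.
  by apply/asboolP => b x y; rewrite /= scaler0 addr0.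
move=> /asboolP lf /asboolP lg; apply/asboolP => b x y /=.
rewrite [LHS]/(a *: f _ + g _) lf lg [X in _ = b *: X + _]/(a *: f x + g x).
rewrite [X in _ = _ + X]/(a *: f y + g y) !scalerDr !scalerA (mulrC a b).
by rewrite addrACA.
Qed.
Definition dual : Type := sub (Subspace dual_closed).
HB.instance Definition _ := GRing.Lmodule.on dual.
Definition dual_app (f : dual) (x : M) : K := incl f x.
Lemma dual_app_linear (f : dual) : linear (dual_app f : M -> K^o).
Proof. by case: f => f lf; have := lf; rewrite inE => /asboolP. Qed.
Definition mkdual (f : M -> K) (lf : linear (f : M -> K^o)) : dual :=
  @InSub _ _ (Subspace dual_closed) f (introT (asboolP _) lf).
End Dual.

Section Transpose.
Variables (K : fieldType) (M N : lmodType K) (g : {linear M -> N}).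
Fact transpose_proof (f : dual N) :
  linear ((fun x => dual_app f (g x)) : M -> K^o).
Proof. by move=> a x y; rewrite linearP dual_app_linear. Qed.
Fact transpose_linear : linear (fun f => mkdual (transpose_proof f)).
Proof. by move=> a f f'; apply: val_inj. Qed.
Definition transpose : {linear dual N -> dual M} := mklin transpose_linear.
End Transpose.

(* Vertices form the finite type Q0; the arrow a goes from tl a to hd a. *)
Record quiver (Q0 : finType) := Quiver {
  arrow :> finType;
  hd : arrow -> Q0;
  tl : arrow -> Q0 }.
Arguments hd {Q0 q} _.
Arguments tl {Q0 q} _.

Section Quivers.
Variable Q0 : finType.
Implicit Types Q : quiver Q0.

Definition loopfree Q := forall a : Q, hd a <> tl a.

Definition no_2cycle_at (k : Q0) Q :=
  forall a b : Q, hd a = k -> tl b = k -> hd b <> tl a.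

(* walk i w j: the word w = c_1 ... c_d is a path from j to i, paths being    *)
(* composed like functions, so that tl c_m = hd c_(m+1).                      *)
Fixpoint walk Q (i : Q0) (w : seq Q) (j : Q0) : bool :=
  if w is c :: w' then (hd c == i) && walk (tl c) w' j else i == j.

Definition opq Q : quiver Q0 := Quiver (@tl _ Q) (@hd _ Q).

Definition sumq Q Q' : quiver Q0 := @Quiver Q0 (Q + Q')%type
  (fun c => match c with inl a => hd a | inr a => hd a end)
  (fun c => match c with inl a => tl a | inr a => tl a end).

Definition quiver_iso Q Q' :=
  exists f : Q -> Q',
    [/\ bijective f, forall a, hd (f a) = hd a & forall a, tl (f a) = tl a].

End Quivers.

(* An element u of the complete path algebra: coef u i w j is the coefficient *)
(* of the path w from j to i. Recording both end points gives the paths of    *)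
(* length 0 their own coefficients coef u i [::] i.                           *)
Definition is_series (K : fieldType) (Q0 : finType) (Q : quiver Q0)
    (f : Q0 -> seq Q -> Q0 -> K^o) :=
  forall i w j, ~~ walk i w j -> f i w j = 0.

Section Series.
Variables (K : fieldType) (Q0 : finType) (Q : quiver Q0).
Local Notation cfun := (Q0 -> seq Q -> Q0 -> K^o).

Fact series_closed : submod_closed [pred f : cfun | `[< is_series f >]].
Proof.
split=> [|a f g]; rewrite !inE; first exact/asboolP.
move=> /asboolP f0 /asboolP g0; apply/asboolP => i w j nw.
have -> : (a *: f + g) i w j = a * f i w j + g i w j by [].
by rewrite (f0 _ _ _ nw) (g0 _ _ _ nw) mulr0 add0r.
Qed.

Definition series_sub := Subspace series_closed.
Record series := Series { rawcoef : cfun; _ : rawcoef \in sp_mem series_sub }.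
HB.instance Definition _ := [isSub for rawcoef].
HB.instance Definition _ := [Choice of series by <:].
HB.instance Definition _ := [SubChoice_isSubLmodule of series by <:].

Definition coef (u : series) i w j : K := rawcoef u i w j.

Lemma coef_notwalk (u : series) i w j : ~~ walk i w j -> coef u i w j = 0.
Proof. by case: u => u su; have := su; rewrite inE => /asboolP; apply. Qed.

Lemma seriesP (u v : series) :
  (forall i w j, walk i w j -> coef u i w j = coef v i w j) -> u = v.
Proof.
move=> uv; apply: val_inj; apply/funext => i; apply/funext => w.
apply/funext => j; rewrite -[LHS]/(coef u i w j) -[RHS]/(coef v i w j).
have [/uv//|nw] := boolP (walk i w j).
by rewrite !coef_notwalk.
Qed.

Lemma coefD (u v : series) i w j : coef (u + v) i w j = coef u i w j + coef v i w j.
Proof. by []. Qed.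
Lemma coefZ a (u : series) i w j : coef (a *: u) i w j = a * coef u i w j.
Proof. by []. Qed.
Lemma coef0 i w j : coef 0 i w j = 0.
Proof. by []. Qed.

(* The series with coefficient f i w j at each path w from j to i. *)
Definition mkcoef (f : Q0 -> seq Q -> Q0 -> K) : cfun :=
  fun i w j => if walk i w j then f i w j else 0.
Fact mkcoef_proof f : mkcoef f \in sp_mem series_sub.
Proof. by rewrite inE; apply/asboolP => i w j nw; rewrite /mkcoef (negPf nw). Qed.
Definition mkseries f := Series (mkcoef_proof f).

Lemma coef_mk f i w j :
  coef (mkseries f) i w j = if walk i w j then f i w j else 0.
Proof. by []. Qed.

Arguments coef : simpl never.

Definition conv (u v : series) i w j : K :=
  \sum_(l : Q0) \sum_(n < (size w).+1) coef u i (take n w) l * coef v l (drop n w) j.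
Definition series_mul u v := mkseries (conv u v).
Definition series_one := mkseries (fun i w j => ((w == [::]) && (i == j))%:R).

Lemma walk_cat i (w1 w2 : seq Q) l j :
  walk i w1 l -> walk l w2 j -> walk i (w1 ++ w2) j.
Proof.
by elim: w1 i => [i /eqP->|c w1 IH i /= /andP[-> /IH]].
Qed.

Lemma coef_mul u v i w j : coef (series_mul u v) i w j = conv u v i w j.
Proof.
rewrite coef_mk; case: ifP => // nw; rewrite /conv big1 // => l _.
rewrite big1 // => n _; have [w1|w1] := boolP (walk i (take n w) l); last first.
  by rewrite coef_notwalk // mul0r.
rewrite (@coef_notwalk v) ?mulr0 //; apply/negP => /(walk_cat w1).
by rewrite cat_take_drop nw.
Qed.

Definition splitsum (F : seq Q -> seq Q -> K) w :=
  \sum_(n < (size w).+1) F (take n w) (drop n w).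

Lemma splitsum_nil F : splitsum F [::] = F [::] [::].
Proof. by rewrite /splitsum big_ord1. Qed.
Lemma splitsum_cons F c w :
  splitsum F (c :: w) = F [::] (c :: w) + splitsum (fun x y => F (c :: x) y) w.
Proof. by rewrite /splitsum big_ord_recl. Qed.
Lemma eq_splitsum F G w : F =2 G -> splitsum F w = splitsum G w.
Proof. by move=> FG; apply: eq_bigr. Qed.
Lemma splitsumD F G w :
  splitsum (fun x y => F x y + G x y) w = splitsum F w + splitsum G w.
Proof. exact: big_split. Qed.

Lemma splitsumA (G : seq Q -> seq Q -> seq Q -> K) w :
  splitsum (fun x r => splitsum (fun p q => G p q r) x) w =
  splitsum (fun p y => splitsum (fun q r => G p q r) y) w.
Proof.
elim: w G => [|c w IH] G; first by rewrite !splitsum_nil.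
rewrite !splitsum_cons splitsum_nil -addrA; congr (_ + _).
rewrite -IH -splitsumD; apply: eq_splitsum => x r; exact: splitsum_cons.
Qed.

Lemma convE u v i w j : conv u v i w j =
  splitsum (fun x y => \sum_l coef u i x l * coef v l y j) w.
Proof. by rewrite /conv exchange_big. Qed.

Fact series_mulA : associative series_mul.
Proof.
move=> u v t; apply: seriesP => i w j _; rewrite !coef_mul !convE.
transitivity (splitsum (fun p y => splitsum (fun q r =>
    \sum_l \sum_m coef u i p l * coef v l q m * coef t m r j) y) w).
  apply: eq_splitsum => p y; rewrite /splitsum exchange_big; apply: eq_bigr => l _.
  rewrite coef_mul convE /splitsum mulr_sumr; apply: eq_bigr => n _.
  by rewrite mulr_sumr; apply: eq_bigr => m _; rewrite mulrA.
rewrite -splitsumA; apply: eq_splitsum => x r.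
rewrite /splitsum (eq_bigr _ (fun n _ => exchange_big _ _ _ _ _ _)) exchange_big.
apply: eq_bigr => m _; rewrite coef_mul convE /splitsum mulr_suml.
by apply: eq_bigr => n _; rewrite mulr_suml.
Qed.

Lemma coef_one i w j : coef series_one i w j = ((w == [::]) && (i == j))%:R.
Proof.
rewrite /series_one coef_mk; case: ifP => //.
by case: w => //= ->.
Qed.

Fact series_mul1l : left_id series_one series_mul.
Proof.
move=> u; apply: seriesP => i w j _; rewrite coef_mul /conv (bigD1 i) //=.
rewrite [X in _ + X]big1 ?addr0 => [|l il]; last first.
  by apply: big1 => n _; rewrite coef_one [i == l]eq_sym (negPf il) andbF mul0r.
rewrite big_ord_recl /= take0 drop0 coef_one !eqxx mul1r.
rewrite big1 ?addr0 // => n _; rewrite coef_one.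
by case: w n => [[]//|c w] n; rewrite mul0r.
Qed.

Fact series_mul1r : right_id series_one series_mul.
Proof.
move=> u; apply: seriesP => i w j _; rewrite coef_mul /conv (bigD1 j) //=.
rewrite [X in _ + X]big1 ?addr0 => [|l lj]; last first.
  by apply: big1 => n _; rewrite coef_one (negPf lj) andbF mulr0.
rewrite big_ord_recr /= take_size drop_size coef_one !eqxx mulr1.
rewrite big1 ?add0r // => n _; rewrite coef_one.
by rewrite -size_eq0 size_drop subn_eq0 leqNgt ltn_ord mulr0.
Qed.

Fact series_mulDl : left_distributive series_mul +%R.
Proof.
move=> u v t; apply: seriesP => i w j _; rewrite coefD !coef_mul /conv.
rewrite -big_split; apply: eq_bigr => l _; rewrite -big_split.
by apply: eq_bigr => n _; rewrite coefD mulrDl.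
Qed.
Fact series_mulDr : right_distributive series_mul +%R.
Proof.
move=> u v t; apply: seriesP => i w j _; rewrite coefD !coef_mul /conv.
rewrite -big_split; apply: eq_bigr => l _; rewrite -big_split.
by apply: eq_bigr => n _; rewrite coefD mulrDr.
Qed.
HB.instance Definition _ := GRing.Zmodule_isPzRing.Build series
  series_mulA series_mul1l series_mul1r series_mulDl series_mulDr.

Lemma coefM (u v : series) i w j : coef (u * v) i w j =
  \sum_(l : Q0) \sum_(n < (size w).+1) coef u i (take n w) l * coef v l (drop n w) j.
Proof. exact: coef_mul. Qed.

(* The path w from j to i (0 if w is not one); e_j; the arrow c. *)
Definition path_series i w j : series :=
  mkseries (fun i' w' j' => [&& i' == i, w' == w & j' == j]%:R).
Definition vtx j := path_series j [::] j.
Definition arr (c : Q) := path_series (hd c) [:: c] (tl c).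
Definition vtxC (k : Q0) : series := 1 - vtx k.

(* u \in m^n, for m the ideal generated by the arrows *)
Definition mpow n (u : series) := forall i w j, (size w < n)%N -> coef u i w j = 0.

Definition mclosure (X : series -> Prop) (u : series) :=
  forall n, exists2 x, X x & mpow n (u - x).

Definition ideal_gen (G : series -> Prop) (u : series) :=
  exists (n : nat) (x g y : 'I_n -> series),
    (forall l, G (g l)) /\ u = \sum_l x l * g l * y l.

Definition lin_span (G : series -> Prop) (u : series) :=
  exists (n : nat) (z : 'I_n -> K) (g : 'I_n -> series),
    (forall l, G (g l)) /\ u = \sum_l z l *: g l.

Definition is_potential (S : series) :=
  forall i w j, coef S i w j != 0 -> i = j /\ w <> [::].

(* c_1 c_2 ... c_d - c_2 ... c_d c_1 for a cyclic path c_1 ... c_d *)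
Definition is_rotdiff (u : series) :=
  exists (c : Q) (w : seq Q), walk (hd c) (c :: w) (hd c) /\
    u = path_series (hd c) (c :: w) (hd c) - path_series (tl c) (rcons w c) (tl c).

Definition cyc_equiv (S T : series) :=
  [/\ is_potential S, is_potential T & mclosure (lin_span is_rotdiff) (S - T)].

(* Cyclic derivatives. The coefficient of the path w in d_a(S) collects the    *)
(* cycles c and the positions n in c such that reading c cyclically from the   *)
(* position n gives a w, hence such that removing the letter a there leaves w; *)
(* similarly for d_ba(S) with the two letters b a.                             *)
Definition cder (a : Q) (S : series) : series := mkseries (fun i w j =>
  if (i == tl a) && (j == hd a) then
    \sum_(v : Q0) \sum_(c : (size w).+1.-tuple Q)
      \sum_(n < (size w).+1 | rot n c == a :: w) coef S v c v
  else 0).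

Definition cder2 (b a : Q) (S : series) : series := mkseries (fun i w j =>
  if (i == tl a) && (j == hd b) then
    \sum_(v : Q0) \sum_(c : (size w).+2.-tuple Q)
      \sum_(n < (size w).+2 | rot n c == [:: b, a & w]) coef S v c v
  else 0).

Definition jacobian (S : series) : series -> Prop :=
  mclosure (ideal_gen (fun u => exists a, u = cder a S)).

End Series.

Section Premutation.
Variable Q0 : finType.
Implicit Types (Q : quiver Q0) (k : Q0).

Definition keeparr k Q := {c : Q | (hd c != k) && (tl c != k)}.
Definition inarr k Q := {a : Q | hd a == k}.
Definition outarr k Q := {b : Q | tl b == k}.

(* The arrows of the premutation at k. Comp b a is [ba], StarIn a is a^* and  *)
(* StarOut b is b^*; in a loop-free quiver each arrow incident to k is either *)
(* in inarr or in outarr, but not in both.                                    *)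
Inductive parrow k Q :=
| Keep of keeparr k Q
| Comp of outarr k Q & inarr k Q
| StarIn of inarr k Q
| StarOut of outarr k Q.

Section ParrowFin.
Variables (k : Q0) (Q : quiver Q0).
Definition parrow_enc (c : parrow k Q) :
    keeparr k Q + outarr k Q * inarr k Q + (inarr k Q + outarr k Q) :=
  match c with
  | Keep c => inl (inl c)
  | Comp b a => inl (inr (b, a))
  | StarIn a => inr (inl a)
  | StarOut b => inr (inr b)
  end.
Definition parrow_dec (s : keeparr k Q + outarr k Q * inarr k Q +
                           (inarr k Q + outarr k Q)) : parrow k Q :=
  match s with
  | inl (inl c) => Keep c
  | inl (inr (b, a)) => Comp b a
  | inr (inl a) => StarIn a
  | inr (inr b) => StarOut b
  end.
Lemma parrow_encK : cancel parrow_enc parrow_dec.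
Proof. by case. Qed.
HB.instance Definition _ := Finite.copy (parrow k Q) (can_type parrow_encK).
End ParrowFin.

Definition premut k Q : quiver Q0 := @Quiver Q0 (parrow k Q)
  (fun c => match c with
    | Keep c => hd (val c) | Comp b a => hd (val b)
    | StarIn a => tl (val a) | StarOut b => tl (val b) end)
  (fun c => match c with
    | Keep c => tl (val c) | Comp b a => tl (val a)
    | StarIn a => hd (val a) | StarOut b => hd (val b) end).

(* The quiver obtained by deleting the vertex k and all arrows incident to it. *)
Definition delq k Q : quiver {j : Q0 | j != k} := @Quiver _ (keeparr k Q)
  (fun c => exist _ (hd (val c)) (proj1 (andP (valP c))))
  (fun c => exist _ (tl (val c)) (proj2 (andP (valP c)))).

Definition is_star k Q (c : parrow k Q) : bool :=
  match c with StarIn _ | StarOut _ => true | _ => false end.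

(* The path of Q that a non-starred arrow of the premutation abbreviates. *)
Definition expand k Q (c : parrow k Q) : seq Q :=
  match c with
  | Keep c => [:: val c]
  | Comp b a => [:: val b; val a]
  | _ => [::]
  end.

End Premutation.

Section PremutationPotential.
Variables (K : fieldType) (Q0 : finType) (k : Q0) (Q : quiver Q0).
Implicit Type S : series K Q.

(* [S]: the coefficient of a path is that of the path of Q it abbreviates *)
Definition bracket S : series K (premut k Q) := mkseries (fun i (w : seq (premut k Q)) j =>
  if has (@is_star _ k Q) w then 0 else coef S i (flatten (map (@expand _ k Q) w)) j).

Definition Delta : series K (premut k Q) :=
  \sum_(b : outarr k Q) \sum_(a : inarr k Q)
    @arr K _ (premut k Q) (StarOut b) * @arr K _ (premut k Q) (Comp b a) *
    @arr K _ (premut k Q) (StarIn a).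

Definition is_premutation S (T : series K (premut k Q)) :=
  exists S', [/\ cyc_equiv S S', forall w, coef S' k w k = 0 &
    T = bracket S' + Delta].

(* kappa: e_hat K<<Q>> e_hat -> K<<e_hat premut_k(Q) e_hat>>, replacing each    *)
(* length-2 path ba through k by the arrow [ba]; it only reads the             *)
(* coefficients of paths between vertices other than k.                        *)
Definition kappa S : series K (delq k (premut k Q)) :=
  mkseries (fun i (w : seq (delq k (premut k Q))) j =>
  coef S (val i) (flatten [seq expand (val c : parrow k Q) | c <- w]) (val j)).

End PremutationPotential.

(* The continuous algebra homomorphism determined by e_i |-> e_(g i) on        *)
(* vertices and c |-> f c on arrows, when every f c lies in the ideal          *)
(* generated by the arrows and goes from g (tl c) to g (hd c): the words of    *)
(* length > size w then do not contribute to the coefficient of w.             *)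
Section Subst.
Variables (K : fieldType) (Q0' Q0 : finType).
Variables (Q' : quiver Q0') (Q : quiver Q0).
Variables (g : Q0' -> Q0) (f : Q' -> series K Q).
Definition subst (u : series K Q') : series K Q := mkseries (fun i w j =>
  \sum_(i' : Q0') \sum_(j' : Q0') \sum_(n < (size w).+1) \sum_(v : n.-tuple Q')
    coef u i' v j' * coef (vtx K Q (g i') * \prod_(c <- v) f c) i w j).
End Subst.

Section Psi.
Variables (K : fieldType) (Q0 : finType) (k : Q0) (Q : quiver Q0) (S : series K Q).

(* c |-> c, [ba] |-> ba, [a^* b^*] |-> - d_ba(S); when Q has no loop and no     *)
(* 2-cycle at k there are no other arrows.                                     *)
Definition psi_arr (c : delq k (premut k (premut k Q))) : series K Q :=
  match val c with
  | Keep d =>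
    match val d with
    | Keep c' => arr K (val c')
    | Comp b a => arr K (val b) * arr K (val a)
    | _ => 0
    end
  | Comp y x =>
    match val y, val x with
    | StarIn a, StarOut b => - cder2 (val b) (val a) S
    | _, _ => 0
    end
  | _ => 0
  end.

Definition psi : series K (delq k (premut k (premut k Q))) -> series K Q :=
  subst (fun j => val j) psi_arr.

Definition psikappa (u : series K (premut k Q)) : series K Q := psi (kappa k u).

End Psi.

Section QP.
Variables (K : fieldType) (Q0 : finType).
Implicit Types Q : quiver Q0.

Definition qp := {Q : quiver Q0 & series K Q}.

Definition is_reduced Q (S : series K Q) :=
  forall i w j, size w = 2 -> coef S i w j = 0.

Definition is_trivial Q (S : series K Q) :=
  (forall i w j, size w <> 2 -> coef S i w j = 0) /\
  (forall c : Q, exists z : Q -> K, arr K c = \sum_a z a *: cder a S).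

Definition sinl Q Q' (u : series K Q) : series K (sumq Q Q') :=
  mkseries (fun i (w : seq (sumq Q Q')) j =>
    let w' : seq Q := pmap (fun c => if c is inl a then Some a else None) w in
    if map inl w' == w then coef u i w' j else 0).
Definition sinr Q Q' (u : series K Q') : series K (sumq Q Q') :=
  mkseries (fun i (w : seq (sumq Q Q')) j =>
    let w' : seq Q' := pmap (fun c => if c is inr a then Some a else None) w in
    if map inr w' == w then coef u i w' j else 0).

Definition ring_iso Q' Q (phi : series K Q' -> series K Q) :=
  [/\ linear phi, phi 1 = 1, {morph phi : u v / u * v},
      forall j, phi (vtx K Q' j) = vtx K Q j & bijective phi].

Definition right_equiv Q' (S' : series K Q') Q (S : series K Q)
    (phi : series K Q' -> series K Q) :=
  ring_iso phi /\ cyc_equiv (phi S') S.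

Record splitting Q := Splitting {
  redQ : quiver Q0;
  redS : series K redQ;
  trivQ : quiver Q0;
  trivS : series K trivQ;
  split_map : series K (sumq redQ trivQ) -> series K Q }.

Definition is_splitting Q (S : series K Q) (s : splitting Q) :=
  [/\ quiver_iso (sumq (redQ s) (trivQ s)) Q,
      is_potential (redS s) /\ is_reduced (redS s),
      is_potential (trivS s) /\ is_trivial (trivS s) &
      right_equiv (sinl _ (redS s) + sinr _ (trivS s)) S (@split_map _ s)].

(* mu_k(Q, S), when s is a splitting of the premutation of (Q, S) *)
Definition red_qp Q (s : splitting Q) : qp := existT _ (redQ s) (redS s).

End QP.

Section Opposite.
Variables (K : fieldType) (Q0 : finType).
Implicit Types (Q : quiver Q0) (k : Q0).

Definition opser Q (u : series K Q) : series K (opq Q) :=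
  mkseries (fun i (w : seq (opq Q)) j => coef u j (rev w) i).
Definition unopser Q (u : series K (opq Q)) : series K Q :=
  mkseries (fun i (w : seq Q) j => coef u j (rev w) i).

Definition op_qp (X : qp K Q0) : qp K Q0 :=
  existT _ (opq (projT1 X)) (opser (projT2 X)).

(* The identification of the arrows of premut_k(Q^op) with those of            *)
(* premut_k(Q)^op: the arrow d of premut_k(Q^op) is (op_arrow d)^op.           *)
Definition op_arrow k Q (d : premut k (opq Q)) : premut k Q :=
  match d with
  | Keep c => Keep (exist _ (val c : Q) (etrans (andbC _ _) (valP c)))
  | Comp b a => Comp (a : outarr k Q) (b : inarr k Q)
  | StarIn a => StarOut (a : outarr k Q)
  | StarOut b => StarIn (b : inarr k Q)
  end.

(* u |-> u^op, from K<<premut_k(Q)>> to K<<premut_k(Q^op)>> *)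
Definition premut_op k Q (u : series K (premut k Q)) :
    series K (premut k (opq Q)) :=
  mkseries (fun i (w : seq (premut k (opq Q))) j =>
    coef u j (rev (map (@op_arrow k Q) w)) i).

Definition op_splitting k Q (s : splitting K (premut k Q)) :
    splitting K (premut k (opq Q)) :=
  @Splitting K Q0 (premut k (opq Q)) (opq (redQ s)) (opser (redS s))
    (opq (trivQ s)) (opser (trivS s))
    (fun v : series K (opq (sumq (redQ s) (trivQ s))) =>
       premut_op (split_map (unopser v))).

End Opposite.

(* A K-vector space with a K-linear endomorphism for each element of A. The     *)
(* module axioms are the separate predicates is_algebra_action and is_Pmodule.  *)
Record action (K : fieldType) (A : Type) := Action {
  space :> lmodType K;
  act : A -> {linear space -> space} }.

Section Actions.
Variable K : fieldType.

Definition is_algebra_action (A : lmodType K) (one : A) (mul : A -> A -> A)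
    (M : action K A) :=
  [/\ forall x, linear (fun u => act M u x),
      forall x, act M one x = x &
      forall u v x, act M (mul u v) x = act M u (act M v x)].

Definition pull_action (A A' : Type) (f : A' -> A) (M : action K A) : action K A' :=
  @Action K A' (space M) (fun u => act M (f u)).

(* Hom_K(M, K), on which u in A' acts as the transpose of f u *)
Definition dual_action (A A' : Type) (f : A' -> A) (M : action K A) : action K A' :=
  @Action K A' (dual M) (fun u => transpose (act M (f u))).

Definition action_iso (A : Type) (M N : action K A) :=
  exists f : {linear M -> N},
    bijective f /\ forall u x, f (act M u x) = act N u (f x).

End Actions.

Section Modules.
Variables (K : fieldType) (Q0 : finType).
Implicit Types Q : quiver Q0.

(* A P(Q,S)-module: a module over K<<Q>> annihilated by J(S). *)
Definition is_Pmodule Q (S : series K Q) (M : action K (series K Q)) :=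
  @is_algebra_action K (series K Q) 1 *%R M /\ forall u, jacobian S u -> forall x, act M u x = 0.

Definition KQ0 := {ffun Q0 -> K^o}.
Definition eKQ0 (j : Q0) : KQ0 := [ffun i => (i == j)%:R].

Record decorated Q := Decorated {
  dmod : action K (series K Q);
  ddec : action K KQ0 }.

Definition is_decorated_Pmodule Q (S : series K Q) (D : decorated Q) :=
  is_Pmodule S (dmod D) /\ @is_algebra_action K KQ0 1 *%R (ddec D).

Definition decorated_iso Q (D E : decorated Q) :=
  action_iso (dmod D) (dmod E) /\ action_iso (ddec D) (ddec E).

Definition decorated_dual Q (D : decorated Q) : decorated (opq Q) :=
  Decorated (dual_action (@unopser K Q0 Q) (dmod D)) (dual_action id (ddec D)).

End Modules.

Section Completion.
Variables (K : fieldType) (Min Mout Mk Vk : lmodType K).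
Variables (alpha : {linear Min -> Mk}) (beta : {linear Mk -> Mout}).
Variable gamma : {linear Mout -> Min}.

Record completion := Completion {
  bar_space : lmodType K;
  bar_alpha : {linear Mout -> bar_space};
  bar_beta : {linear bar_space -> Min} }.

Definition kergamma_imbeta : lmodType K := quo (within (im beta) (ker gamma)).
Definition keralpha_imgamma : lmodType K := quo (within (im gamma) (ker alpha)).
Definition cokerbeta : lmodType K := quo (im beta).

Variable rho : {linear Mout -> sub (ker gamma)}.
Variable sigma : {linear keralpha_imgamma -> sub (ker alpha)}.

Definition is_retraction := forall x : sub (ker gamma), rho (incl x) = x.
Definition is_section := forall x, qproj (within (im gamma) (ker alpha)) (sigma x) = x.

Local Notation p := (qproj (within (im beta) (ker gamma))).

Definition spaceA : lmodType K :=
  (kergamma_imbeta * sub (im gamma) * keralpha_imgamma * Vk)%type.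
Fact alphaA_linear :
  linear (fun x => (- p (rho x), - toim gamma x, 0, 0) : spaceA).
Proof.
move=> a x y; congr (_, _, _, _) => /=; rewrite ?scaler0 ?addr0 // scalerN -opprD;
  by congr (- _); rewrite !linearP.
Qed.
Fact betaA_linear : linear (fun x : spaceA =>
  let: (_, y, z, _) := x in incl y + incl (sigma z)).
Proof.
by move=> a [[[x y] z] v] [[[x' y'] z'] v'] /=; rewrite !linearP addrACA scalerDr.
Qed.
Definition completionA := Completion (mklin alphaA_linear) (mklin betaA_linear).

Definition spaceB : lmodType K := (kergamma_imbeta * sub (ker alpha) * Vk)%type.
Fact alphaB_linear :
  linear (fun x => (- p (rho x), - corestrict (ker alpha) gamma x, 0) : spaceB).
Proof.
move=> a x y; congr (_, _, _) => /=; rewrite ?scaler0 ?addr0 // scalerN -opprD;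
  by congr (- _); rewrite !linearP.
Qed.
Fact betaB_linear : linear (fun x : spaceB => let: (_, y, _) := x in incl y).
Proof. move=> a [[x y] v] [[x' y'] v']; exact: incl_is_linear. Qed.
Definition completionB := Completion (mklin alphaB_linear) (mklin betaB_linear).

Definition spaceC : lmodType K := (cokerbeta * keralpha_imgamma * Vk)%type.
Fact alphaC_linear : linear (fun x => (- qproj (im beta) x, 0, 0) : spaceC).
Proof.
move=> a x y; congr (_, _, _) => /=; rewrite ?scaler0 ?addr0 // scalerN -opprD;
  by congr (- _); rewrite !linearP.
Qed.
Fact betaC_linear : linear (fun x : spaceC =>
  let: (y, z, _) := x in induced (im beta) gamma y + incl (sigma z)).
Proof.
by move=> a [[y z] v] [[y' z'] v'] /=; rewrite !linearP addrACA scalerDr.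
Qed.
Definition completionC := Completion (mklin alphaC_linear) (mklin betaC_linear).

End Completion.

Inductive description := DescA | DescB | DescC.

Definition completion_of (K : fieldType) (Min Mout Mk Vk : lmodType K)
    (alpha : {linear Min -> Mk}) (beta : {linear Mk -> Mout})
    (gamma : {linear Mout -> Min}) (d : description)
    (rho : {linear Mout -> sub (ker gamma)})
    (sigma : {linear keralpha_imgamma alpha gamma -> sub (ker alpha)}) :
    completion Min Mout :=
  match d with
  | DescA => completionA Vk beta rho sigma
  | DescB => completionB Vk alpha beta rho
  | DescC => completionC Vk beta sigma
  end.

Section Mutation.
Variables (K : fieldType) (Q0 : finType) (k : Q0) (Q : quiver Q0).
Variables (S : series K Q) (D : decorated K Q).
Local Notation M := (dmod D).
Local Notation V := (ddec D).

(* M_j = e_j M *)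
Definition piece (j : Q0) : lmodType K := sub (im (act M (vtx K Q j))).

(* the component M_j -> M_i of the action of u *)
Definition block (u : series K Q) (i j : Q0) : {linear piece j -> piece i} :=
  toim (act M (vtx K Q i)) \o (act M u \o @incl K M (im (act M (vtx K Q j)))).

Definition Min : lmodType K := dsum (fun a : inarr k Q => piece (tl (val a))).
Definition Mout : lmodType K := dsum (fun b : outarr k Q => piece (hd (val b))).

Definition alpha : {linear Min -> piece k} :=
  row_map (fun a : inarr k Q => block (arr K (val a)) k (tl (val a))).
Definition beta : {linear piece k -> Mout} :=
  col_map (fun b : outarr k Q => block (arr K (val b)) (hd (val b)) k).
Definition gamma : {linear Mout -> Min} :=
  col_map (fun a : inarr k Q => row_map (fun b : outarr k Q =>
    block (cder2 (val b) (val a) S) (tl (val a)) (hd (val b)))).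

Definition Vpiece (j : Q0) : lmodType K := sub (im (act V (eKQ0 K j))).

Definition rho_type := {linear Mout -> sub (ker gamma)}.
Definition sigma_type := {linear keralpha_imgamma alpha gamma -> sub (ker alpha)}.

Variables (d : description) (rho : rho_type) (sigma : sigma_type).

Definition bar_k : completion Min Mout :=
  completion_of (Vpiece k) beta d rho sigma.

(* e_hat M = (+)_(j <> k) M_j *)
Definition Mhat : lmodType K := sub (im (act M (vtxC K Q k))).
Definition to_Mhat : {linear M -> Mhat} := toim (act M (vtxC K Q k)).

Definition Mbar : lmodType K := (Mhat * bar_space bar_k)%type.

Local Notation Mk := (bar_space bar_k).
Local Notation i1 := (inj1 Mhat Mk).
Local Notation i2 := (inj2 Mhat Mk).

Definition eta_ek (z : K) : {linear Mbar -> Mbar} := i2 \o (z \*: (@snd Mhat Mk)).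

Definition eta_in (a : inarr k Q) : {linear Mbar -> Mbar} :=
  i1 \o (to_Mhat \o (@incl _ _ _ \o (component a \o (bar_beta bar_k \o snd)))).

(* The map from e_hat M onto its summand M_(hd b), followed by the inclusion of *)
(* the latter as the summand of index b of Mout.                                *)
Definition into_Mout (b : outarr k Q) : {linear Mhat -> Mout} :=
  col_map (fun b' : outarr k Q =>
    if b' == b
    then toim (act M (vtx K Q (hd (val b')))) \o @incl _ _ _
         : {linear Mhat -> piece (hd (val b'))}
    else \0).

Definition eta_out (b : outarr k Q) : {linear Mbar -> Mbar} :=
  i2 \o (bar_alpha bar_k \o (into_Mout b \o fst)).

(* Theta = theta rho~ psi kappa *)
Definition Theta (u : series K (premut k Q)) : {linear Mbar -> Mbar} :=
  i1 \o (to_Mhat \o (act M (psikappa S u) \o (@incl _ _ _ \o fst))).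

(* The components of u in its decomposition                                     *)
(* z e_k + u_hat + \sum v_a a^* + \sum b^* w_b + \sum b^* x_ab a^*:              *)
(* up to multiplication by e_hat on the left, v_a collects the paths ending in  *)
(* the letter a^*, that letter being removed; similarly for w_b and x_ab.       *)
Definition cut_right (a : inarr k Q) (u : series K (premut k Q)) :
    series K (premut k Q) :=
  mkseries (fun i (w : seq (premut k Q)) j =>
    if j == tl (val a) then coef u i (rcons w (StarIn a)) k else 0).
Definition cut_left (b : outarr k Q) (u : series K (premut k Q)) :
    series K (premut k Q) :=
  mkseries (fun i (w : seq (premut k Q)) j =>
    if i == hd (val b) then coef u k (StarOut b :: w) j else 0).

Definition ehat : series K (premut k Q) := vtxC K (premut k Q) k.

Definition eta_tilde_fun (u : series K (premut k Q)) (x : Mbar) : Mbar :=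
  eta_ek (coef u k [::] k) x
  + Theta (ehat * u * ehat) x
  + \sum_a Theta (ehat * cut_right a u) (eta_in a x)
  + \sum_b eta_out b (Theta (cut_left b u * ehat) x)
  + \sum_b \sum_a eta_out b (Theta (cut_left b (cut_right a u)) (eta_in a x)).

Lemma sum_linear (T : finType) (U W : lmodType K) (f : T -> U -> W) :
  (forall t, linear (f t)) -> linear (fun x => \sum_t f t x).
Proof.
move=> lf a x y; rewrite scaler_sumr -big_split.
by apply: eq_bigr => t _; exact: lf.
Qed.
Lemma add_linear (U W : lmodType K) (f g : U -> W) :
  linear f -> linear g -> linear (fun x => f x + g x).
Proof. by move=> lf lg a x y; rewrite lf lg scalerDr addrACA. Qed.

Fact eta_tilde_linear u : linear (eta_tilde_fun u).
Proof.
apply: add_linear; last first.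
  by do 2![apply: sum_linear => ?] => c x y; rewrite !linearP.
apply: add_linear; last first.
  by apply: sum_linear => b c x y; rewrite !linearP.
apply: add_linear; last first.
  by apply: sum_linear => a c x y; rewrite !linearP.
by apply: add_linear; exact: linearP.
Qed.

Definition Mbar_action : action K (series K (premut k Q)) :=
  @Action K _ Mbar (fun u => mklin (eta_tilde_linear u)).

(* Vbar = e_hat V (+) ker beta / (ker beta :&: im alpha) *)
Definition Vhat : lmodType K := sub (im (act V (1 - eKQ0 K k))).
Definition Vbar_k : lmodType K := quo (within (im alpha) (ker beta)).
Definition Vbar : lmodType K := (Vhat * Vbar_k)%type.
Definition Vbar_fun (c : KQ0 K Q0) (x : Vbar) : Vbar :=
  (toim (act V (1 - eKQ0 K k)) (act V c (incl x.1)), c k *: x.2).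
Fact Vbar_linear c : linear (Vbar_fun c).
Proof.
move=> a x y; congr (_, _) => /=; first by rewrite !linearP.
by rewrite scalerDr !scalerA mulrC.
Qed.
Definition Vbar_action : action K (KQ0 K Q0) :=
  @Action K _ Vbar (fun c => mklin (Vbar_linear c)).

(* mu_k(M, V), for the given splitting of the premutation *)
Definition mutation (s : splitting K (premut k Q)) : decorated K (redQ s) :=
  Decorated
    (pull_action (fun u => split_map (sinl (trivQ s) u)) Mbar_action) Vbar_action.

End Mutation.

(* Main.v *)
From mathcomp Require Import all_boot all_order all_algebra.
From mathcomp Require Import boolp classical_sets.
Require Import Defs.

(* Transposition turns the triangle (alpha, beta, gamma) of M into that of its
   dual, so only the vertex k is at issue. The three descriptions of the
   completion share the properties ker abar = im beta, im bbar = ker alpha,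
   bbar abar = - gamma and ker bbar = (im abar :&: ker bbar) (+) V_k; these
   determine the completion up to an isomorphism compatible with abar and bbar,
   and transposition exchanges them. Finite dimension plays no role: by Zorn's
   lemma subspaces have complements, so im f^T is the annihilator of ker f.
   As for potentials, [S] respects cyclic equivalence because rotating by one
   arrow the cycles that start at k extends it to a continuous linear operation
   on all potentials, which maps a generator c w - w c to a generator or to 0. *)

Set Implicit Arguments.
Unset Strict Implicit.
Unset Printing Implicit Defensive.

Import GRing.Theory.
Local Open Scope ring_scope.

(** * Complements and duals of infinite-dimensional spaces *)

(** The two sides may use different descriptions and unrelated choices of [rho] and [sigma], so no
    formula for the isomorphism at k is to be expected; maps are therefore obtained by showing that
    a linear relation is the graph of a map. What remains is that each element of the completed path
    algebra acts on the two sides by adjoint operators. [eta_tilde_fun] is built from e_k, the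
    starred arrows and [Theta]; reversal exchanges the stars of incoming and outgoing arrows, and
    for [Theta] the claim is that psi kappa commutes with reversal. Since psi lives on the doubly
    premutated quiver, which for [opq Q] is only isomorphic to the opposite of the one for Q,
    reversal is studied for any end-swapping map between the arrows of two quivers, and such maps
    are carried through the premutation. On the side of potentials, [T] and [Top] come from
    independently chosen representatives without cycles at k, so the opposite of [T] is only
    cyclically equivalent to [Top]; a splitting asks for no more. *)

Section LinearRelations.
Variable K : fieldType.
Implicit Types U V W X Y Z : lmodType K.

Definition linset V (P : V -> Prop) :=
  P 0 /\ forall a x y, P x -> P y -> P (a *: x + y).

Definition linrel U V (R : U -> V -> Prop) :=
  R 0 0 /\ forall a x x' y y', R x x' -> R y y' -> R (a *: x + y) (a *: x' + y').

(** Take C maximal among the subspaces meeting P trivially. If x were outside P + C, then C + K x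
    would still meet P trivially. *)
Lemma linset_complement V (P : V -> Prop) : linset P -> exists C : V -> Prop,
  [/\ linset C, forall x, P x -> C x -> x = 0 &
      forall x, exists2 y, P y & C (x - y)].
Proof.
move=> [P0 PP].
(* [ok] does not ask for 0 in C: it has to hold for the empty set, which is the union of the empty
   chain. *)
pose ok (C : set V) := (forall a x y, C x -> C y -> C (a *: x + y)) /\
  forall x, P x -> C x -> x = 0.
have [F Fok totF|C [[CC CP] maxC]] := @Zorn_bigcup V ok.
  split=> [a x y [A FA Ax] [B FB By]|x Px [A FA Ax]]; last exact: (Fok A FA).2 Ax.
  have [AB|BA] := totF A B FA FB.
    by exists B => //; apply: (Fok B FB).1 => //; apply: AB.
  by exists A => //; apply: (Fok A FA).1 => //; apply: BA.
(* A maximal set is not empty, because the set reduced to 0 satisfies [ok]. *)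
have C0 : C 0.
  have [[x Cx]|nC] := pselect (exists x, C x).
    by have := CC (-1) x x Cx Cx; rewrite scaleN1r addNr.
  case: (maxC (eq^~ 0)); last first.
    by split=> [a x y -> ->|//]; rewrite scaler0 addr0.
  split=> [x Cx|C0]; first by case: nC; exists x.
  by apply: nC; exists 0; apply: C0.
exists C; split=> // x.
apply: contrapT => nx.
pose B y := exists2 a, C a & exists c : K, y = a + c *: x.
have xB : B x by exists 0 => //; exists 1; rewrite add0r scale1r.
have CB y : C y -> B y by move=> Cy; exists y => //; exists 0; rewrite scale0r addr0.
case: (maxC B).
  split=> [|BC]; first exact: CB.
  by apply: nx; exists 0 => //; rewrite subr0; apply: BC.
split=> [a y z [y1 Cy1 [c ->]] [z1 Cz1 [c' ->]]|y Py [y1 Cy1 [c yE]]].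
  exists (a *: y1 + z1); first exact: CC.
  by exists (a * c + c'); rewrite scalerDr addrACA scalerA scalerDl.
have [c0|c0] := eqVneq c 0.
  by apply: CP => //; rewrite yE c0 scale0r addr0.
case: nx; exists (c^-1 *: y).
  by have := PP c^-1 y 0 Py P0; rewrite addr0.
have -> : x - c^-1 *: y = (- c^-1) *: y1 + 0.
  by rewrite yE scalerDr scalerA mulVf // scale1r opprD addrCA subrr !addr0 scaleNr.
exact: CC.
Qed.

(** The values over a given x form a coset of [R 0], in which a complement D of [R 0] selects one
    element. A complement C of the domain, on which the map is 0, extends the choice to all of U.
    Both extensions of functionals and lifts of maps are obtained from this. *)
Lemma linrel_select U V (R : U -> V -> Prop) : linrel R ->
  exists f : {linear U -> V}, forall x y, R x y -> R x (f x).
Proof.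
move=> [R0 RR].
have RB x x' y y' : R x x' -> R y y' -> R (x - y) (x' - y').
  move=> Rx Ry; rewrite addrC -scaleN1r [x' - _]addrC -[X in X + x']scaleN1r.
  exact: RR.
have [|D [[D0 DD] DR DT]] := @linset_complement V (R 0).
  by split=> // a x y Rx Ry; have := RR a _ _ _ _ Rx Ry; rewrite scaler0 addr0.
case: (@linset_complement U (fun x => exists y, R x y)) => [|C [[C0 CC] CR CT]].
  split; first by exists 0.
  by move=> a x y [x' Rx] [y' Ry]; exists (a *: x' + y'); apply: RR.
pose G x y := exists x1, [/\ R x1 y, D y & C (x - x1)].
have GT x : exists y, G x y.
  have [x1 [y1 R1] C1] := CT x; have [y0 R0y D1] := DT y1.
  by exists (y1 - y0), x1; split=> //; have := RB _ _ _ _ R1 R0y; rewrite subr0.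
have G0 y : G 0 y -> y = 0.
  move=> [x1 [Rx Dy Cx]]; apply: DR => //.
  suff x0 : x1 = 0 by rewrite x0 in Rx.
  apply/eqP; rewrite -oppr_eq0; apply/eqP; rewrite sub0r in Cx; apply: CR => //.
  by exists (- y); have := RB _ _ _ _ R0 Rx; rewrite !sub0r.
have GG a x x' y y' : G x x' -> G y y' -> G (a *: x + y) (a *: x' + y').
  move=> [x1 [Rx Dx Cx]] [y1 [Ry Dy Cy]]; exists (a *: x1 + y1).
  split; [exact: RR|exact: DD|].
  by rewrite opprD addrACA -scalerBr; apply: CC.
have [f fG] := choice GT.
have fE x y : G x y -> f x = y.
  move=> Gxy; have Gz := GG (-1) _ _ _ _ Gxy (fG x).
  rewrite !scaleN1r addNr in Gz.
  by have /eqP := G0 _ Gz; rewrite addrC subr_eq0 => /eqP.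
have lf : linear f by move=> a x y; apply: fE; apply: GG.
exists (mklin lf) => x y Rxy.
have [x1 [Rx Dx Cx]] := fG x.
suff xE : x = x1 by rewrite {1}xE.
apply/eqP; rewrite -subr_eq0; apply/eqP; apply: CR => //.
by exists (y - f x); apply: RB.
Qed.

Lemma linear_bij U V (f : {linear U -> V}) :
  (forall x, f x = 0 -> x = 0) -> (forall y, exists x, f x = y) -> bijective f.
Proof.
move=> f0 /choice[g gK]; exists g => // x.
apply/eqP; rewrite -subr_eq0; apply/eqP/f0.
by rewrite linearB gK subrr.
Qed.

Lemma linrel_bij U V (R : U -> V -> Prop) : linrel R ->
  (forall x, exists y, R x y) -> (forall y, exists x, R x y) ->
  (forall y, R 0 y -> y = 0) -> (forall x, R x 0 -> x = 0) ->
  exists2 f : {linear U -> V}, bijective f & forall x y, R x y <-> f x = y.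
Proof.
move=> lR RT RS RF RI; have [f fR] := linrel_select lR.
have {}fR x : R x (f x) by have [y /fR] := RT x.
have fE x y : R x y <-> f x = y.
  split=> [Rxy|<-//]; have := lR.2 (-1) _ _ _ _ Rxy (fR x).
  rewrite !scaleN1r addNr => /RF /eqP.
  by rewrite addrC subr_eq0 => /eqP.
exists f => //; apply: linear_bij => [x /fE/RI //|y].
by have [x /fE] := RS y; exists x.
Qed.

Lemma bij_eq0 U V (f : {linear U -> V}) x : bijective f -> f x = 0 -> x = 0.
Proof. by move=> /bij_inj fI fx0; apply: fI; rewrite linear0. Qed.

Lemma bij_surj (A B : Type) (f : A -> B) : bijective f -> forall y, exists x, f x = y.
Proof. by move=> [g _ gK] y; exists (g y). Qed.

Lemma dualP V (f g : dual V) : (forall x, dual_app f x = dual_app g x) -> f = g.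
Proof. by move=> fg; apply: val_inj; apply/funext. Qed.

Lemma dual_app_linl V x a (f g : dual V) :
  dual_app (a *: f + g) x = a * dual_app f x + dual_app g x.
Proof. by []. Qed.

Lemma dual_appDl V x (f g : dual V) : dual_app (f + g) x = dual_app f x + dual_app g x.
Proof. by []. Qed.

Lemma dual_appNl V x (f : dual V) : dual_app (- f) x = - dual_app f x.
Proof. by []. Qed.

Lemma dual_app0l V x : dual_app (0 : dual V) x = 0.
Proof. by []. Qed.

Lemma dual_appDr V (f : dual V) x y : dual_app f (x + y) = dual_app f x + dual_app f y.
Proof. by have := dual_app_linear f 1 x y; rewrite !scale1r. Qed.

Lemma dual_app0r V (f : dual V) : dual_app f 0 = 0.
Proof. by have /eqP := dual_appDr f 0 0; rewrite addr0 addrC -subr_eq subrr => /eqP. Qed.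

Lemma dual_appZr V (f : dual V) a x : dual_app f (a *: x) = a * dual_app f x.
Proof.
by have := dual_app_linear f a x 0; rewrite dual_app0r !addr0.
Qed.

Lemma dual_appNr V (f : dual V) x : dual_app f (- x) = - dual_app f x.
Proof. by rewrite -scaleN1r dual_appZr mulN1r. Qed.

Lemma dual_app_sumr V (f : dual V) (T : finType) (F : T -> V) :
  dual_app f (\sum_t F t) = \sum_t dual_app f (F t).
Proof.
apply: (big_morph (dual_app f)); [exact: dual_appDr|exact: dual_app0r].
Qed.

Lemma dual_app_suml V x (T : finType) (F : T -> dual V) :
  dual_app (\sum_t F t) x = \sum_t dual_app (F t) x.
Proof. by apply: (big_morph (fun f => dual_app f x)). Qed.

Lemma transposeE V W (g : {linear V -> W}) (f : dual W) x :
  dual_app (transpose g f) x = dual_app f (g x).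
Proof. by []. Qed.

Lemma linrel_functional V (R : V -> K -> Prop) :
  R 0 0 -> (forall a x x' y y', R x x' -> R y y' -> R (a *: x + y) (a * x' + y')) ->
  (forall c, R 0 c -> c = 0) ->
  exists f : dual V, forall x c, R x c -> dual_app f x = c.
Proof.
move=> R0 RR RF.
have [f fR] := @linrel_select V K^o R (conj R0 RR).
have lf : linear (f : V -> K^o) by exact: linearP.
exists (mkdual lf) => x c Rxc; have := RR (-1) _ _ _ _ (fR _ _ Rxc) Rxc.
rewrite scaleN1r addNr mulN1r => /RF /eqP.
by rewrite addrC subr_eq0 => /eqP.
Qed.

(** The rule [f x |-> phi x] is a well-defined functional on the image of f, and it extends to W. *)
Lemma im_transpose V W (f : {linear V -> W}) (phi : dual V) :
  (forall x, f x = 0 -> dual_app phi x = 0) -> exists psi, transpose f psi = phi.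
Proof.
move=> phi0.
have [|||psi psiE] := @linrel_functional W
  (fun y c => exists2 x, f x = y & dual_app phi x = c).
- by exists 0; rewrite ?linear0 ?dual_app0r.
- move=> a y c y' c' [x <- <-] [x' <- <-]; exists (a *: x + x').
    by rewrite linearP.
  by rewrite dual_appDr dual_appZr.
- by move=> c [x fx <-]; apply: phi0.
exists psi; apply: dualP => x; rewrite transposeE; apply: psiE; by exists x.
Qed.

End LinearRelations.

(** * Completions of a triangle *)

Section Factorizations.
Variable K : fieldType.
Implicit Types U V W X Y Z : lmodType K.

(* v identifies V with a complement of ker b :&: im a in ker b, and q is the    *)
(* corresponding projection; both are swapped by duality.                      *)
Definition splits V X Y Z (a : {linear Y -> X}) (b : {linear X -> Z})
    (v : {linear V -> X}) (q : {linear X -> V}) :=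
  [/\ forall t, b (v t) = 0, forall y, q (a y) = 0, forall t, q (v t) = t &
      forall x, b x = 0 -> exists y t, x = a y + v t].

(** The last condition is the one with content: if a^T xi = 0, then xi - q^T v^T xi vanishes on each
    a y + v t in ker b, hence lies in the image of b^T. *)
Lemma splits_transpose V X Y Z (a : {linear Y -> X}) (b : {linear X -> Z})
    (v : {linear V -> X}) (q : {linear X -> V}) :
  splits a b v q -> splits (transpose b) (transpose a) (transpose q) (transpose v).
Proof.
move=> [bv qa qv kerb]; split=> [t|y|t|xi axi].
- by apply: dualP => y; rewrite !transposeE qa dual_app0r.
- by apply: dualP => t; rewrite !transposeE bv dual_app0r.
- by apply: dualP => s; rewrite !transposeE qv.
have [|psi psiE] := @im_transpose _ _ _ b (xi - transpose q (transpose v xi)).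
  move=> x /kerb[y [t ->]].
  rewrite dual_appDl dual_appNl !transposeE linearD /= qa qv add0r.
  by rewrite dual_appDr -(transposeE a) axi dual_app0l add0r subrr.
by exists psi, (transpose v xi); rewrite psiE subrK.
Qed.

Lemma splits_compl V X Y Y' Z (a : {linear Y -> X}) (b : {linear X -> Z})
    (v : {linear V -> X}) (q : {linear X -> V}) (f : {linear Y' -> Y}) :
  bijective f -> splits a b v q -> splits (a \o f) b v q.
Proof.
move=> bf [bv qa qv kerb]; split=> // [y|x /kerb[y [t ->]]]; first exact: qa.
by have [y' <-] := bij_surj bf y; exists y', t.
Qed.

Lemma splits_compr V X Y Z Z' (a : {linear Y -> X}) (b : {linear X -> Z})
    (v : {linear V -> X}) (q : {linear X -> V}) (h : {linear Z -> Z'}) :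
  bijective h -> splits a b v q -> splits a (h \o b) v q.
Proof.
move=> bh [bv qa qv kerb]; split=> // [t|x hbx] /=; first by rewrite bv linear0.
exact: kerb (bij_eq0 bh hbx).
Qed.

(** Let C be a complement of im a + v V in X. The isomorphism is a y + v t + w |-> a' y + v' (th t)
    + s w for w in C, where s is a linear lift of b through b'. Composed with b' it gives b, so
    surjectivity and injectivity reduce to the kernels of b' and b, which [splits] describes. *)
Lemma factorization_unique V V' X X' Y Z
    (a : {linear Y -> X}) (b : {linear X -> Z})
    (v : {linear V -> X}) (q : {linear X -> V})
    (a' : {linear Y -> X'}) (b' : {linear X' -> Z})
    (v' : {linear V' -> X'}) (q' : {linear X' -> V'}) (th : {linear V -> V'}) :
  splits a b v q -> splits a' b' v' q' -> bijective th ->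
  (forall y, a y = 0 <-> a' y = 0) ->
  (forall z, (exists x, b x = z) <-> (exists x, b' x = z)) ->
  (forall y, b (a y) = b' (a' y)) ->
  exists g : {linear X -> X'}, [/\ bijective g, forall y, g (a y) = a' y &
    forall x, b' (g x) = b x].
Proof.
move=> [bv qa qv kerb] [bv' qa' qv' kerb'] bth kera imb ba.
case: (@linset_complement K X (fun x => exists y t, x = a y + v t)).
  split; first by exists 0, 0; rewrite !linear0 addr0.
  move=> c _ _ [y [t ->]] [y' [t' ->]]; exists (c *: y + y'), (c *: t + t').
  by rewrite !linearP scalerDr addrACA.
move=> C [[C0 CC] CI CT].
case: (@linrel_select K X X' (fun x x' => b' x' = b x)).
  by split=> [|c x y x' y' e e']; rewrite ?linear0 // !linearP e e'.
move=> s sP.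
have {}sP x : b' (s x) = b x.
  have [x' /sP//] : exists x', b' x' = b x by apply/imb; exists x.
pose R x x' := exists y t w,
  [/\ C w, x = a y + v t + w & x' = a' y + v' (th t) + s w].
case: (@linrel_bij K X X' R).
- split; first by exists 0, 0, 0; rewrite !linear0 !addr0.
  move=> c _ _ _ _ [y [t [w [Cw -> ->]]]] [y' [t' [w' [Cw' -> ->]]]].
  exists (c *: y + y'), (c *: t + t'), (c *: w + w').
  split; first exact: CC.
    by rewrite !linearP !scalerDr addrACA; congr (_ + _); rewrite addrACA.
  by rewrite !linearP !scalerDr addrACA; congr (_ + _); rewrite addrACA.
- move=> x; have [_ [y [t ->]] Cw] := CT x.
  by exists (a' y + v' (th t) + s (x - (a y + v t))), y, t, (x - (a y + v t));
     split=> //; rewrite addrC subrK.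
- move=> x'.
  (* Some x = a y + v t + w has b x = b' x'. Then x' - (a' y + s w) lies in ker b', and its
     decomposition a' y1 + v' t1 corrects y and replaces t. *)
  have [x bx] : exists x, b x = b' x' by apply/imb; exists x'.
  have [y [t [w [Cw xE]]]] : exists y t w, C w /\ x = a y + v t + w.
    have [_ [y [t ->]] Cw] := CT x.
    by exists y, t, (x - (a y + v t)); split=> //; rewrite addrC subrK.
  case: (kerb' (x' - (a' y + s w))).
    rewrite linearB linearD /= sP -ba -bx xE !linearD /= bv addr0.
    by rewrite -opprD subrr.
  move=> y1 [t1 /eqP]; rewrite subr_eq => /eqP x'E.
  have [t2 t2E] := bij_surj bth t1.
  exists (a (y + y1) + v t2 + w), (y + y1), t2, w; split=> //.
  by rewrite x'E t2E linearD /= addrCA !addrA; do 2!congr (_ + _); rewrite addrAC.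
- move=> x' [y [t [w [Cw /esym e ->]]]].
  have w0 : w = 0.
    apply: CI => //; exists (- y), (- t); rewrite !linearN -opprD.
    by apply/eqP; rewrite -addr_eq0 addrC e.
  rewrite w0 addr0 in e; have t0 : t = 0.
    by rewrite -(qv t) -[v t]add0r -(subrr (a y)) addrAC e add0r linearN /= qa oppr0.
  rewrite t0 linear0 addr0 in e.
  by rewrite w0 t0 !linear0 !addr0; apply/kera.
move=> x [y [t [w [Cw -> /esym e]]]].
(* Applying b' to the vanishing image puts a y + w in ker b, so w lies in im a + v V, which meets C
   trivially. *)
have bw : b (a y + w) = 0.
  have := congr1 b' e.
  by rewrite !linearD /= linear0 bv' addr0 sP ba.
have w0 : w = 0.
  apply: CI => //; have [y1 [t1 e1]] := kerb _ bw.
  exists (y1 - y), t1; apply: (addrI (a y)).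
  by rewrite e1 linearB /= [RHS]addrA [a y + _]addrC subrK.
rewrite w0 linear0 addr0 in e; rewrite w0 addr0.
have t0 : t = 0.
  apply: (bij_eq0 bth).
  by rewrite -(qv' (th t)) -[v' _]add0r -(subrr (a' y)) addrAC e add0r linearN /= qa' oppr0.
rewrite t0 !linear0 addr0 in e; rewrite t0 linear0 addr0.
  by apply/kera.
move=> g bg gR; exists g; split=> // [y|x].
  by apply/gR; exists y, 0, 0; rewrite !linear0 !addr0.
have [y [t [w [Cw xE gx]]]] := (gR x (g x)).2 erefl.
by rewrite gx [in RHS]xE !linearD /= bv bv' sP ba !addr0.
Qed.

Definition completion_spec (Min Mout Mk V : lmodType K) (alpha : {linear Min -> Mk})
    (beta : {linear Mk -> Mout}) (gamma : {linear Mout -> Min})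
    (c : completion Min Mout) :=
  [/\ forall y, bar_alpha c y = 0 <-> exists x, beta x = y,
      forall z, alpha z = 0 <-> exists x, bar_beta c x = z,
      forall y, bar_beta c (bar_alpha c y) = - gamma y &
      exists v : {linear V -> bar_space c}, exists q : {linear bar_space c -> V},
        splits (bar_alpha c) (bar_beta c) v q].

(** The pair (bbar^T Pout, abar^T) is compared with (abar', Pin bbar'). Both first maps have as
    kernel the y with [Pout y] zero on ker alpha, both second maps have as image the functionals
    zero on im beta, and transposition keeps the sign of - gamma; [factorization_unique] applies. *)
Lemma completion_dual (Min Mout Mk V Min' Mout' Mk' V' : lmodType K)
    (alpha : {linear Min -> Mk}) (beta : {linear Mk -> Mout})
    (gamma : {linear Mout -> Min}) (c : completion Min Mout)
    (alpha' : {linear Min' -> Mk'}) (beta' : {linear Mk' -> Mout'})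
    (gamma' : {linear Mout' -> Min'}) (c' : completion Min' Mout')
    (Pin : {linear Min' -> dual Mout}) (Pout : {linear Mout' -> dual Min})
    (Pk : {linear Mk' -> dual Mk}) (PV : {linear V' -> dual V}) :
  completion_spec V alpha beta gamma c -> completion_spec V' alpha' beta' gamma' c' ->
  bijective Pin -> bijective Pout -> bijective Pk -> bijective PV ->
  (forall x, Pk (alpha' x) = transpose beta (Pin x)) ->
  (forall x, Pout (beta' x) = transpose alpha (Pk x)) ->
  (forall x, Pin (gamma' x) = transpose gamma (Pout x)) ->
  exists g : {linear bar_space c' -> dual (bar_space c)}, [/\ bijective g,
    forall y, g (bar_alpha c' y) = transpose (bar_beta c) (Pout y) &
    forall x, transpose (bar_alpha c) (g x) = Pin (bar_beta c' x)].
Proof.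
move=> [kera imb ba [v [q sp]]] [kera' imb' ba' [v' [q' sp']]] bin bout bk bV.
move=> Ea Eb Eg.
have [y|phi|y|g [bg ga gb]] := factorization_unique (splits_compr bin sp')
  (splits_compl bout (splits_transpose sp)) bV; last by exists g.
- split=> [/kera'[x <-]|].
    apply: dualP => z; rewrite /= Eb !transposeE (imb _).2 ?dual_app0r //.
    by exists z.
  move=> /= by0; have [z /imb[x <-]|psi psiE] := @im_transpose _ _ _ alpha (Pout y).
    exact: (congr1 (fun f => dual_app f x) by0).
  have [x xE] := bij_surj bk psi; apply/kera'; exists x.
  by apply: (bij_inj bout); rewrite Eb xE.
- split=> [[x' <-]|[xi xiE]].
    apply: im_transpose => y /kera[x <-] /=.
    rewrite -transposeE -Ea (imb' _).2 ?linear0 //; by exists x'.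
  have [z zE] := bij_surj bin phi.
  have [|x xE] := (imb' z).1; last by exists x; rewrite /= xE.
  apply: (bij_eq0 bk); rewrite Ea zE -xiE; apply: dualP => x.
  by rewrite !transposeE (kera _).2 ?dual_app0r //; exists x.
apply: dualP => z.
rewrite -[LHS]/(dual_app (Pin (bar_beta c' (bar_alpha c' y))) z) ba' linearN Eg.
rewrite -[RHS]/(dual_app (Pout y) (bar_beta c (bar_alpha c z))) ba.
by rewrite dual_appNl dual_appNr.
Qed.

End Factorizations.

Section Subspaces.
Variable K : fieldType.
Implicit Types U V W : lmodType K.

Lemma mem_ker U V (f : {linear U -> V}) x : reflect (f x = 0) (x \in sp_mem (ker f)).
Proof. by rewrite inE; apply: eqP. Qed.

Lemma mem_im U V (f : {linear U -> V}) y :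
  reflect (exists x, f x = y) (y \in sp_mem (im f)).
Proof. by rewrite inE; apply: asboolP. Qed.

Lemma incl_inj V (P : subspace V) : injective (@incl K V P).
Proof. exact: val_inj. Qed.

Lemma inclP V (P : subspace V) (x : sub P) : incl x \in sp_mem P.
Proof. exact: (valP x). Qed.

Lemma inclN V (P : subspace V) (x : sub P) : incl (- x) = - incl x.
Proof. exact: linearN. Qed.

Lemma incl_onto V (P : subspace V) x : x \in sp_mem P -> exists y : sub P, incl y = x.
Proof. by move=> Px; exists (InSub Px). Qed.

Lemma mem_within V (R P : subspace V) (x : sub P) :
  (x \in sp_mem (within R P)) = (incl x \in sp_mem R).
Proof. by rewrite inE. Qed.

Lemma qproj_eq0 V (P : subspace V) x : qproj P x = 0 <-> x \in sp_mem P.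
Proof.
rewrite -[X in X \in _]subr0 -(linear0 (qproj P)).
by split=> [/qproj_eqP|/qproj_eqP].
Qed.

Lemma qproj_surj V (P : subspace V) (y : quo P) : exists x, qproj P x = y.
Proof. by exists (qrepr y); apply: qreprK. Qed.

Lemma inducedE V W (P : subspace V) (f : {linear V -> W}) x :
  (forall y, y \in sp_mem P -> f y = 0) -> induced P f (qproj P x) = f x.
Proof.
move=> fP; rewrite -[LHS]/(induced_fun f (qproj P x)) /induced_fun.
case: asboolP => // _.
apply/eqP; rewrite -subr_eq0 -linearB; apply/eqP/fP.
by apply/qproj_eqP; rewrite qreprK.
Qed.

Lemma corestrictE U V (P : subspace V) (f : {linear U -> V}) x :
  (forall y, f y \in sp_mem P) -> incl (corestrict P f x) = f x.
Proof.
move=> fP; rewrite -[corestrict P f x]/(corestrict_fun P f x) /corestrict_fun.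
case: asboolP => // _.
by rewrite -[incl _]/(val _) val_insubd fP.
Qed.

End Subspaces.

(** * The three descriptions of the completion satisfy the same specification *)

Section CompletionSpec.
Variables (K : fieldType) (Min Mout Mk V : lmodType K).
Variables (alpha : {linear Min -> Mk}) (beta : {linear Mk -> Mout}).
Variable gamma : {linear Mout -> Min}.
Variable rho : {linear Mout -> sub (ker gamma)}.
Variable sigma : {linear keralpha_imgamma alpha gamma -> sub (ker alpha)}.
Hypotheses (ag : forall y, alpha (gamma y) = 0) (gb : forall x, gamma (beta x) = 0).
Hypotheses (rhoP : is_retraction rho) (sigmaP : is_section sigma).

Local Notation p := (qproj (within (im beta) (ker gamma))).
Local Notation p' := (qproj (within (im gamma) (ker alpha))).

Lemma p_rho_eq0 y : gamma y = 0 -> p (rho y) = 0 <-> exists x, beta x = y.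
Proof.
move=> /mem_ker/incl_onto[z <-]; rewrite rhoP.
split=> [/qproj_eq0|[x e]]; first by rewrite mem_within => /mem_im.
by apply/qproj_eq0; rewrite mem_within; apply/mem_im; exists x.
Qed.

(** An element of ker alpha differs from the representative of its class chosen by [sigma] by an
    element of im gamma. *)
Lemma ker_alpha_split z : alpha z = 0 ->
  exists y t, z = gamma y + incl (sigma t).
Proof.
move=> /mem_ker/incl_onto[x <-].
have : p' (x - sigma (p' x)) = 0 by rewrite linearB /= sigmaP subrr.
move=> /qproj_eq0; rewrite mem_within => /mem_im[y yE].
by exists y, (p' x); rewrite yE linearB subrK.
Qed.

Lemma sigma_eq0 y t : gamma y + incl (sigma t) = 0 -> t = 0.
Proof.
move=> /eqP; rewrite addrC addr_eq0 => /eqP e.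
rewrite -(sigmaP t); apply/qproj_eq0; rewrite mem_within e -linearN.
by apply/mem_im; exists (- y).
Qed.

Lemma alpha_sum y t : alpha (gamma y + incl (sigma t)) = 0.
Proof. by rewrite linearD /= ag add0r; apply/mem_ker/inclP. Qed.

(** The last summand gives v and q. An element of ker bbar has no component in ker alpha / im gamma
    because [sigma] is a section, hence none in im gamma; what is left besides V comes from ker
    gamma. *)
Lemma completionA_spec : completion_spec V alpha beta gamma (completionA V beta rho sigma).
Proof.
split=> /=.
- move=> y; split=> [[e1 e2]|[x e]].
    have gy : gamma y = 0 by apply/eqP; rewrite -oppr_eq0 e2.
    by apply/p_rho_eq0 => //; apply/eqP; rewrite -oppr_eq0 e1.
  have gy : gamma y = 0 by rewrite -e gb.
  congr (_, _, _, _); first by rewrite (p_rho_eq0 gy).2 ?oppr0 //; exists x.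
  by apply: incl_inj; rewrite linearN /= gy oppr0.
- move=> z; split=> [/ker_alpha_split[y [t ->]]|[[[[w y] t] v] <-]].
    by exists (0, toim gamma y, t, 0).
  have /mem_im[y' yE] := inclP y.
  by rewrite -[mklin_fun _ _]/(incl y + incl (sigma t)) -yE alpha_sum.
- by move=> y; rewrite -[LHS]/(- gamma y + incl (sigma 0)) !linear0 addr0.
have lv : linear (fun t => (0, 0, 0, t) : spaceA V alpha beta gamma).
  by move=> a x y; congr (_, _, _, _); rewrite /= scaler0 addr0.
exists (mklin lv), (@snd _ _); split=> // [t|[[[w y] t] v]].
  by rewrite -[LHS]/(incl 0 + incl (sigma 0)) !linear0 addr0.
have [y' yE] : exists y', toim gamma y' = y.
  by have /mem_im[y' e] := inclP y; exists y'; apply: incl_inj.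
rewrite -yE -[LHS]/(gamma y' + incl (sigma t)) => e; have t0 := sigma_eq0 e.
have {e}gy : gamma y' = 0 by move: e; rewrite t0 !linear0 addr0.
have [w' <-] := qproj_surj w.
(* The sign undoes that of abar: as gamma w' = 0 and [rho] is a retraction, p w' is the only
   component of abar (- w'). *)
exists (- incl w'), v; congr (_, _, _, _) => //=; rewrite ?t0 ?addr0 ?add0r //.
  by rewrite !linearN /= opprK rhoP.
apply: incl_inj; rewrite linearN !linearN /= opprK gy.
by apply/esym/mem_ker/inclP.
Qed.

Lemma gamma_ker_alpha y : gamma y \in sp_mem (ker alpha).
Proof. by apply/mem_ker. Qed.

Lemma completionB_spec : completion_spec V alpha beta gamma (completionB V alpha beta rho).
Proof.
(* alpha gamma = 0 excludes the default value 0 of [corestrict]. *)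
have cE := corestrictE _ gamma_ker_alpha.
split.
- move=> y; split=> [[e1 e2]|[x e]].
    have gy : gamma y = 0 by apply/eqP; rewrite -cE -oppr_eq0; apply/eqP.
    by apply/p_rho_eq0 => //; apply/eqP; rewrite -oppr_eq0 e1.
  have gy : gamma y = 0 by rewrite -e gb.
  congr (_, _, _); first by rewrite (p_rho_eq0 gy).2 ?oppr0 //; exists x.
  by apply: incl_inj; rewrite inclN cE gy oppr0.
- move=> z; split=> [/mem_ker/incl_onto[y <-]|[[[w y] t] <-]].
    by exists (0, y, 0).
  by apply/mem_ker/inclP.
- by move=> y; rewrite -[LHS]/(incl (- corestrict (ker alpha) gamma y)) inclN cE.
have lv : linear (fun t => (0, 0, t) : spaceB V alpha beta gamma).
  by move=> a x y; congr (_, _, _); rewrite /= scaler0 addr0.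
exists (mklin lv), (@snd _ _); split=> //= - [[w y] v] /= y0.
have {}y0 : y = 0 by apply: incl_inj.
have [w' <-] := qproj_surj w.
exists (- incl w'), v; congr (_, _, _) => //=; rewrite ?addr0 ?add0r //.
  by rewrite !linearN /= opprK rhoP.
apply: incl_inj; rewrite y0 inclN cE linearN opprK.
by apply/esym/mem_ker/inclP.
Qed.

Lemma completionC_spec : completion_spec V alpha beta gamma (completionC V beta sigma).
Proof.
(* gamma beta = 0 excludes the default value 0 of [induced]. *)
have iE y : induced (im beta) gamma (qproj (im beta) y) = gamma y.
  by apply: inducedE => _ /mem_im[x <-].
split.
- move=> y; split=> [[/eqP]|[x e]].
    by rewrite oppr_eq0 => /eqP/qproj_eq0/mem_im.
  congr (_, _, _); apply/eqP; rewrite oppr_eq0; apply/eqP/qproj_eq0/mem_im.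
  by exists x.
- move=> z; split=> [/ker_alpha_split[y [t ->]]|[[[y t] v] <-]].
    by exists (qproj (im beta) y, t, 0); rewrite -iE.
  have [y' <-] := qproj_surj y.
  rewrite -[bar_beta _ _]/(induced (im beta) gamma (qproj (im beta) y') + incl (sigma t)).
  by rewrite iE alpha_sum.
- move=> y; rewrite -[LHS]/(induced (im beta) gamma (- qproj (im beta) y) + incl (sigma 0)).
  by rewrite !linear0 addr0 -linearN iE linearN.
have lv : linear (fun t => (0, 0, t) : spaceC V alpha beta gamma).
  by move=> a x y; congr (_, _, _); rewrite /= scaler0 addr0.
exists (mklin lv), (@snd _ _); split=> // [t|[[y t] v]].
  by rewrite -[LHS]/(induced (im beta) gamma 0 + incl (sigma 0)) !linear0 addr0.
have [y' <-] := qproj_surj y.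
rewrite -[bar_beta _ _]/(induced (im beta) gamma (qproj (im beta) y') + incl (sigma t)).
rewrite iE => /sigma_eq0 ->.
exists (- y'), v; congr (_, _, _) => //=; rewrite ?addr0 ?add0r //.
by rewrite linearN opprK.
Qed.

Lemma completion_of_spec d :
  completion_spec V alpha beta gamma (completion_of V beta d rho sigma).
Proof.
case: d; [exact: completionA_spec|exact: completionB_spec|exact: completionC_spec].
Qed.

End CompletionSpec.

(** * Duals of images of idempotents, of finite direct sums and of a subquotient *)

Section DualBijections.
Variable K : fieldType.
Implicit Types U V W M : lmodType K.

Definition restrict_dual M (e : {linear M -> M}) (e' : {linear dual M -> dual M}) :
    {linear sub (im e') -> dual (sub (im e))} :=
  transpose (@incl K M (im e)) \o @incl K (dual M) (im e').

Lemma restrict_dualE M (e : {linear M -> M}) (e' : {linear dual M -> dual M})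
    (phi : sub (im e')) (x : sub (im e)) :
  dual_app (restrict_dual e e' phi) x = dual_app (incl phi) (incl x).
Proof. by []. Qed.

Lemma idem_incl M (e : {linear M -> M}) (x : sub (im e)) :
  (forall x, e (e x) = e x) -> e (incl x) = incl x.
Proof. by move=> ee; have /mem_im[y <-] := inclP x. Qed.

(** As e is idempotent, a functional on im e extends by composition with e, and an element of im e'
    is determined by its values on im e. This serves for e_j M, for (1 - e_k) M and for the
    decorations. *)
Lemma restrict_dual_bij M (e : {linear M -> M}) (e' : {linear dual M -> dual M}) :
  (forall x, e (e x) = e x) ->
  (forall phi x, dual_app (e' phi) x = dual_app phi (e x)) ->
  bijective (restrict_dual e e').
Proof.
move=> ee ee'; apply: linear_bij => [phi r0|eta].
  apply: incl_inj; apply: dualP => x; have /mem_im[psi psiE] := inclP phi.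
  rewrite -psiE ee' -ee -ee' psiE.
  have [y yE] := @incl_onto _ _ (im e) (e x) (introT (mem_im _ _) (ex_intro _ x erefl)).
  by rewrite -yE -restrict_dualE r0.
pose zeta := transpose (toim e) eta.
have [phi phiE] := @incl_onto _ _ (im e') (e' zeta)
  (introT (mem_im _ _) (ex_intro _ zeta erefl)).
exists phi; apply: dualP => x; rewrite restrict_dualE phiE ee' transposeE.
by congr dual_app; apply: incl_inj; rewrite [LHS]/= idem_incl // idem_incl.
Qed.

Section DSumDual.
Variables (T : finType) (V V' : T -> lmodType K).

(** The type of a summand depends on its index, so the nonzero coordinate is transported along i =
    j; the statement hides this transport behind two equations. *)
Lemma dsum_single i : exists s : {linear V i -> dsum V},
  (forall x, s x i = x) /\ forall x j, j != i -> s x j = 0.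
Proof.
pose s x : dsum V := fun j => if i =P j is ReflectT e then ecast j (V j) e x else 0.
have ls : linear s.
  move=> a x y; apply: functional_extensionality_dep => j.
  rewrite -[RHS]/(a *: s x j + s y j) /s.
  by case: eqP => [e|_]; [case: j / e|rewrite scaler0 addr0].
exists (mklin ls); split=> x => [|j]; rewrite -[LHS]/(s x _) /s.
  by case: eqP => // e; rewrite (eq_axiomK e).
by case: eqP => // e; rewrite [in X in X -> _]e eqxx.
Qed.

Variable r : forall i, {linear V' i -> dual (V i)}.

Definition dsum_dual : {linear dsum V' -> dual (dsum V)} :=
  row_map (fun i => transpose (component i) \o r i).

Lemma dsum_dualE x y : dual_app (dsum_dual x) y = \sum_i dual_app (r i (x i)) (y i).
Proof. exact: dual_app_suml. Qed.

Lemma dsum_dual_bij : (forall i, bijective (r i)) -> bijective dsum_dual.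
Proof.
move=> br; have [s sP] : exists s : forall i, {linear V i -> dsum V}, forall i,
    (forall x, s i x i = x) /\ forall x j, j != i -> s i x j = 0.
  by exists (fun i => sval (cid (dsum_single i))) => i; case: cid.
apply: linear_bij => [x x0|eta].
  apply: functional_extensionality_dep => i; apply: (bij_eq0 (br i)).
  apply: dualP => y; have := dsum_dualE x (s i y).
  rewrite x0 (bigD1 i) //= (sP i).1 big1 ?addr0 => [<-//|j ji].
  by rewrite (sP i).2 // dual_app0r.
have [x xE] : exists x : dsum V', forall i, r i (x i) = transpose (s i) eta.
  exists (fun i => sval (cid (bij_surj (br i) (transpose (s i) eta)))) => i.
  by case: cid.
exists x; apply: dualP => y; rewrite dsum_dualE.
rewrite (eq_bigr (fun i => dual_app eta (s i (y i)))) => [|i _]; last by rewrite xE.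
rewrite -dual_app_sumr; congr dual_app.
apply: functional_extensionality_dep => j.
rewrite -[LHS]/(component j (\sum_i s i (y i))) linear_sum (bigD1 j) //=.
rewrite [X in X + _](sP j).1 big1 ?addr0 // => i ij.
by apply: (sP i).2; rewrite eq_sym.
Qed.

End DSumDual.

(** The map restricts [Pk psi] to ker beta; it kills im alpha because beta' psi = 0. Conversely, a
    functional on the quotient extends to M_k so as to kill im alpha, and a functional killing ker
    beta lies in the image of beta^T, which is Pk (im alpha'). This handles the decoration at k. *)
Lemma ker_im_dual (Min Mout Mk Min' Mout' Mk' : lmodType K)
    (alpha : {linear Min -> Mk}) (beta : {linear Mk -> Mout})
    (alpha' : {linear Min' -> Mk'}) (beta' : {linear Mk' -> Mout'})
    (Pin : {linear Min' -> dual Mout}) (Pout : {linear Mout' -> dual Min})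
    (Pk : {linear Mk' -> dual Mk}) :
  bijective Pin -> bijective Pout -> bijective Pk ->
  (forall x, Pk (alpha' x) = transpose beta (Pin x)) ->
  (forall x, Pout (beta' x) = transpose alpha (Pk x)) ->
  exists h : {linear quo (within (im alpha') (ker beta')) ->
                     dual (quo (within (im alpha) (ker beta)))}, bijective h.
Proof.
move=> bin bout bk Ea Eb.
pose R xi (eta : dual (quo (within (im alpha) (ker beta)))) :=
  exists2 psi, qproj (within (im alpha') (ker beta')) psi = xi & forall m,
    dual_app eta (qproj (within (im alpha) (ker beta)) m) = dual_app (Pk (incl psi)) (incl m).
suff [h bh _] : exists2 h : {linear _ -> _}, bijective h & forall x y, R x y <-> h x = y.
  by exists h.
have P_im psi x : beta' psi = 0 -> dual_app (Pk psi) (alpha x) = 0.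
  by move=> b0; rewrite -transposeE -Eb b0 linear0.
apply: linrel_bij.
- split; first by exists 0 => [|m]; rewrite !linear0 ?dual_app0l.
  move=> a _ xi eta1 eta2 [psi1 <- E1] [psi2 <- E2]; exists (a *: psi1 + psi2).
    by rewrite linearP.
  by move=> m; rewrite dual_app_linl E1 E2 !linearP.
- move=> xi; have [psi <-] := qproj_surj xi.
  have /mem_ker b0 := inclP psi.
  have lf : linear (fun m : sub (ker beta) => dual_app (Pk (incl psi)) (incl m) : K^o).
    by move=> a x y; rewrite linearP dual_app_linear.
  have I0 y : y \in sp_mem (within (im alpha) (ker beta)) -> mklin lf y = 0.
    rewrite mem_within => /mem_im[x e].
    by rewrite -[LHS]/(dual_app (Pk (incl psi)) (incl y)) -e P_im.
  have li : linear (induced _ (mklin lf) : quo (within (im alpha) (ker beta)) -> K^o).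
    exact: linearP.
  exists (mkdual li), psi => // m.
  by rewrite -[LHS]/(induced _ (mklin lf) (qproj (within (im alpha) (ker beta)) m)) inducedE.
- move=> eta.
  (* The functional to extend lives on ker beta + im alpha: it is eta of the class on the first term
     and 0 on the second. *)
  have [|||zeta zetaE] := @linrel_functional K Mk (fun x c => exists m y,
    x = incl m + alpha y /\ dual_app eta (qproj (within (im alpha) (ker beta)) m) = c).
  + by exists 0, 0; rewrite !linear0 addr0 dual_app0r.
  + move=> a _ _ c c' [m [y [-> <-]]] [m' [y' [-> <-]]].
    exists (a *: m + m'), (a *: y + y'); split.
      by rewrite !linearP scalerDr addrACA.
    by rewrite linearP dual_appDr dual_appZr.
  + move=> c [m [y [/esym/eqP]]]; rewrite addr_eq0 => /eqP mE <-.
    rewrite (_ : qproj (within (im alpha) (ker beta)) m = 0) ?dual_app0r //; apply/qproj_eq0.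
    by rewrite mem_within mE -linearN; apply/mem_im; exists (- y).
  have [psi psiE] := bij_surj bk zeta.
  have /mem_ker/incl_onto[psi' psiE'] : beta' psi = 0.
    apply: (bij_eq0 bout); rewrite Eb psiE; apply: dualP => y.
    rewrite transposeE dual_app0l; apply: zetaE; exists 0, y.
    by rewrite !linear0 add0r dual_app0r.
  exists (qproj (within (im alpha') (ker beta')) psi'), psi' => // m.
  rewrite psiE' psiE; apply/esym/zetaE.
  by exists m, 0; rewrite linear0 addr0.
- move=> eta [psi /qproj_eq0]; rewrite mem_within => /mem_im[x xE] etaE.
  apply: dualP => z; have [m <-] := qproj_surj z.
  rewrite etaE -xE Ea transposeE.
  by have /mem_ker-> := inclP m; rewrite dual_app0r dual_app0l.
move=> xi [psi <- psi0]; apply/qproj_eq0; rewrite mem_within.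
have [x bx|zeta zetaE] := @im_transpose K _ _ beta (Pk (incl psi)).
  by have /mem_ker/incl_onto[m <-] := bx; rewrite -psi0 dual_app0l.
have [y yE] := bij_surj bin zeta.
apply/mem_im; exists y; apply: (bij_inj bk).
by rewrite Ea yE zetaE.
Qed.

End DualBijections.

(** * Anti-isomorphisms of path algebras *)

Local Arguments coef : simpl never.

Section Walks.
Variables (Q0 : finType) (Q : quiver Q0).

Lemma walk_rcons i (w : seq Q) c j :
  walk i (rcons w c) j = walk i w (hd c) && (tl c == j).
Proof. by elim: w i => [|d w IH] i /=; rewrite ?IH ?andbA // eq_sym. Qed.

End Walks.

Section AntiSeries.
Variables (K : fieldType) (Q0 : finType).
Implicit Types A B Q : quiver Q0.

Lemma coef_path Q i (w : seq Q) j i' w' j' : walk i w j ->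
  coef (path_series K i w j) i' w' j' = [&& i' == i, w' == w & j' == j]%:R.
Proof.
move=> ww; rewrite coef_mk; case: ifP => // /negbT nw.
by case: and3P => // -[/eqP e1 /eqP e2 /eqP e3]; rewrite e1 e2 e3 ww in nw.
Qed.

Lemma coef_arr Q (c : Q) i w j :
  coef (arr K c) i w j = [&& i == hd c, w == [:: c] & j == tl c]%:R.
Proof. by rewrite coef_path //= !eqxx. Qed.

Lemma coef_vtx Q l i (w : seq Q) j :
  coef (vtx K Q l) i w j = [&& i == l, w == [::] & j == l]%:R.
Proof. by rewrite coef_path //=. Qed.

Lemma coefN Q (u : series K Q) i w j : coef (- u) i w j = - coef u i w j.
Proof. by []. Qed.

Lemma coef_sum Q (T : Type) (r : seq T) (P : pred T) (F : T -> series K Q) i w j :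
  coef (\sum_(t <- r | P t) F t) i w j = \sum_(t <- r | P t) coef (F t) i w j.
Proof. exact: (big_morph (fun u => coef u i w j)). Qed.

Lemma coef_vtxM Q l (u : series K Q) i w j :
  coef (vtx K Q l * u) i w j = (i == l)%:R * coef u i w j.
Proof.
rewrite coefM (bigD1 l) //= [X in _ + X]big1 ?addr0 => [|m ml]; last first.
  by apply: big1 => n _; rewrite coef_vtx (negPf ml) !andbF mul0r.
rewrite big_ord_recl take0 drop0 coef_vtx !eqxx andbT.
rewrite big1 ?addr0 => [|n _].
  by case: eqP => [->//|_]; rewrite !mul0r.
by rewrite coef_vtx; case: w n => [[]//|c w] n; rewrite andbF mul0r.
Qed.

Lemma coef_Mvtx Q l (u : series K Q) i w j :
  coef (u * vtx K Q l) i w j = coef u i w j * (j == l)%:R.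
Proof.
rewrite coefM (bigD1 l) //= [X in _ + X]big1 ?addr0 => [|m ml]; last first.
  by apply: big1 => n _; rewrite coef_vtx (negPf ml) mulr0.
rewrite big_ord_recr /= take_size drop_size coef_vtx !eqxx /=.
rewrite big1 ?add0r => [|n _].
  by case: eqP => [->//|_]; rewrite !mulr0.
rewrite coef_vtx -size_eq0 size_drop subn_eq0 leqNgt ltn_ord.
by rewrite andbF mulr0.
Qed.

Lemma vtx_idem Q l : vtx K Q l * vtx K Q l = vtx K Q l.
Proof.
apply: seriesP => i w j _; rewrite coef_vtxM coef_vtx.
by case: eqP => _; rewrite ?mul1r ?mul0r.
Qed.

Lemma vtxC_idem Q l : vtxC K Q l * vtxC K Q l = vtxC K Q l.
Proof.
rewrite /vtxC mulrBl mul1r mulrBr mulr1 vtx_idem subrr subr0 //.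
Qed.

Lemma coef_arrM Q (a : Q) (u : series K Q) i w j :
  coef (arr K a * u) i w j =
  if w is c :: w' then ((c == a) && (i == hd a))%:R * coef u (tl a) w' j else 0.
Proof.
rewrite coefM (bigD1 (tl a)) //= [X in _ + X]big1 ?addr0 => [|m ml]; last first.
  by apply: big1 => n _; rewrite coef_arr (negPf ml) !andbF mul0r.
case: w => [|c w]; first by rewrite big_ord_recl big_ord0 coef_arr andbF mul0r addr0.
rewrite !big_ord_recl /= take0 drop0 coef_arr /= andbF mul0r add0r.
rewrite coef_arr eqxx andbT [_ && _]andbC eqseq_cons andbT big1 ?addr0 // => n _.
rewrite coef_arr eqseq_cons; case: w n => [[]//|c' w] n.
by rewrite !andbF mul0r.
Qed.

(** Coefficients are pulled back along f, so no question of convergence arises. For f bijective and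
    swapping ends this is the anti-isomorphism extending the inverse of f; [opser], [unopser] and
    [premut_op] are instances. *)
Definition antiser A B (f : B -> A) (u : series K A) : series K B :=
  mkseries (fun i (w : seq B) j => coef u j (rev (map f w)) i).

Section Anti.
Variables (A B : quiver Q0) (f : B -> A).
Hypotheses (hdf : forall b, hd (f b) = tl b) (tlf : forall b, tl (f b) = hd b).

Lemma walk_anti i (w : seq B) j : walk j (rev (map f w)) i = walk i w j.
Proof.
elim: w i => [|c w IH] i /=; first by rewrite eq_sym.
by rewrite rev_cons walk_rcons IH // hdf // tlf // eq_sym andbC eq_sym.
Qed.

Lemma coef_anti u i w j : coef (antiser f u) i w j = coef u j (rev (map f w)) i.
Proof.
by rewrite coef_mk; case: ifP => // nw; rewrite coef_notwalk // walk_anti ?nw.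
Qed.

Lemma antiser_linear : linear (antiser f).
Proof.
by move=> a u v; apply: seriesP => i w j _; rewrite coef_anti !(coefD, coefZ) !coef_anti.
Qed.

Lemma antiserD u v : antiser f (u + v) = antiser f u + antiser f v.
Proof. exact: (linearD (mklin antiser_linear)). Qed.

Lemma antiserN u : antiser f (- u) = - antiser f u.
Proof. exact: (linearN (mklin antiser_linear)). Qed.

Lemma antiser_sum (T : Type) (r : seq T) (P : pred T) (F : T -> series K A) :
  antiser f (\sum_(t <- r | P t) F t) = \sum_(t <- r | P t) antiser f (F t).
Proof. exact: (linear_sum (mklin antiser_linear)). Qed.

Lemma antiser1 : antiser f 1 = 1.
Proof.
apply: seriesP => i w j _; rewrite coef_anti // !coef_one [j == i]eq_sym.
by rewrite -!size_eq0 size_rev size_map.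
Qed.

Lemma antiserM u v : antiser f (u * v) = antiser f v * antiser f u.
Proof.
apply: seriesP => i w j _; rewrite coef_anti // !coefM; apply: eq_bigr => l _.
(* Cutting the reversed word after n letters amounts to cutting the word n letters before its
   end. *)
rewrite size_rev size_map [RHS](reindex_inj rev_ord_inj); apply: eq_bigr => n _.
rewrite mulrC !coef_anti // /= subSS; have nw : (n <= size w)%N by rewrite -ltnS.
rewrite take_rev drop_rev size_map map_take map_drop.
by rewrite /take /drop -/take -/drop.
Qed.

Lemma antiser_potential u : is_potential u -> is_potential (antiser f u).
Proof.
move=> pu i w j; rewrite coef_anti // => /pu[-> nw]; split=> // w0.
by apply: nw; rewrite w0.
Qed.

Lemma antiser_mpow n u : mpow n u -> mpow n (antiser f u).
Proof.
by move=> un i w j sw; rewrite coef_anti // un // size_rev size_map.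
Qed.

Lemma antiser_vtx j : antiser f (vtx K A j) = vtx K B j.
Proof.
apply: seriesP => i w l _; rewrite coef_anti // !coef_vtx.
rewrite -!size_eq0 size_rev size_map.
by case: (i == j); case: (l == j); rewrite ?andbT ?andbF.
Qed.

Section Inverse.
Variable g : A -> B.
Hypotheses (fK : cancel f g) (gK : cancel g f).

Lemma antiser_path i (w : seq A) j : walk i w j ->
  antiser f (path_series K i w j) = path_series K j (rev (map g w)) i.
Proof.
have hdg a : hd (g a) = tl a by rewrite -[in RHS](gK a) tlf.
have tlg a : tl (g a) = hd a by rewrite -[in RHS](gK a) hdf.
move=> ww; apply: seriesP => i' w' j' _; rewrite coef_anti // !coef_path //.
  have -> : (w' == rev (map g w)) = (rev (map f w') == w).
    apply/eqP/eqP => [->|<-]; first by rewrite map_rev revK mapK.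
    by rewrite map_rev revK mapK.
  by case: (i' == j); case: (j' == i); rewrite ?andbT ?andbF.
rewrite -[w in walk i w j](mapK gK) -[map f _]revK in ww.
move: ww.
rewrite -map_rev walk_anti. done.
Qed.

Lemma antiser_arr a : antiser f (arr K a) = arr K (g a).
Proof.
rewrite /arr antiser_path /=; last by rewrite !eqxx.
by congr path_series; rewrite -[in LHS](gK a) ?tlf ?hdf.
Qed.

End Inverse.
End Anti.

Lemma antiserK A B (f : B -> A) (g : A -> B) :
  (forall b, hd (f b) = tl b) -> (forall b, tl (f b) = hd b) -> cancel g f ->
  cancel (antiser f) (antiser g).
Proof.
move=> hdf tlf gK u.
have hdg a : hd (g a) = tl a by rewrite -[in RHS](gK a) tlf.
have tlg a : tl (g a) = hd a by rewrite -[in RHS](gK a) hdf.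
apply: seriesP => i w j _; rewrite !coef_anti //.
by rewrite map_rev revK -map_comp (eq_map gK) map_id.
Qed.

End AntiSeries.

(** * Cyclic derivatives and reversal *)

Section Cyclic.
Variables (K : fieldType) (Q0 : finType).
Implicit Types Q : quiver Q0.

(** Up to conditions on end points, the coefficient of w in a cyclic derivative is this sum at a w,
    or at b a w. Its invariance under rotation makes the derivatives commute with reversal. *)
Definition cycsum Q (S : series K Q) (u : seq Q) : K :=
  \sum_(n < size u) \sum_(v : Q0) coef S v (rot n u) v.

Lemma sum_rotr Q (F : seq Q -> K) (u : seq Q) :
  \sum_(n < size u) F (rotr n u) = \sum_(n < size u) F (rot n u).
Proof.
case su: (size u) => [|m]; first by rewrite !big_ord0.
rewrite !big_ord_recl rot0 /rotr subn0 rot_size; congr (_ + _).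
rewrite [RHS](reindex_inj rev_ord_inj); apply: eq_bigr => n _.
by congr (F (rot _ u)); rewrite /= /bump !leq0n !add1n su subSS subnSK.
Qed.

(** For each n the only c with rot n c = u is rotr n u, and left and right rotations of u give the
    same total. *)
Lemma cycsumE Q (S : series K Q) (u : seq Q) :
  \sum_(v : Q0) \sum_(c : (size u).-tuple Q) \sum_(n < size u | rot n c == u)
    coef S v c v = cycsum S u.
Proof.
rewrite /cycsum -(sum_rotr (fun c => \sum_v coef S v c v)).
rewrite [RHS]exchange_big; apply: eq_bigr => v _.
rewrite (exchange_big_dep xpredT) //=; apply: eq_bigr => n _.
have su : size (rotr n u) == size u by rewrite size_rotr.
rewrite (big_pred1 (Tuple su)) // => c /=.
rewrite -val_eqE /=; apply/eqP/eqP => [e|->]; last exact: rotrK.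
by rewrite -(rotK n (tval c)) e.
Qed.

Lemma cycsum_rot1 Q (S : series K Q) (u : seq Q) : cycsum S (rot 1 u) = cycsum S u.
Proof.
case: u => [//|c u]; rewrite /cycsum size_rot.
pose G n := \sum_v coef S v (rot n (c :: u)) v.
transitivity (\sum_(n < (size u).+1) G n.+1).
  by apply: eq_bigr => n _; rewrite /G -[(nat_of_ord n).+1]addn1 rotD // addn1 ltn_ord.
rewrite -[RHS]/(\sum_(n < (size u).+1) G n) big_ord_recr big_ord_recl /= addrC.
by congr (_ + _); rewrite /G rot0 -[(size u).+1]/(size (c :: u)) rot_size.
Qed.

Lemma coef_cder Q (S : series K Q) a i w j : coef (cder a S) i w j =
  if [&& i == tl a, j == hd a & walk i w j] then cycsum S (a :: w) else 0.
Proof.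
rewrite /cder coef_mk -(cycsumE S (a :: w)).
by case: (walk i w j); rewrite ?andbT ?andbF //; case: (_ && _).
Qed.

Lemma coef_cder2 Q (S : series K Q) b a i w j : coef (cder2 b a S) i w j =
  if [&& i == tl a, j == hd b & walk i w j] then cycsum S [:: b, a & w] else 0.
Proof.
rewrite /cder2 coef_mk -(cycsumE S [:: b, a & w]).
by case: (walk i w j); rewrite ?andbT ?andbF //; case: (_ && _).
Qed.

Section Anti.
Variables (A B : quiver Q0) (f : B -> A).
Hypotheses (hdf : forall b, hd (f b) = tl b) (tlf : forall b, tl (f b) = hd b).

Lemma cycsum_anti (S : series K A) (u : seq B) :
  cycsum (antiser f S) u = cycsum S (rev (map f u)).
Proof.
rewrite /cycsum size_rev size_map.
rewrite -[in RHS](size_map f u) -[in RHS](size_rev (map f u)).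
rewrite -(sum_rotr (fun c => \sum_v coef S v c v)) size_rev size_map.
apply: eq_bigr => n _; apply: eq_bigr => v _.
by rewrite coef_anti // map_rot rev_rot.
Qed.

Lemma cder_anti (S : series K A) b :
  cder b (antiser f S) = antiser f (cder (f b) S).
Proof.
apply: seriesP => i w j _; rewrite coef_anti // !coef_cder hdf tlf walk_anti //.
rewrite cycsum_anti /= rev_cons -rot1_cons cycsum_rot1.
by case: (i == _); case: (j == _).
Qed.

Lemma cder2_anti (S : series K A) b1 b2 :
  cder2 b1 b2 (antiser f S) = antiser f (cder2 (f b2) (f b1) S).
Proof.
apply: seriesP => i w j _; rewrite coef_anti // !coef_cder2 hdf tlf walk_anti //.
(* Reversal sends the two leading letters to the end; two rotations bring them back to the front as
   f b2, f b1. *)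
rewrite cycsum_anti /= !rev_cons -rot1_cons cycsum_rot1 -rcons_cons -rot1_cons.
by rewrite cycsum_rot1; case: (i == _); case: (j == _).
Qed.

End Anti.

(** Each occurrence of b in a cycle is followed cyclically by exactly one arrow a, which ends at k.
    Together with the mirror identity this yields alpha gamma = 0 = gamma beta, since cyclic
    derivatives act by 0. *)
Lemma sum_arr_cder2 Q (S : series K Q) k b : loopfree Q -> tl b = k ->
  \sum_(a : inarr k Q) arr K (val a) * cder2 b (val a) S = cder b S.
Proof.
move=> lf tb; apply: seriesP => i w j iwj; rewrite coef_sum coef_cder.
under eq_bigr do rewrite coef_arrM.
case: w iwj => [/eqP ij|c w /= /andP[/eqP <- wj]].
  (* A path of length 0 could occur in the derivative along b only if b were a loop. *)
  rewrite big1 //; case: ifP => // /and3P[/eqP it /eqP jh _].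
  by case: (lf b); rewrite -jh -ij it.
rewrite wj eqxx andbT tb.
have [hk|hk] := eqVneq (hd c) k; last first.
  rewrite big1 // => a _; case: eqP => [e|_]; last by rewrite mul0r.
  by rewrite e (eqP (valP a)) eqxx in hk.
pose a0 : inarr k Q := exist (fun a : Q => hd a == k) c (introT eqP hk).
rewrite (bigD1 a0) //= big1 ?addr0 => [|a na].
  by rewrite !eqxx mul1r coef_cder2 wj !eqxx andbT.
case: eqP => [e|_]; last by rewrite mul0r.
by case/eqP: na; apply: val_inj.
Qed.

(** The preceding identity on the opposite quiver, carried back by reversal. *)
Lemma sum_cder2_arr Q (S : series K Q) k a : loopfree Q -> hd a = k ->
  \sum_(b : outarr k Q) cder2 (val b) a S * arr K (val b) = cder a S.
Proof.
move=> lf ha.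
pose f := fun b : opq Q => b : Q; pose g := fun a : Q => a : opq Q.
have fK := @antiserK K Q0 Q (opq Q) f g (fun=> erefl) (fun=> erefl) (fun=> erefl).
apply: (can_inj fK); rewrite -[a in RHS]/(f (g a)) -cder_anti //.
have lf' : loopfree (opq Q) by move=> c /esym/lf.
rewrite -(@sum_arr_cder2 (opq Q) (antiser f S) k (g a) lf' ha).
rewrite (antiser_sum (f := f)) //; apply: eq_bigr => b _.
by rewrite antiserM // (@cder2_anti Q (opq Q)) // (@antiser_arr K Q0 Q (opq Q) f _ _ g).
Qed.

End Cyclic.

(** * Reversal carried through premutation, kappa and psi *)

Section ArrowMaps.
Variables (Q0 : finType) (k : Q0) (A B : quiver Q0).
Variable f : B -> A.
Hypotheses (hdf : forall b, hd (f b) = tl b) (tlf : forall b, tl (f b) = hd b).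

Fact anti_keep_proof (c : keeparr k B) : (hd (f (val c)) != k) && (tl (f (val c)) != k).
Proof. by rewrite hdf tlf andbC; exact: (valP c). Qed.
Definition anti_keep (c : keeparr k B) : keeparr k A := exist _ (f (val c)) (anti_keep_proof c).
Fact anti_out_proof (a : inarr k B) : tl (f (val a)) == k.
Proof. by rewrite tlf; exact: (valP a). Qed.
Definition anti_out (a : inarr k B) : outarr k A := exist _ (f (val a)) (anti_out_proof a).
Fact anti_in_proof (b : outarr k B) : hd (f (val b)) == k.
Proof. by rewrite hdf; exact: (valP b). Qed.
Definition anti_in (b : outarr k B) : inarr k A := exist _ (f (val b)) (anti_in_proof b).

(** Being defined for an arbitrary end-swapping f, the construction applies to its own result, as
    the double premutation under [psi] requires. *)
Definition premut_anti (d : premut k B) : premut k A :=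
  match d with
  | Keep c => Keep (anti_keep c)
  | Comp b a => Comp (anti_out a) (anti_in b)
  | StarIn a => StarOut (anti_out a)
  | StarOut b => StarIn (anti_in b)
  end.

Lemma hd_premut_anti d : hd (premut_anti d) = tl d.
Proof. by case: d => * /=. Qed.
Lemma tl_premut_anti d : tl (premut_anti d) = hd d.
Proof. by case: d => * /=. Qed.

Lemma expand_anti (d : premut k B) :
  expand (premut_anti d : parrow k A) = rev (map f (expand (d : parrow k B))).
Proof. by case: d. Qed.

Lemma expand_anti_seq (w : seq (premut k B)) :
  flatten (map (@expand _ k A) (rev (map premut_anti w))) =
  rev (map f (flatten (map (@expand _ k B) w))).
Proof.
elim: w => //= d w IH.
by rewrite rev_cons map_rcons flatten_rcons IH expand_anti map_cat rev_cat.
Qed.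

Definition delq_anti (c : delq k B) : delq k A := anti_keep c.

Lemma hd_delq_anti c : hd (delq_anti c) = tl c.
Proof. by apply: val_inj; exact: hdf. Qed.
Lemma tl_delq_anti c : tl (delq_anti c) = hd c.
Proof. by apply: val_inj; exact: tlf. Qed.

End ArrowMaps.

Section ArrowMapsInverse.
Variables (Q0 : finType) (k : Q0) (A B : quiver Q0) (f : B -> A) (g : A -> B).
Hypotheses (hdf : forall b, hd (f b) = tl b) (tlf : forall b, tl (f b) = hd b).
Hypotheses (hdg : forall b, hd (g b) = tl b) (tlg : forall b, tl (g b) = hd b).
Hypothesis fK : cancel f g.

Lemma premut_antiK :
  cancel (premut_anti (k := k) hdf tlf) (premut_anti hdg tlg).
Proof.
case=> [c|b a|a|b].
- by congr Keep; apply: val_inj; exact: fK.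
- by congr Comp; apply: val_inj; exact: fK.
- by congr StarIn; apply: val_inj; exact: fK.
- by congr StarOut; apply: val_inj; exact: fK.
Qed.

Lemma delq_antiK : cancel (delq_anti (k := k) hdf tlf) (delq_anti hdg tlg).
Proof. by move=> c; apply: val_inj; exact: fK. Qed.

End ArrowMapsInverse.

Section KappaAnti.
Variables (K : fieldType) (Q0 : finType) (k : Q0) (A B : quiver Q0).
Variable f : premut k B -> premut k A.
Hypotheses (hdf : forall b, hd (f b) = tl b) (tlf : forall b, tl (f b) = hd b).

Lemma coef_kappa (Q : quiver Q0) (u : series K (premut k Q)) i w j : walk i w j ->
  coef (kappa k u) i w j =
  coef u (val i) (flatten [seq expand (val c : parrow k (premut k Q)) | c <- w]) (val j).
Proof. by move=> ww; rewrite coef_mk ww. Qed.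

Local Notation D := (delq_anti (k := k) (hd_premut_anti (k := k) hdf tlf)
  (tl_premut_anti (k := k) hdf tlf)).

Lemma kappa_anti (u : series K (premut k A)) :
  kappa k (antiser f u) = antiser D (kappa k u).
Proof.
apply: seriesP => i w j ww; rewrite (coef_anti (hd_delq_anti _ _) (tl_delq_anti _ _)).
rewrite !coef_kappa ?(walk_anti (hd_delq_anti _ _) (tl_delq_anti _ _)) //.
rewrite (coef_anti hdf tlf); congr coef.
have -> : [seq expand (val c : parrow k (premut k A)) | c <- rev (map D w)] =
   [seq expand c | c <- rev (map (premut_anti (k := k) hdf tlf) (map val w))].
  rewrite !map_rev; congr rev.
  by rewrite -!map_comp.
by rewrite expand_anti_seq -map_comp.
Qed.

End KappaAnti.

Section PsiAnti.
Variables (K : fieldType) (Q0 : finType) (k : Q0).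
Implicit Types A B Q : quiver Q0.

Lemma vtx_arr Q (c : Q) : vtx K Q (hd c) * arr K c = arr K c.
Proof.
apply: seriesP => i w j _; rewrite coef_vtxM coef_arr.
by case: eqP; rewrite ?mul1r ?mul0r.
Qed.
Lemma arr_vtx Q (c : Q) : arr K c * vtx K Q (tl c) = arr K c.
Proof.
apply: seriesP => i w j _; rewrite coef_Mvtx coef_arr.
by case: (j == _); rewrite ?andbF ?mulr1 ?mul0r.
Qed.
Lemma vtx_cder2 Q (S : series K Q) b a : vtx K Q (tl a) * cder2 b a S = cder2 b a S.
Proof.
apply: seriesP => i w j _; rewrite coef_vtxM coef_cder2.
by case: eqP; rewrite ?mul1r ?mul0r.
Qed.
Lemma cder2_vtx Q (S : series K Q) b a : cder2 b a S * vtx K Q (hd b) = cder2 b a S.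
Proof.
apply: seriesP => i w j _; rewrite coef_Mvtx coef_cder2.
by case: (j == _); rewrite ?andbF ?mulr1 ?mul0r.
Qed.

Lemma psi_arr_hd Q (S : series K Q) c :
  vtx K Q (val (hd c)) * psi_arr (k := k) S c = psi_arr S c.
Proof.
case: c => -[[[c|b a|a|b] /= pd]|[[c|b a|a|b] /= py] [[c'|b' a'|a'|b'] /= px]|a|b] /= pc;
  rewrite /psi_arr /= ?mulr0 ?mulrN ?vtx_cder2 ?mulrA ?vtx_arr //.
Qed.

Lemma psi_arr_tl Q (S : series K Q) c :
  psi_arr (k := k) S c * vtx K Q (val (tl c)) = psi_arr S c.
Proof.
case: c => -[[[c|b a|a|b] /= pd]|[[c|b a|a|b] /= py] [[c'|b' a'|a'|b'] /= px]|a|b] /= pc;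
  rewrite /psi_arr /= ?mul0r ?mulNr ?cder2_vtx -?mulrA ?arr_vtx //.
Qed.

(** [subst] places an idempotent to the left of each product only, whereas reversal brings it to the
    right; on walks the two positions agree. *)
Lemma psi_prod_vtx Q (S : series K Q) i (v : seq (delq k (premut k (premut k Q)))) j :
  walk i v j -> vtx K Q (val i) * \prod_(c <- v) psi_arr S c =
    \prod_(c <- v) psi_arr S c * vtx K Q (val j).
Proof.
elim: v i => [|c v IH] i /=; first by move=> /eqP->; rewrite big_nil mul1r mulr1.
move=> /andP[/eqP<- /IH e]; rewrite big_cons mulrA psi_arr_hd -mulrA -e mulrA.
by rewrite psi_arr_tl.
Qed.

Section Maps.
Variables (A B : quiver Q0) (f : B -> A) (g : A -> B).
Hypotheses (hdf : forall b, hd (f b) = tl b) (tlf : forall b, tl (f b) = hd b).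
Hypotheses (hdg : forall b, hd (g b) = tl b) (tlg : forall b, tl (g b) = hd b).
Hypotheses (fK : cancel f g) (gK : cancel g f).

Local Notation f1 := (premut_anti (k := k) hdf tlf).
Local Notation hdf1 := (hd_premut_anti (k := k) hdf tlf).
Local Notation tlf1 := (tl_premut_anti (k := k) hdf tlf).
Local Notation D2 := (delq_anti (k := k) (hd_premut_anti (k := k) hdf1 tlf1)
  (tl_premut_anti (k := k) hdf1 tlf1)).
Local Notation g1 := (premut_anti (k := k) hdg tlg).
Local Notation hdg1 := (hd_premut_anti (k := k) hdg tlg).
Local Notation tlg1 := (tl_premut_anti (k := k) hdg tlg).
Local Notation E2 := (delq_anti (k := k) (hd_premut_anti (k := k) hdg1 tlg1)
  (tl_premut_anti (k := k) hdg1 tlg1)).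

Lemma psi_arr_anti (S : series K A) c :
  psi_arr (k := k) (antiser f S) c = antiser f (psi_arr S (D2 c)).
Proof.
have a0 : antiser f (0 : series K A) = 0 by exact: (linear0 (mklin (antiser_linear hdf tlf))).
have gf x : g (f x) = x by apply: fK.
case: c => -[[[c|b a|a|b] /= pd]|[[c|b a|a|b] /= py] [[c'|b' a'|a'|b'] /= px]|a|b] /= pc;
  rewrite /psi_arr /= ?a0 ?antiserN ?antiserM ?(antiser_arr K hdf tlf fK gK) ?gf ?cder2_anti //.
Qed.

Lemma prod_anti (S : series K A) (v : seq (delq k (premut k (premut k B)))) :
  antiser f (\prod_(c <- rev (map D2 v)) psi_arr S c) =
  \prod_(c <- v) psi_arr (antiser f S) c.
Proof.
elim: v => [|c v IH]; first by rewrite !big_nil antiser1.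
by rewrite /= rev_cons big_rcons antiserM // IH big_cons psi_arr_anti.
Qed.

(** Words are matched by reversal, which also exchanges the two summations over end points. On a
    word that is a walk the idempotent can be moved across the product; any other word has
    coefficient 0 on both sides. *)
Lemma psi_anti (S : series K A) u :
  psi (k := k) (antiser f S) (antiser D2 u) = antiser f (psi S u).
Proof.
apply: seriesP => i w j ww; rewrite coef_anti // {1}/psi {1}/psi /subst !coef_mk walk_anti // ww.
rewrite [RHS]exchange_big; apply: eq_bigr => i' _; apply: eq_bigr => j' _.
rewrite size_rev size_map; apply: eq_bigr => n _.
pose h (v : n.-tuple (delq k (premut k (premut k B)))) :
  n.-tuple (delq k (premut k (premut k A))) := [tuple of rev (map D2 v)].
pose h' (v : n.-tuple (delq k (premut k (premut k A)))) :
  n.-tuple (delq k (premut k (premut k B))) := [tuple of rev (map E2 v)].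
have DK : cancel D2 E2 by apply/delq_antiK/premut_antiK/premut_antiK.
have EK : cancel E2 D2 by apply/delq_antiK/premut_antiK/premut_antiK.
have hK : cancel h h'.
  by move=> v; apply: val_inj; rewrite /= map_rev revK mapK.
have h'K : cancel h' h.
  by move=> v; apply: val_inj; rewrite /= map_rev revK mapK.
rewrite [RHS](reindex h); last by exists h' => v _; [exact: hK|exact: h'K].
apply: eq_bigr => v _; rewrite (coef_anti (hd_delq_anti _ _) (tl_delq_anti _ _)).
have [wv|nwv] := boolP (walk i' (val v) j'); last first.
  by rewrite coef_notwalk ?mul0r // (walk_anti (hd_delq_anti _ _) (tl_delq_anti _ _)).
congr (_ * _).
rewrite -(coef_anti hdf tlf) antiserM // prod_anti antiser_vtx //.
by rewrite -(psi_prod_vtx _ wv).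
Qed.

Lemma psikappa_anti (S : series K A) u :
  psikappa (k := k) (antiser f S) (antiser f1 u) = antiser f (psikappa S u).
Proof. by rewrite /psikappa (kappa_anti hdf1 tlf1) psi_anti. Qed.

End Maps.
End PsiAnti.

Local Arguments dual_app : simpl never.

Section OppositeSeries.
Variables (K : fieldType) (Q0 : finType).
Implicit Types Q : quiver Q0.

Lemma opserE Q (u : series K Q) : opser u = antiser (fun b : opq Q => b : Q) u.
Proof. by apply: seriesP => i w j ww; rewrite !coef_mk ww map_id. Qed.

Lemma unopserE Q (u : series K (opq Q)) : unopser u = antiser (fun b : Q => b : opq Q) u.
Proof. by apply: seriesP => i w j ww; rewrite !coef_mk ww map_id. Qed.

Lemma opserK Q : cancel (@opser K Q0 Q) (@unopser K Q0 Q).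
Proof. by move=> u; rewrite opserE unopserE (antiserK (g := fun b : Q => b : opq Q)). Qed.

Lemma unopserK Q : cancel (@unopser K Q0 Q) (@opser K Q0 Q).
Proof. by move=> u; rewrite opserE unopserE (antiserK (B := Q)). Qed.

Lemma unopser_vtx Q j : unopser (vtx K (opq Q) j) = vtx K Q j.
Proof. by rewrite unopserE (@antiser_vtx K Q0 (opq Q) Q). Qed.

Lemma unopser1 Q : unopser (1 : series K (opq Q)) = 1.
Proof. by rewrite unopserE (@antiser1 K Q0 (opq Q) Q). Qed.

Lemma unopserM Q (u v : series K (opq Q)) : unopser (u * v) = unopser v * unopser u.
Proof. by rewrite !unopserE (antiserM (B := Q)). Qed.

Lemma unopser_vtxC Q j : unopser (vtxC K (opq Q) j) = vtxC K Q j.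
Proof.
rewrite unopserE /vtxC (antiserD (B := Q)) // (antiserN (B := Q)) //.
by rewrite (@antiser1 K Q0 (opq Q) Q) // (@antiser_vtx K Q0 (opq Q) Q).
Qed.

Lemma unopser_arr Q (c : Q) : unopser (arr K (c : opq Q)) = arr K c.
Proof.
by rewrite unopserE (@antiser_arr K Q0 (opq Q) Q _ _ _ (fun b : opq Q => b : Q)).
Qed.

Lemma unopser_cder2 Q (S : series K Q) (a b : Q) :
  unopser (@cder2 K Q0 (opq Q) a b (opser S)) = cder2 b a S.
Proof.
by rewrite opserE (@cder2_anti K Q0 Q (opq Q)) // -opserE opserK.
Qed.

Variable k : Q0.

(** The two maps carry different proofs of incidence with k, so they agree by proof irrelevance and
    not by conversion. *)
Lemma op_arrowE Q : @op_arrow Q0 k Q =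
  premut_anti (k := k) (f := fun b : opq Q => b : Q) (fun=> erefl) (fun=> erefl).
Proof.
apply/funext => -[c|b a|a|b].
- by congr Keep; apply: val_inj.
- by congr Comp; apply: val_inj.
- by congr StarOut; apply: val_inj.
- by congr StarIn; apply: val_inj.
Qed.

Lemma hd_op_arrow Q (d : premut k (opq Q)) : hd (op_arrow d) = tl d.
Proof. by rewrite op_arrowE hd_premut_anti. Qed.
Lemma tl_op_arrow Q (d : premut k (opq Q)) : tl (op_arrow d) = hd d.
Proof. by rewrite op_arrowE tl_premut_anti. Qed.

Definition op_arrow_inv Q : premut k Q -> premut k (opq Q) :=
  premut_anti (k := k) (f := fun b : Q => b : opq Q) (fun=> erefl) (fun=> erefl).

Lemma op_arrowK Q : cancel (@op_arrow Q0 k Q) (@op_arrow_inv Q).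
Proof. by rewrite op_arrowE; apply: premut_antiK. Qed.
Lemma op_arrow_invK Q : cancel (@op_arrow_inv Q) (@op_arrow Q0 k Q).
Proof. by rewrite op_arrowE; apply: premut_antiK. Qed.

Lemma premut_opE Q (u : series K (premut k Q)) :
  premut_op u = antiser (@op_arrow Q0 k Q) u.
Proof. by []. Qed.

Lemma coef_premut_op Q (u : series K (premut k Q)) i w j :
  coef (premut_op u) i w j = coef u j (rev (map (@op_arrow Q0 k Q) w)) i.
Proof. exact: (coef_anti (@hd_op_arrow Q) (@tl_op_arrow Q)). Qed.

Lemma premut_opM Q (u v : series K (premut k Q)) :
  premut_op (u * v) = premut_op v * premut_op u.
Proof. exact: (antiserM (@hd_op_arrow Q) (@tl_op_arrow Q)). Qed.

Lemma premut_op_ehat Q : premut_op (ehat K k Q) = ehat K k (opq Q).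
Proof.
pose h := @hd_op_arrow Q; pose t := @tl_op_arrow Q.
rewrite premut_opE /ehat /vtxC (antiserD h t) (antiserN h t).
by rewrite (antiser1 _ h t) (antiser_vtx _ h t).
Qed.

Lemma psikappa_op Q (S : series K Q) (u : series K (premut k Q)) :
  unopser (psikappa (opser S) (premut_op u)) = psikappa S u.
Proof.
rewrite premut_opE opserE op_arrowE.
rewrite (@psikappa_anti K Q0 k Q (opq Q) _ (fun b : Q => b : opq Q)) //.
by rewrite -opserE opserK.
Qed.

Lemma coef_cut_right Q (a : inarr k Q) (u : series K (premut k Q)) i w j :
  walk i w j -> coef (cut_right a u) i w j =
    if j == tl (val a) then coef u i (rcons w (StarIn a)) k else 0.
Proof. by move=> ww; rewrite [LHS]coef_mk ww. Qed.

Lemma coef_cut_left Q (b : outarr k Q) (u : series K (premut k Q)) i w j :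
  walk i w j -> coef (cut_left b u) i w j =
    if i == hd (val b) then coef u k (StarOut b :: w) j else 0.
Proof. by move=> ww; rewrite [LHS]coef_mk ww. Qed.

Lemma cut_right_op Q (b : outarr k Q) (u : series K (premut k Q)) :
  cut_right (k := k) (Q := opq Q) b (premut_op u) = premut_op (cut_left b u).
Proof.
apply: seriesP => i w j ww; rewrite coef_premut_op coef_cut_right //.
rewrite coef_cut_left ?(walk_anti (@hd_op_arrow Q) (@tl_op_arrow Q)) //.
by rewrite coef_premut_op map_rcons rev_rcons.
Qed.

Lemma cut_left_op Q (a : inarr k Q) (u : series K (premut k Q)) :
  cut_left (k := k) (Q := opq Q) a (premut_op u) = premut_op (cut_right a u).
Proof.
apply: seriesP => i w j ww; rewrite coef_premut_op coef_cut_left //.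
rewrite coef_cut_right ?(walk_anti (@hd_op_arrow Q) (@tl_op_arrow Q)) //.
by rewrite coef_premut_op map_cons rev_cons.
Qed.

(** When the end points match, adding a starred letter to a walk gives a walk again, so both sides
    read the same coefficient of u; otherwise both sides are 0. *)
Lemma cut_left_right Q b a (u : series K (premut k Q)) :
  cut_left b (cut_right a u) = cut_right a (cut_left b u).
Proof.
apply: seriesP => i w j ww; rewrite coef_cut_left // [RHS]coef_cut_right //.
have wl : i = hd (val b) -> walk k (StarOut b :: w : seq (premut k Q)) j.
  by move=> ib; rewrite /= (valP b) -ib.
have wr : j = tl (val a) -> walk i (rcons w (StarIn a : premut k Q)) k.
  by move=> ja; rewrite walk_rcons /= (valP a) -ja ww.
have [ib|ib] := eqVneq i (hd (val b)); have [ja|ja] := eqVneq j (tl (val a)) => //.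
- by rewrite coef_cut_right ?wl // coef_cut_left ?wr // ib ja !eqxx rcons_cons.
- by rewrite coef_cut_right ?wl // (negPf ja).
by rewrite coef_cut_left ?wr // (negPf ib).
Qed.

End OppositeSeries.

(** * The dual of a mutated module *)

Section PairDual.
Variables (K : fieldType) (U V U' V' : lmodType K).
Variables (r : {linear U' -> dual U}) (s : {linear V' -> dual V}).

Definition pair_dual : {linear (U' * V')%type -> dual (U * V)%type} :=
  (transpose (@fst U V) \o (r \o (@fst U' V'))) \+ (transpose (@snd U V) \o (s \o (@snd U' V'))).

Lemma pair_dualE y x : dual_app (pair_dual y) x = dual_app (r y.1) x.1 + dual_app (s y.2) x.2.
Proof. by []. Qed.

Lemma pair_dual_bij : bijective r -> bijective s -> bijective pair_dual.
Proof.
move=> br bs; apply: linear_bij => [[y1 y2] y0|eta].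
  congr (_, _).
    apply: (bij_eq0 br); apply: dualP => x; have := pair_dualE (y1, y2) (x, 0).
    by rewrite y0 dual_app0r addr0.
  apply: (bij_eq0 bs); apply: dualP => x; have := pair_dualE (y1, y2) (0, x).
  by rewrite y0 dual_app0r add0r.
have [y1 y1E] := bij_surj br (transpose (inj1 U V) eta).
have [y2 y2E] := bij_surj bs (transpose (inj2 U V) eta).
exists (y1, y2); apply: dualP => -[x1 x2]; rewrite pair_dualE y1E y2E !transposeE.
rewrite -dual_appDr; congr dual_app.
by rewrite -[LHS]/(x1 + 0, 0 + x2) addr0 add0r.
Qed.

End PairDual.

Section AlgebraAction.
Variables (K : fieldType) (Q0 : finType) (Q : quiver Q0).
Variable M : action K (series K Q).
Hypothesis hM : @is_algebra_action K (series K Q) 1 *%R M.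

Lemma actM u v x : act M (u * v) x = act M u (act M v x).
Proof. by case: hM. Qed.

Lemma act_sum (T : finType) (F : T -> series K Q) x :
  act M (\sum_t F t) x = \sum_t act M (F t) x.
Proof. by case: hM => l _ _; exact: (linear_sum (mklin (l x))). Qed.

Lemma act_vtx_idem j x : act M (vtx K Q j) (act M (vtx K Q j) x) = act M (vtx K Q j) x.
Proof. by rewrite -actM vtx_idem. Qed.

Lemma act_vtxC_idem j x : act M (vtxC K Q j) (act M (vtxC K Q j) x) = act M (vtxC K Q j) x.
Proof. by rewrite -actM vtxC_idem. Qed.

End AlgebraAction.

(** * The triangle of a module and that of its dual *)

Section Triangle.
Variables (K : fieldType) (Q0 : finType) (k : Q0) (Q : quiver Q0).
Variables (S : series K Q) (D : decorated K Q).
Hypotheses (lfQ : loopfree Q) (hD : is_Pmodule S (dmod D)).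
Local Notation M := (dmod D).
Let hM := hD.1.

Lemma incl_block u i j (x : piece D j) :
  incl (block D u i j x) = act M (vtx K Q i) (act M u (incl x)).
Proof. by []. Qed.

Lemma incl_sum (V : lmodType K) (P : subspace V) (T : finType) (F : T -> sub P) :
  incl (\sum_t F t) = \sum_t incl (F t).
Proof. exact: linear_sum. Qed.

Lemma act_cder c x : act M (cder c S) x = 0.
Proof.
apply: hD.2 => n; exists (cder c S); last by rewrite subrr.
exists 1%N, (fun=> 1), (fun=> cder c S), (fun=> 1); split; first by exists c.
by rewrite big_ord1 mul1r mulr1.
Qed.

Lemma alpha_gamma y : alpha k D (gamma k S D y) = 0.
Proof.
apply: incl_inj; rewrite incl_sum.
rewrite (eq_bigr (fun a : inarr k Q => \sum_(b : outarr k Q)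
    act M (vtx K Q k) (act M (arr K (val a) * cder2 (val b) (val a) S) (incl (y b))))).
  rewrite exchange_big big1 // => b _; rewrite -linear_sum -act_sum //.
  by rewrite (sum_arr_cder2 _ lfQ (eqP (valP b))) act_cder linear0.
move=> a _; rewrite incl_block -[gamma k S D y a]/(\sum_b _) incl_sum !linear_sum.
apply: eq_bigr => b _; rewrite incl_block; congr (act M _ _).
by rewrite -!(actM hM) arr_vtx.
Qed.

Lemma gamma_beta x : gamma k S D (beta k D x) = 0.
Proof.
apply: functional_extensionality_dep => a; apply: incl_inj.
rewrite -[gamma k S D _ a]/(\sum_b block D (cder2 (val b) (val a) S) _ _ (beta k D x b)).
rewrite incl_sum (eq_bigr (fun b : outarr k Q =>
    act M (vtx K Q (tl (val a))) (act M (cder2 (val b) (val a) S * arr K (val b)) (incl x)))).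
  rewrite -linear_sum -act_sum // (sum_cder2_arr _ lfQ (eqP (valP a))).
  by rewrite act_cder linear0.
move=> b _; rewrite incl_block -[beta k D x b]/(block D (arr K (val b)) _ _ x) incl_block.
by congr (act M _ _); rewrite -!(actM hM) cder2_vtx.
Qed.

End Triangle.

Section DualTriangle.
Variables (K : fieldType) (Q0 : finType) (k : Q0) (Q : quiver Q0).
Variables (S : series K Q) (D : decorated K Q).
Hypotheses (lfQ : loopfree Q) (hD : is_Pmodule S (dmod D)).
Local Notation M := (dmod D).
Local Notation D' := (decorated_dual D).
Local Notation M' := (dmod D').
Let hM := hD.1.

Lemma act_dual u (phi : dual M) x :
  dual_app (act M' u phi : dual M) x = dual_app phi (act M (unopser u) x).
Proof. by []. Qed.

Definition piece_dual (j : Q0) : {linear piece D' j -> dual (piece D j)} :=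
  restrict_dual (act M (vtx K Q j)) (act M' (vtx K (opq Q) j)).

Lemma piece_dual_bij j : bijective (piece_dual j).
Proof.
apply: restrict_dual_bij; first exact: act_vtx_idem.
by move=> phi x; rewrite act_dual unopser_vtx.
Qed.

Lemma piece_dual_vtx j (phi : piece D' j) x :
  dual_app (incl phi : dual M) (act M (vtx K Q j) x) = dual_app (incl phi : dual M) x.
Proof.
have /mem_im[psi <-] := inclP phi.
by rewrite !act_dual unopser_vtx act_vtx_idem.
Qed.

Lemma block_dual u i j (phi : piece D' j) (x : piece D i) :
  dual_app (piece_dual i (block D' u i j phi)) x =
  dual_app (piece_dual j phi) (block D (unopser u) j i x).
Proof.
rewrite !restrict_dualE !incl_block !act_dual unopser_vtx.
by rewrite piece_dual_vtx (idem_incl _ (act_vtx_idem hM i)).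
Qed.

(** The arrows of [opq Q] ending at k are, by conversion, those of Q starting at k; hence [Min] of
    the dual module is paired with [Mout]. *)
Definition Min_dual : {linear Min k D' -> dual (Mout k D)} :=
  dsum_dual (fun b : outarr k Q => piece_dual (hd (val b))).
Definition Mout_dual : {linear Mout k D' -> dual (Min k D)} :=
  dsum_dual (fun a : inarr k Q => piece_dual (tl (val a))).

Lemma Min_dual_bij : bijective Min_dual.
Proof. by apply: dsum_dual_bij => b; exact: piece_dual_bij. Qed.
Lemma Mout_dual_bij : bijective Mout_dual.
Proof. by apply: dsum_dual_bij => b; exact: piece_dual_bij. Qed.

Lemma alpha_dual x : piece_dual k (alpha k D' x) = transpose (beta k D) (Min_dual x).
Proof.
apply: dualP => m; rewrite transposeE dsum_dualE.
rewrite -[alpha k D' x]/(\sum_(b : outarr k Q)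
  block D' (arr K (val b : opq Q)) k (hd (val b)) (x b)).
rewrite linear_sum dual_app_suml; apply: eq_bigr => b _.
by rewrite block_dual unopser_arr.
Qed.

Lemma beta_dual x : Mout_dual (beta k D' x) = transpose (alpha k D) (piece_dual k x).
Proof.
apply: dualP => m; rewrite transposeE dsum_dualE.
rewrite -[alpha k D m]/(\sum_(a : inarr k Q) block D (arr K (val a)) k (tl (val a)) (m a)).
rewrite dual_app_sumr; apply: eq_bigr => a _.
rewrite -[beta k D' x a]/(block D' (arr K (val a : opq Q)) (tl (val a)) k x).
by rewrite block_dual unopser_arr.
Qed.

Lemma gamma_dual x :
  Min_dual (gamma k (opser S) D' x) = transpose (gamma k S D) (Mout_dual x).
Proof.
apply: dualP => m; rewrite transposeE !dsum_dualE.
transitivity (\sum_(b : outarr k Q) \sum_(a : inarr k Q)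
  dual_app (piece_dual (tl (val a)) (x a))
    (block D (cder2 (val b) (val a) S) (tl (val a)) (hd (val b)) (m b))).
  apply: eq_bigr => b _.
  rewrite -[gamma _ _ _ x b]/(\sum_(a : inarr k Q) block D'
    (@cder2 K Q0 (opq Q) (val a) (val b) (opser S)) (hd (val b)) (tl (val a)) (x a)).
  rewrite linear_sum dual_app_suml; apply: eq_bigr => a _.
  by rewrite block_dual unopser_cder2.
rewrite exchange_big; apply: eq_bigr => a _.
rewrite -[gamma k S D m a]/(\sum_(b : outarr k Q)
  block D (cder2 (val b) (val a) S) (tl (val a)) (hd (val b)) (m b)).
by rewrite dual_app_sumr.
Qed.

(** This is the transpose of gamma beta = 0 under the pairings, so no action of the Jacobian ideal
    of the opposite potential has to be examined. *)
Lemma dual_alpha_gamma y : alpha k D' (gamma k (opser S) D' y) = 0.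
Proof.
apply: (bij_eq0 (piece_dual_bij k)); rewrite alpha_dual gamma_dual.
apply: dualP => x; rewrite !transposeE gamma_beta //.
exact: dual_app0r.
Qed.

Lemma dual_gamma_beta x : gamma k (opser S) D' (beta k D' x) = 0.
Proof.
apply: (bij_eq0 Min_dual_bij); rewrite gamma_dual beta_dual.
apply: dualP => y; rewrite !transposeE alpha_gamma //.
exact: dual_app0r.
Qed.

End DualTriangle.

Lemma incl_to_Mhat (K : fieldType) (Q0 : finType) (k : Q0) (Q : quiver Q0)
  (D : decorated K Q) x : incl (to_Mhat k D x) = act (dmod D) (vtxC K Q k) x.
Proof. by []. Qed.

Lemma into_MoutE (K : fieldType) (Q0 : finType) (k : Q0) (Q : quiver Q0)
    (D : decorated K Q) (b b' : outarr k Q) m :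
  incl (into_Mout D b m b') =
  if b' == b then act (dmod D) (vtx K Q (hd (val b'))) (incl m) else 0.
Proof.
rewrite -[into_Mout D b m b']/((if b' == b
  then toim (act (dmod D) (vtx K Q (hd (val b')))) \o @incl _ _ _
    : {linear Mhat k D -> piece D (hd (val b'))} else \0) m).
by case: ifP.
Qed.

Section MutationDual.
Variables (K : fieldType) (Q0 : finType) (k : Q0) (Q : quiver Q0).
Variables (S : series K Q) (D : decorated K Q).
Hypotheses (lfQ : loopfree Q) (hD : is_decorated_Pmodule S D).
Variables (d : description) (rho : rho_type k S D) (sigma : sigma_type k S D).
Hypotheses (rhoP : is_retraction rho) (sigmaP : is_section sigma).
Local Notation D' := (decorated_dual D).
Variables (d' : description) (rho' : rho_type k (opser S) D').
Variable sigma' : sigma_type k (opser S) D'.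
Hypotheses (rhoP' : is_retraction rho') (sigmaP' : is_section sigma').
Local Notation M := (dmod D).
Local Notation M' := (dmod D').
Local Notation V := (ddec D).
Local Notation V' := (ddec D').
Let hM := hD.1.1.

Lemma actV_idem c x : c * c = c -> act V c (act V c x) = act V c x.
Proof. by case: hD.2 => _ _ m cc; rewrite -m cc. Qed.

Lemma eKQ0_idem j : eKQ0 K j * eKQ0 K j = eKQ0 K j :> KQ0 K Q0.
Proof.
apply/ffunP => i; rewrite !ffunE; case: (i == j); [exact: mulr1|exact: mulr0].
Qed.

Lemma eKQ0C_idem j :
  (1 - eKQ0 K j) * (1 - eKQ0 K j) = 1 - eKQ0 K j :> KQ0 K Q0.
Proof. by rewrite mulrBl mul1r mulrBr mulr1 eKQ0_idem subrr subr0. Qed.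

Definition Vpiece_dual : {linear Vpiece D' k -> dual (Vpiece D k)} :=
  restrict_dual (act V (eKQ0 K k)) (act V' (eKQ0 K k)).

Lemma Vpiece_dual_bij : bijective Vpiece_dual.
Proof.
by apply: restrict_dual_bij => // x; apply: actV_idem; exact: eKQ0_idem.
Qed.

Lemma bar_k_dual : exists g : {linear bar_space (bar_k d' rho' sigma') ->
    dual (bar_space (bar_k d rho sigma))},
  [/\ bijective g,
    forall y, g (bar_alpha (bar_k d' rho' sigma') y) =
      transpose (bar_beta (bar_k d rho sigma)) (Mout_dual k D y) &
    forall x, transpose (bar_alpha (bar_k d rho sigma)) (g x) =
      Min_dual k D (bar_beta (bar_k d' rho' sigma') x)].
Proof.
have hP := hD.1.
apply: (completion_dual (PV := Vpiece_dual) (Pk := piece_dual D k)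
  (alpha := alpha k D) (beta := beta k D) (gamma := gamma k S D)
  (alpha' := alpha k D') (beta' := beta k D') (gamma' := gamma k (opser S) D')).
- by apply: completion_of_spec => //; [exact: alpha_gamma|exact: gamma_beta].
- by apply: completion_of_spec => //; [exact: dual_alpha_gamma|exact: dual_gamma_beta].
- exact: Min_dual_bij hP.
- exact: Mout_dual_bij hP.
- exact: piece_dual_bij hP _.
- exact: Vpiece_dual_bij.
- exact: alpha_dual hP.
- exact: beta_dual hP.
exact: gamma_dual hP.
Qed.

Definition Mhat_dual : {linear Mhat k D' -> dual (Mhat k D)} :=
  restrict_dual (act M (vtxC K Q k)) (act M' (vtxC K (opq Q) k)).

Lemma Mhat_dual_bij : bijective Mhat_dual.
Proof.
apply: restrict_dual_bij; first exact: act_vtxC_idem.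
by move=> phi x; rewrite act_dual unopser_vtxC.
Qed.

Lemma Mhat_vtxC (x : Mhat k D) : act M (vtxC K Q k) (incl x) = incl x.
Proof. by apply: idem_incl; exact: act_vtxC_idem. Qed.

Lemma Mhat_dual_to phi (x : Mhat k D) :
  dual_app (Mhat_dual (to_Mhat k D' phi)) x = dual_app (phi : dual M) (incl x).
Proof.
rewrite restrict_dualE (@incl_to_Mhat K Q0 k (opq Q) D').
by rewrite act_dual unopser_vtxC Mhat_vtxC.
Qed.

Lemma Mhat_dual_app (phi : Mhat k D') x :
  dual_app (Mhat_dual phi) (to_Mhat k D x) = dual_app (incl phi : dual M) x.
Proof.
have /mem_im[psi psiE] := inclP phi.
rewrite restrict_dualE incl_to_Mhat -psiE !act_dual unopser_vtxC.
by rewrite act_vtxC_idem.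
Qed.

Section Pairing.
Variable g : {linear bar_space (bar_k d' rho' sigma') ->
  dual (bar_space (bar_k d rho sigma))}.
Hypotheses (ga : forall y, g (bar_alpha (bar_k d' rho' sigma') y) =
  transpose (bar_beta (bar_k d rho sigma)) (Mout_dual k D y)).
Hypotheses (gb : forall x, transpose (bar_alpha (bar_k d rho sigma)) (g x) =
  Min_dual k D (bar_beta (bar_k d' rho' sigma') x)).

Definition Mbar_dual : {linear Mbar d' rho' sigma' -> dual (Mbar d rho sigma)} :=
  pair_dual Mhat_dual g.

(** Compatibility with the actions becomes an identity between pairings, stable under sums and under
    composition in reversed order, so it can be checked on the building blocks of
    [eta_tilde_fun]. *)
Definition adjoint (F' : Mbar d' rho' sigma' -> Mbar d' rho' sigma')
    (F : Mbar d rho sigma -> Mbar d rho sigma) :=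
  forall y x, dual_app (Mbar_dual (F' y)) x = dual_app (Mbar_dual y) (F x).

Lemma adjoint_comp F' F G' G : adjoint F' F -> adjoint G' G ->
  adjoint (fun y => F' (G' y)) (fun x => G (F x)).
Proof. by move=> a b y x; rewrite a b. Qed.

Lemma adjoint_add F' F G' G : adjoint F' F -> adjoint G' G ->
  adjoint (fun y => F' y + G' y) (fun x => F x + G x).
Proof. by move=> a b y x; rewrite linearD dual_appDl dual_appDr a b. Qed.

Lemma adjoint_sum (T : finType) F' F : (forall t : T, adjoint (F' t) (F t)) ->
  adjoint (fun y => \sum_t F' t y) (fun x => \sum_t F t x).
Proof.
move=> a y x; rewrite linear_sum dual_app_suml dual_app_sumr.
by apply: eq_bigr => t _; rewrite a.
Qed.

Lemma adjoint_ek z : adjoint (eta_ek d' rho' sigma' z) (eta_ek d rho sigma z).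
Proof.
move=> [phi xi] [m x].
rewrite -[eta_ek _ _ _ z (phi, xi)]/((0, z *: xi) : Mbar d' rho' sigma').
rewrite -[eta_ek _ _ _ z (m, x)]/((0, z *: x) : Mbar d rho sigma).
rewrite !pair_dualE /= !linear0 linearZ dual_app0l dual_app0r !add0r.
by rewrite dual_appZr.
Qed.

Lemma adjoint_Theta (u : series K (premut k Q)) :
  adjoint (Theta d' rho' sigma' (premut_op u)) (Theta d rho sigma u).
Proof.
move=> [phi xi] [m x].
rewrite -[Theta _ _ _ _ (phi, xi)]/((to_Mhat k D'
  (act M' (psikappa (opser S) (premut_op u)) (incl phi)), 0) : Mbar d' rho' sigma').
rewrite -[Theta _ _ _ _ (m, x)]/((to_Mhat k D (act M (psikappa S u) (incl m)), 0)
  : Mbar d rho sigma).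
rewrite !pair_dualE /= linear0 dual_app0l dual_app0r !addr0.
by rewrite Mhat_dual_to Mhat_dual_app act_dual psikappa_op.
Qed.

(** On the dual side b is an arrow ending at k, so its star acts through bbar', which [gb] turns
    into the transpose of abar; in the pairing only the summand of index b survives. *)
Lemma adjoint_in_out (b : outarr k Q) :
  adjoint (eta_in (k := k) (Q := opq Q) d' rho' sigma' b) (eta_out d rho sigma b).
Proof.
move=> [phi xi] [m x].
rewrite -[eta_in _ _ _ _ (phi, xi)]/((to_Mhat k D'
  (incl (bar_beta (bar_k d' rho' sigma') xi b)), 0) : Mbar d' rho' sigma').
rewrite -[eta_out _ _ _ _ (m, x)]/((0, bar_alpha (bar_k d rho sigma) (into_Mout D b m))
  : Mbar d rho sigma).
rewrite !pair_dualE /= linear0 dual_app0l dual_app0r addr0 add0r.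
rewrite Mhat_dual_to -(transposeE _ (g xi)) gb dsum_dualE (bigD1 b) //= big1 ?addr0.
  by rewrite restrict_dualE into_MoutE eqxx (piece_dual_vtx hD.1).
move=> b' nb; rewrite restrict_dualE into_MoutE (negPf nb).
exact: dual_app0r.
Qed.

Lemma adjoint_out_in (a : inarr k Q) :
  adjoint (eta_out (k := k) (Q := opq Q) d' rho' sigma' a) (eta_in d rho sigma a).
Proof.
move=> [phi xi] [m x].
rewrite -[eta_out _ _ _ _ (phi, xi)]/((0, bar_alpha (bar_k d' rho' sigma')
  (into_Mout (k := k) (Q := opq Q) D' a phi)) : Mbar d' rho' sigma').
rewrite -[eta_in _ _ _ _ (m, x)]/((to_Mhat k D
  (incl (bar_beta (bar_k d rho sigma) x a)), 0) : Mbar d rho sigma).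
rewrite !pair_dualE /= linear0 dual_app0l dual_app0r addr0 add0r.
rewrite Mhat_dual_app ga transposeE dsum_dualE (bigD1 a) //= big1 ?addr0.
  rewrite restrict_dualE (@into_MoutE K Q0 k (opq Q)) eqxx act_dual unopser_vtx.
  by rewrite (idem_incl _ (act_vtx_idem hM _)).
move=> a' na; rewrite restrict_dualE (@into_MoutE K Q0 k (opq Q)) (negPf na).
exact: dual_app0l.
Qed.

Lemma adjoint_eta_tilde (u : series K (premut k Q)) :
  adjoint (@eta_tilde_fun _ _ _ _ _ _ d' rho' sigma' (premut_op u))
    (@eta_tilde_fun _ _ _ _ _ _ d rho sigma u).
Proof.
set eh := ehat K k Q.
have A := adjoint_add (adjoint_add (adjoint_add (adjoint_add
  (adjoint_ek (coef u k [::] k)) (adjoint_Theta (eh * u * eh)))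
  (adjoint_sum (fun b => adjoint_comp (adjoint_Theta (cut_left b u * eh)) (adjoint_in_out b))))
  (adjoint_sum (fun a => adjoint_comp (adjoint_out_in a) (adjoint_Theta (eh * cut_right a u)))))
  (adjoint_sum (fun a => adjoint_sum (fun b => adjoint_comp (adjoint_out_in a)
    (adjoint_comp (adjoint_Theta (cut_left b (cut_right a u))) (adjoint_in_out b))))).
move=> y x; rewrite /eta_tilde_fun.
(* Reversal exchanges the sum of the terms ending in a star with that of the terms beginning with
   one, and the order of the double sum. *)
have := A y x; rewrite [X in _ = dual_app _ (X + _) -> _]addrAC.
rewrite [X in _ = dual_app _ (_ + X) -> _]exchange_big => <-.
congr (dual_app (Mbar_dual _) x).
do 4?[apply: (congr2 +%R)].

- by rewrite coef_premut_op.
- by rewrite !premut_opM premut_op_ehat mulrA.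
- by apply: eq_bigr => b _; rewrite cut_right_op premut_opM premut_op_ehat.
- by apply: eq_bigr => a _; rewrite cut_left_op premut_opM premut_op_ehat.
apply: eq_bigr => a _; apply: eq_bigr => b _.
by rewrite cut_right_op cut_left_op cut_left_right.
Qed.

End Pairing.

Lemma Mbar_action_dual : exists2 f : {linear Mbar d' rho' sigma' -> dual (Mbar d rho sigma)},
  bijective f & forall u y, f (act (Mbar_action d' rho' sigma') (premut_op u) y) =
    transpose (act (Mbar_action d rho sigma) u) (f y).
Proof.
have [g [bg ga gb]] := bar_k_dual.
exists (Mbar_dual g); first by apply: pair_dual_bij => //; exact: Mhat_dual_bij.
move=> u y; apply: dualP => x; rewrite transposeE.
exact: (adjoint_eta_tilde ga gb).
Qed.

Lemma actV_dual c (phi : dual V) x :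
  dual_app (act V' c phi : dual V) x = dual_app phi (act V c x).
Proof. by []. Qed.

Definition Vhat_dual : {linear Vhat k D' -> dual (Vhat k D)} :=
  restrict_dual (act V (1 - eKQ0 K k)) (act V' (1 - eKQ0 K k)).

Lemma Vbar_action_dual :
  action_iso (Vbar_action k D') (dual_action id (Vbar_action k D)).
Proof.
have hP := hD.1; have ee x := actV_idem x (eKQ0C_idem k).
have [h bh] := ker_im_dual (Min_dual_bij k hP) (Mout_dual_bij k hP)
  (piece_dual_bij hP k) (alpha_dual hP) (beta_dual hP).
have br : bijective Vhat_dual by apply: restrict_dual_bij.
exists (pair_dual Vhat_dual h); split; first exact: pair_dual_bij.
move=> c [phi xi]; apply: dualP => -[t x].
rewrite -[act (Vbar_action k D') c _]/((toim (act V' (1 - eKQ0 K k)) (act V' c (incl phi)),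
  c k *: xi) : Vbar k D').
rewrite transposeE -[act (Vbar_action k D) c _]/((toim (act V (1 - eKQ0 K k))
  (act V c (incl t)), c k *: x) : Vbar k D).
rewrite !pair_dualE /= linearZ dual_appZr; congr (_ + _).
change (dual_app (act V' (1 - eKQ0 K k) (act V' c (incl phi)) : dual V) (incl t) =
  dual_app (incl phi : dual V) (act V (1 - eKQ0 K k) (act V c (incl t)))).
have /mem_im[psi psiE] := inclP phi.
rewrite -psiE !actV_dual ee; congr (dual_app psi (act V _ (act V _ _))).
exact: idem_incl ee.
Qed.

End MutationDual.

(** * Cyclic equivalence and premutation *)

Section Closure.
Variables (K : fieldType) (Q0 : finType).
Implicit Types Q : quiver Q0.

Lemma lin_span_lin Q (G : series K Q -> Prop) a u v :
  lin_span G u -> lin_span G v -> lin_span G (a *: u + v).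
Proof.
move=> [n [z [g [Gg ->]]]] [m [z' [g' [Gg' ->]]]].
exists (n + m)%N, (fun l => match split l with inl i => a * z i | inr i => z' i end),
  (fun l => match split l with inl i => g i | inr i => g' i end); split.
  by move=> l; case: split.
rewrite big_split_ord scaler_sumr; congr (_ + _); apply: eq_bigr => l _.
  by rewrite (unsplitK (inl l)) scalerA.
by rewrite (unsplitK (inr l)).
Qed.

Lemma lin_span0 Q (G : series K Q -> Prop) : lin_span G 0.
Proof.
have n0 (T : Type) (l : 'I_0) : T by case: l.
exists 0%N, (fun=> 0), (n0 _); split; last by rewrite big_ord0.
by case.
Qed.

Lemma lin_span_gen Q (G : series K Q -> Prop) a u : G u -> lin_span G (a *: u).
Proof. by move=> Gu; exists 1%N, (fun=> a), (fun=> u); rewrite big_ord1. Qed.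

Lemma lin_span_map Q Q' (G : series K Q -> Prop) (G' : series K Q' -> Prop)
    (F : {linear series K Q -> series K Q'}) :
  (forall u, G u -> lin_span G' (F u)) -> forall u, lin_span G u -> lin_span G' (F u).
Proof.
move=> GF u [n [z [g [Gg ->]]]]; rewrite linear_sum.
apply: big_ind => [|x y|l _]; first exact: lin_span0.
  by move=> Gx Gy; rewrite -[x]scale1r; apply: lin_span_lin.
by rewrite linearZ /= -[_ *: _]addr0; apply: lin_span_lin; [apply: GF|exact: lin_span0].
Qed.

(** The second hypothesis is the continuity of F for the m-adic topologies. *)
Lemma mclosure_map Q Q' (X : series K Q -> Prop) (X' : series K Q' -> Prop)
    (F : {linear series K Q -> series K Q'}) :
  (forall u, X u -> X' (F u)) -> (forall n, exists m, forall u, mpow m u -> mpow n (F u)) ->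
  forall u, mclosure X u -> mclosure X' (F u).
Proof.
move=> XF mF u Xu n; have [m mP] := mF n; have [x Xx ux] := Xu m.
by exists (F x); [exact: XF|rewrite -linearB; apply: mP].
Qed.

Lemma mpow_lin Q n a (u v : series K Q) : mpow n u -> mpow n v -> mpow n (a *: u + v).
Proof. by move=> un vn i w j sw; rewrite coefD coefZ un // vn // mulr0 addr0. Qed.

Lemma mclosure_lin Q (G : series K Q -> Prop) a u v :
  mclosure (lin_span G) u -> mclosure (lin_span G) v ->
  mclosure (lin_span G) (a *: u + v).
Proof.
move=> Gu Gv n; have [x Gx ux] := Gu n; have [y Gy vy] := Gv n.
exists (a *: x + y); first exact: lin_span_lin.
by rewrite opprD addrACA -scalerBr; apply: mpow_lin.
Qed.

Lemma cyc_equiv_sym Q (S T : series K Q) : cyc_equiv S T -> cyc_equiv T S.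
Proof.
move=> [pS pT c]; split; [exact: pT|exact: pS|].
have -> : T - S = (-1) *: (S - T) + 0 by rewrite scaleN1r opprB addr0.
apply: mclosure_lin; first exact: c.
move=> n; exists 0; first exact: lin_span0.
by rewrite subrr.
Qed.

Lemma cyc_equiv_trans Q (S T U : series K Q) :
  cyc_equiv S T -> cyc_equiv T U -> cyc_equiv S U.
Proof.
move=> [pS _ c] [_ pU c']; split; [exact: pS|exact: pU|].
have -> : S - U = 1 *: (S - T) + (T - U).
  by rewrite scale1r addrA subrK.
exact: mclosure_lin.
Qed.

(** Reversal turns c w - w c into the negative of a generator of the same form. *)
Lemma antiser_cyc_equiv (A B : quiver Q0) (f : B -> A) (g : A -> B) :
  (forall b, hd (f b) = tl b) -> (forall b, tl (f b) = hd b) ->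
  cancel f g -> cancel g f -> forall S T : series K A,
  cyc_equiv S T -> cyc_equiv (antiser f S) (antiser f T).
Proof.
move=> hdf tlf fK gK S T [pS pT c].
split; [exact: antiser_potential|exact: antiser_potential|].
pose F := mklin (antiser_linear (K := K) hdf tlf).
rewrite -[antiser f S - _]/(F S - F T) -linearB.
apply: mclosure_map c => [|n]; last first.
  by exists n => u; apply: (antiser_mpow hdf tlf).
apply: lin_span_map => _ [a [w [ww ->]]]; rewrite linearB.
have hg x : hd (g x) = tl x by rewrite -[in RHS](gK x) tlf.
have tg x : tl (g x) = hd x by rewrite -[in RHS](gK x) hdf.
have /= /andP[_ ww'] := ww.
have wr : walk (tl a) (rcons w a) (tl a) by rewrite walk_rcons ww' eqxx.
rewrite -[F (path_series _ (hd a) _ _)]/(antiser f _) -[F (path_series _ _ _ _)]/(antiser f _).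
rewrite !(antiser_path K hdf tlf fK gK) // map_rcons rev_rcons /= rev_cons.
rewrite -opprB -scaleN1r; apply: lin_span_gen.
exists (g a), (rev (map g w)); rewrite hg tg; split=> //=.
by rewrite (walk_anti hg tg) hg tg eqxx.
Qed.

End Closure.

(** * Contracting paths of Q to unstarred paths of the premutation *)

Section Bracket.
Variables (K : fieldType) (Q0 : finType) (k : Q0) (Q : quiver Q0).
Hypothesis lfQ : loopfree Q.
Local Notation P := (premut k Q).
Local Notation E w := (flatten (map (@expand _ k Q) w)).
Local Notation starred := (has (@is_star _ k Q)).

Lemma expand_walk i (w : seq P) j : ~~ starred w -> walk i w j -> walk i (E w) j.
Proof.
elim: w i => //= -[c|b a|a|b] w IH i //= ns /andP[/eqP <- /(IH _ ns) ww].
  by rewrite eqxx.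
by rewrite eqxx (eqP (valP a)) eq_sym (valP b) ww.
Qed.

(** Decoding is unambiguous: the first arrow of the expanded word starts at k exactly when the first
    letter is some [ba]. *)
Lemma expand_inj (w w' : seq P) : ~~ starred w -> ~~ starred w' -> E w = E w' -> w = w'.
Proof.
elim: w w' => [|c w IH] [|c' w'] //=; first by case: c'.
  by case: c.
case: c => [c|b a|a|b] //; case: c' => [c'|b' a'|a'|b'] //= ns ns' [].
- by move=> /val_inj -> /(IH _ ns ns') ->.
- move=> e _; have /andP[_ /negP[]] := valP c.
  rewrite -[val c]/(sval c) e; exact: valP b'.
- move=> e _; have /andP[_ /negP[]] := valP c'.
  rewrite -[val c']/(sval c') -e; exact: valP b.
by move=> /val_inj -> /val_inj -> /(IH _ ns ns') ->.
Qed.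

(** As neither end point is k, each passage through k consists of an arrow into k and one out of it,
    and the absence of loops keeps successive passages disjoint. *)
Lemma contract_walk i (w : seq Q) j : i != k -> j != k -> walk i w j ->
  exists e : seq P, [/\ ~~ starred e, E e = w & walk i e j].
Proof.
(* The induction is on a bound for the length, because a passage through k consumes two letters. *)
move: {2}(size w) (leqnn (size w)) => n.
elim: n w i => [|n IH] [|c w] i //= sw ik jk; try by exists [::].
move=> /andP[/eqP hc ww]; have [tk|tk] := eqVneq (tl c) k; last first.
  have [e [ns Ee we]] := IH w (tl c) sw tk jk ww.
  have cP : (hd c != k) && (tl c != k) by rewrite hc ik tk.
  exists (Keep (exist _ c cP) :: e : seq P).
  by split=> //=; rewrite ?Ee // hc eqxx we.
case: w sw ww => [|c' w] /= sw; first by move/eqP => tj; rewrite -tj tk eqxx in jk.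
move=> /andP[/eqP hc' ww].
have tk' : tl c' != k by apply/eqP => tk'; case: (lfQ (a := c')); rewrite hc' tk tk'.
have [e [ns Ee we]] := IH w (tl c') (ltnW sw) tk' jk ww.
have bP : tl c == k by rewrite tk.
have aP : hd c' == k by rewrite hc' tk.
pose b : outarr k Q := exist (fun c : Q => tl c == k) c bP.
pose a : inarr k Q := exist (fun c : Q => hd c == k) c' aP.
exists (Comp b a :: e : seq P).
by split=> //=; rewrite ?Ee // hc eqxx we.
Qed.

End Bracket.

Section BracketCyclic.
Variables (K : fieldType) (Q0 : finType) (k : Q0) (Q : quiver Q0).
Hypothesis lfQ : loopfree Q.
Local Notation P := (premut k Q).
Local Notation E w := (flatten (map (@expand _ k Q) w)).
Local Notation starred := (has (@is_star _ k Q)).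

Lemma expand_eq (w x : seq P) : ~~ starred x ->
  (w == x) = ~~ starred w && (E w == E x).
Proof.
move=> nx; apply/eqP/andP => [->//|[nw /eqP e]]; exact: expand_inj nw nx e.
Qed.

Lemma expand_source i (w : seq P) j : ~~ starred w -> walk i w j -> E w <> [::] -> i != k.
Proof.
case: w => // -[c|b a|a|b] w //= _ /andP[/eqP <- _] _.
  by have /andP[] := valP c.
by apply/eqP => hb; case: (lfQ (a := val b)); rewrite hb (eqP (valP b)).
Qed.

Lemma size_expand (w : seq P) : (size (E w) <= (size w).*2)%N.
Proof.
elim: w => //= c w IH; rewrite size_cat doubleS -addn2 addnC.
by apply: leq_add => //; case: c.
Qed.

(* [U], where a cycle starting at k is first rotated by one arrow: this makes   *)
(* the operation linear and compatible with cyclic equivalence.                *)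
Definition bracket_rot (U : series K Q) : series K P := mkseries (fun i (w : seq P) j =>
  if starred w then 0
  else coef U i (E w) j + (i == j)%:R * coef U k (rotr 1 (E w)) k).

Lemma coef_bracket_rot (U : series K Q) i (w : seq P) j : walk i w j -> coef (bracket_rot U) i w j =
  if starred w then 0
  else coef U i (E w) j + (i == j)%:R * coef U k (rotr 1 (E w)) k.
Proof. by move=> ww; rewrite [LHS]coef_mk ww. Qed.

Lemma coef_bracket (U : series K Q) i (w : seq P) j : walk i w j -> coef (bracket k U) i w j =
  if starred w then 0 else coef U i (E w) j.
Proof. by move=> ww; rewrite [LHS]coef_mk ww. Qed.

Lemma bracket_rot_linear : linear (bracket_rot : series K Q -> series K P).
Proof.
move=> a u v; apply: seriesP => i w j ww; rewrite coefD coefZ !coef_bracket_rot //.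
case: ifP => _; first by rewrite mulr0 addr0.
by rewrite !coefD !coefZ !mulrDr addrACA mulrCA.
Qed.

Lemma bracket_rotE (U : series K Q) :
  (forall w, coef U k w k = 0) -> bracket_rot U = bracket k U.
Proof.
move=> U0; apply: seriesP => i w j ww; rewrite coef_bracket_rot // coef_bracket //.
by rewrite U0 mulr0 addr0.
Qed.

(** A letter abbreviates at most two arrows, whence the factor 2. *)
Lemma mpow_bracket_rot n (U : series K Q) : mpow n.*2 U -> mpow n (bracket_rot U).
Proof.
move=> Un i w j sw; have [ww|nw] := boolP (walk i w j); last exact: coef_notwalk.
have sE : (size (E w) < n.*2)%N.
  by apply: leq_ltn_trans (size_expand w) _; rewrite ltn_double.
rewrite coef_bracket_rot // !Un ?size_rotr // mulr0 addr0.
by case: ifP.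
Qed.

Lemma rotr1_eq (w x : seq Q) : (rotr 1 w == x) = (w == rot 1 x).
Proof. by apply/eqP/eqP => [<-|->]; rewrite ?rotrK ?rotK. Qed.

(** If c ends at k, the cycle c w is rotated to w c and the difference vanishes. If c starts at k,
    then w = c' w', the cycle w c is rotated to w' c c', and the image is the generator for the
    letter [c c']. Otherwise it is the generator for the kept letter c. *)
Lemma bracket_rot_rotdiff u : is_rotdiff u -> lin_span (@is_rotdiff K Q0 P) (bracket_rot u).
Proof.
move=> [c [w [ww {u}->]]]; set u := _ - _.
have /= /andP[_ wc] := ww.
have wr : walk (tl c) (rcons w c) (tl c) by rewrite walk_rcons wc eqxx.
have uE i v j : coef u i v j = [&& i == hd c, v == c :: w & j == hd c]%:R -
    [&& i == tl c, v == rcons w c & j == tl c]%:R.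
  by rewrite coefD coefN !coef_path.
(* A walk whose last letter is d starts at tl d, so i = j forces both end points to be tl d. *)
have rot_target i (e : seq P) x d j : ~~ starred e -> walk i e j ->
    walk (tl d) (rcons x d) (tl d) ->
    (i == j)%:R * (E e == rcons x d)%:R = [&& i == tl d, E e == rcons x d & j == tl d]%:R :> K.
  move=> ns we _; have := expand_walk ns we.
  case: (E e =P _) => [->|_]; last by rewrite /= mulr0 andbF.
  by rewrite walk_rcons => /andP[_ /eqP ->]; rewrite /= mulr1 eqxx andbT.
have source_k i (e : seq P) x j : ~~ starred e -> walk i e j -> x <> [::] ->
    [&& i == k, E e == x & j == k] = false.
  move=> ns we nx; apply/and3P => -[ik /eqP Ee _].
  by have /negP[] := expand_source ns we (eq_ind_r (fun x => x <> [::]) nx Ee).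
have lin u' : is_rotdiff u' -> lin_span (@is_rotdiff K Q0 P) u'.
  by move=> h; rewrite -[u']scale1r; apply: lin_span_gen.
have [hk|hk] := eqVneq (hd c) k.
  suff -> : bracket_rot u = 0 by exact: lin_span0.
  have tk : tl c != k by apply/eqP => tk; case: (lfQ (a := c)); rewrite hk tk.
  apply: seriesP => i e j we; rewrite coef_bracket_rot //.
  case: ifPn => // ns; rewrite !uE hk source_k // sub0r eqxx andbT /=.
  rewrite [k == tl c]eq_sym (negPf tk) subr0 rotr1_eq rot1_cons.
  by rewrite (rot_target _ _ _ _ _ ns we wr) addNr.
have [tk|tk] := eqVneq (tl c) k; last first.
  have [e1 [ns1 E1 we1]] := contract_walk lfQ tk hk wc.
  have cP : (hd c != k) && (tl c != k) by rewrite hk tk.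
  pose c0 : P := Keep (exist _ c cP).
  have w1 : walk (hd c0) (c0 :: e1) (hd c0) by rewrite /= eqxx.
  have w2 : walk (tl c0) (rcons e1 c0) (tl c0) by rewrite walk_rcons we1 eqxx.
  apply: lin; exists c0, e1; split=> //.
  apply: seriesP => i e j we; rewrite coef_bracket_rot // coefD coefN !coef_path //.
  rewrite !expand_eq //; last by rewrite has_rcons.
  rewrite map_rcons flatten_rcons /= E1 cats1.
  case: (starred e) => /=; first by rewrite !andbF subr0.
  by rewrite !uE [k == hd c]eq_sym (negPf hk) [k == tl c]eq_sym (negPf tk) subr0 mulr0 addr0.
have [c' [w' wE]] : exists c' w', w = c' :: w'.
  case: w wc {ww wr u uE} => [/eqP wc|c' w' _]; last by exists c', w'.
  by rewrite -wc tk eqxx in hk.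
have [hc' wc'] : hd c' = tl c /\ walk (tl c') w' (hd c).
  have : walk (tl c) (c' :: w') (hd c) by rewrite -wE.
  by move=> /andP[/eqP].
have tk' : tl c' != k by apply/eqP => tk'; case: (lfQ (a := c')); rewrite hc' tk tk'.
have [e1 [ns1 E1 we1]] := contract_walk lfQ tk' hk wc'.
have bP : tl c == k by rewrite tk.
have aP : hd c' == k by rewrite hc' tk.
pose c0 : P := Comp (exist (fun c : Q => tl c == k) c bP) (exist (fun c : Q => hd c == k) c' aP).
have w1 : walk (hd c0) (c0 :: e1) (hd c0) by rewrite /= eqxx.
have w2 : walk (tl c0) (rcons e1 c0) (tl c0) by rewrite walk_rcons we1 eqxx.
have w3 : walk (tl c') (rcons (rcons w' c) c') (tl c').
  by rewrite !walk_rcons /= wc' hc' !eqxx.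
apply: lin; exists c0, e1; split=> //.
apply: seriesP => i e j we; rewrite coef_bracket_rot // coefD coefN !coef_path //.
rewrite !expand_eq //; last by rewrite has_rcons.
rewrite map_rcons flatten_rcons /= E1.
case: (boolP (starred e)) => /= ns; first by rewrite !andbF subr0.
have nr : rcons w c <> [::] by rewrite wE.
rewrite !uE tk (source_k _ _ _ _ ns we nr) [k == hd c]eq_sym (negPf hk) !eqxx /=.
rewrite andbT subr0 sub0r mulrN.
have rE : rot 1 (rcons w c) = rcons (rcons w' c) c' by rewrite wE rcons_cons rot1_cons.
rewrite rotr1_eq rE (rot_target _ _ _ _ _ ns we w3).
by rewrite wE -!cats1 -catA.
Qed.

Lemma bracket_potential (U : series K Q) : is_potential U -> is_potential (bracket k U).
Proof.
move=> pU i w j; have [ww|nw] := boolP (walk i w j); last by rewrite coef_notwalk // eqxx.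
rewrite coef_bracket //; case: ifP => _; first by rewrite eqxx.
by move=> /pU[-> nE]; split=> // w0; apply: nE; rewrite w0.
Qed.

Lemma bracket_cyc_equiv (U U' : series K Q) :
  (forall w : seq Q, coef U k w k = 0) -> (forall w : seq Q, coef U' k w k = 0) ->
  cyc_equiv U U' -> cyc_equiv (bracket k U) (bracket k U').
Proof.
move=> U0 U0' [pU pU' c]; split; [exact: bracket_potential|exact: bracket_potential|].
pose F := mklin bracket_rot_linear.
rewrite -(bracket_rotE U0) -(bracket_rotE U0') -[bracket_rot U - _]/(F U - F U') -linearB.
apply: mclosure_map c => [|n]; last by exists n.*2; exact: mpow_bracket_rot.
apply: lin_span_map => u; exact: bracket_rot_rotdiff.
Qed.

End BracketCyclic.

(** * The opposite of a splitting *)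

Section OppositeSplitting.
Variables (K : fieldType) (Q0 : finType).
Implicit Types Q : quiver Q0.

Lemma coef_opser Q (u : series K Q) i w j : coef (opser u) i w j = coef u j (rev w) i.
Proof. by rewrite opserE coef_anti // map_id. Qed.

Lemma coef_unopser Q (u : series K (opq Q)) i w j : coef (unopser u) i w j = coef u j (rev w) i.
Proof. by rewrite unopserE coef_anti // map_id. Qed.

Lemma pmap_rev_comm (T T' : Type) (f : T -> option T') s : pmap f (rev s) = rev (pmap f s).
Proof.
elim: s => //= x s IH; rewrite rev_cons -cats1 pmap_cat IH /=.
by case: (f x) => [y|] /=; rewrite ?rev_cons ?cats1 ?cats0.
Qed.

Lemma unopser_sinl Q Q' (u : series K (opq Q)) :
  unopser (sinl (opq Q') u : series K (opq (sumq Q Q'))) = sinl Q' (unopser u).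
Proof.
apply: seriesP => i w j ww; rewrite coef_unopser [RHS]coef_mk ww.
rewrite [LHS]coef_mk (_ : walk _ _ _); last first.
  have := walk_anti (A := opq (sumq Q Q')) (B := sumq Q Q') (f := id)
    (fun=> erefl) (fun=> erefl) i w j.
  by rewrite map_id ww.
rewrite /= pmap_rev_comm map_rev (can_eq revK); case: ifP => // _.
by rewrite coef_unopser.
Qed.

Lemma unopser_sinr Q Q' (u : series K (opq Q')) :
  unopser (sinr (opq Q) u : series K (opq (sumq Q Q'))) = sinr Q (unopser u).
Proof.
apply: seriesP => i w j ww; rewrite coef_unopser [RHS]coef_mk ww.
rewrite [LHS]coef_mk (_ : walk _ _ _); last first.
  have := walk_anti (A := opq (sumq Q Q')) (B := sumq Q Q') (f := id)
    (fun=> erefl) (fun=> erefl) i w j.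
  by rewrite map_id ww.
rewrite /= pmap_rev_comm map_rev (can_eq revK); case: ifP => // _.
by rewrite coef_unopser.
Qed.

Lemma opser_potential Q (S : series K Q) : is_potential S -> is_potential (opser S).
Proof. by rewrite opserE; apply: antiser_potential. Qed.

Lemma opser_reduced Q (S : series K Q) : is_reduced S -> is_reduced (opser S).
Proof. by move=> h i w j sw; rewrite coef_opser h // size_rev. Qed.

Lemma opser_trivial Q (S : series K Q) : is_trivial S -> is_trivial (opser S).
Proof.
move=> [h2 ha]; split=> [i w j sw|c]; first by rewrite coef_opser h2 // size_rev.
have [z zE] := ha c; exists z; apply: (can_inj (@unopserK K Q0 Q)).
rewrite unopser_arr zE unopserE (antiser_sum (B := Q)) //; apply: eq_bigr => a _.
rewrite -[antiser _ _]/(mklin (antiser_linear (A := opq Q) (B := Q) (f := id) (K := K)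
  (fun=> erefl) (fun=> erefl)) _) linearZ /=; congr (_ *: _).
rewrite -[mklin_fun _ _]/(antiser (A := opq Q) (B := Q) id _).
by rewrite opserE (@cder_anti K Q0 Q (opq Q)) // -opserE -unopserE opserK.
Qed.

Variable k : Q0.

Lemma starred_op Q (w : seq (premut k (opq Q))) :
  has (@is_star _ k Q) (rev (map (@op_arrow Q0 k Q) w)) = has (@is_star _ k (opq Q)) w.
Proof. by rewrite has_rev has_map; apply: eq_has => -[]. Qed.

Lemma premut_op_bracket Q (S : series K Q) :
  premut_op (bracket k S) = bracket k (opser S).
Proof.
apply: seriesP => i w j ww; rewrite coef_premut_op !coef_bracket //; last first.
  by rewrite (walk_anti (@hd_op_arrow Q0 k Q) (@tl_op_arrow Q0 k Q)).
rewrite starred_op; case: ifP => // _.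
by rewrite op_arrowE expand_anti_seq map_id coef_opser.
Qed.

Lemma premut_op_arr Q (d : premut k (opq Q)) : premut_op (arr K (op_arrow d)) = arr K d.
Proof.
rewrite premut_opE (antiser_arr K (@hd_op_arrow Q0 k Q) (@tl_op_arrow Q0 k Q)
  (@op_arrowK Q0 k Q) (@op_arrow_invK Q0 k Q)).
by rewrite op_arrowK.
Qed.

Lemma premut_opD Q (u v : series K (premut k Q)) :
  premut_op (u + v) = premut_op u + premut_op v.
Proof. exact: (antiserD (@hd_op_arrow Q0 k Q) (@tl_op_arrow Q0 k Q)). Qed.

Lemma premut_op_sum Q (T : finType) (F : T -> series K (premut k Q)) :
  premut_op (\sum_t F t) = \sum_t premut_op (F t).
Proof. exact: (antiser_sum (@hd_op_arrow Q0 k Q) (@tl_op_arrow Q0 k Q)). Qed.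

Lemma premut_op_Delta Q : premut_op (Delta K k Q) = Delta K k (opq Q).
Proof.
rewrite /Delta premut_op_sum.
under eq_bigr do rewrite premut_op_sum.
rewrite exchange_big; apply: eq_bigr => b _; apply: eq_bigr => a _.
rewrite !premut_opM mulrA.
congr (_ * _ * _); rewrite -premut_op_arr //.
Qed.

Lemma premut_op_cyc_equiv Q (S T : series K (premut k Q)) :
  cyc_equiv S T -> cyc_equiv (premut_op S) (premut_op T).
Proof.
exact: (antiser_cyc_equiv (@hd_op_arrow Q0 k Q) (@tl_op_arrow Q0 k Q)
  (@op_arrowK Q0 k Q) (@op_arrow_invK Q0 k Q)).
Qed.

Lemma potentialB Q (S T : series K Q) :
  is_potential S -> is_potential T -> is_potential (S - T).
Proof.
move=> pS pT i w j; rewrite coefD coefN => h.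
have [S0|/pS//] := eqVneq (coef S i w j) 0.
by apply: pT; apply: contraNneq h => ->; rewrite S0 oppr0 addr0.
Qed.

(** The representatives S1 of S and S2 of the opposite potential are unrelated choices, but the
    opposite of S1 is cyclically equivalent to S2 and neither has cycles at k, so their brackets are
    cyclically equivalent. The cubic terms correspond exactly. *)
Lemma premutation_op_cyc_equiv Q (S : series K Q) T Top : loopfree Q ->
  is_potential T -> is_premutation S T -> is_premutation (k := k) (opser S) Top ->
  cyc_equiv (premut_op T) Top.
Proof.
move=> lfQ pT [S1 [SS1 S10 TE]] [S2 [SS2 S20 ->]].
have lf' : loopfree (opq Q) by move=> c /esym/lfQ.
have c12 : cyc_equiv (opser S1) S2.
  apply: cyc_equiv_trans SS2; apply: cyc_equiv_sym; rewrite !opserE.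
  exact: (@antiser_cyc_equiv K Q0 Q (opq Q) _ (fun b : Q => b : opq Q)).
have S10' w : coef (opser S1) k w k = 0 by rewrite coef_opser S10.
have [pb1 pb2 cb] := bracket_cyc_equiv lf' S10' S20 c12.
have pD : is_potential (Delta K k (opq Q)).
  rewrite -premut_op_Delta; apply: (antiser_potential (@hd_op_arrow Q0 k Q) (@tl_op_arrow Q0 k Q)).
  (* The cubic term is a potential as the difference of two potentials. *)
  have -> : Delta K k Q = T - bracket k S1 by rewrite TE addrC addKr.
  by apply: potentialB => //; apply: bracket_potential; case: SS1.
have pN (U V : series K (premut k (opq Q))) :
    is_potential U -> is_potential V -> is_potential (U + V).
  move=> pU pV; rewrite -[V]opprK; apply: potentialB => //.
  by rewrite -sub0r; apply: potentialB => // i w j; rewrite coef0 eqxx.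
rewrite TE premut_opD premut_op_bracket premut_op_Delta.
split; [exact: pN|exact: pN|].
by rewrite opprD addrACA subrr addr0.
Qed.

(** The opposite splitting map is the given isomorphism between two reversals, so the
    anti-multiplicativities cancel; its value on the potential is the opposite of one cyclically
    equivalent to [T]. *)
Lemma op_splittingP Q (S T : series K _) Top (s : splitting K (premut k Q)) : loopfree Q ->
  is_premutation S T -> is_premutation (opser S) Top -> is_splitting T s ->
  is_splitting Top (op_splitting s).
Proof.
move=> lfQ hT hTop [[f [bf hf tf]] [pr rr] [pt tt] [[ls s1 sM sv bs] ce]].
(* That [T] is a potential is part of the cyclic equivalence in the right-equivalence. *)
have [_ pT _] := ce.
split.
- exists (fun c => op_arrow_inv (f c)); split=> [|c|c].
  + apply: bij_comp bf; exists (@op_arrow Q0 k Q); [exact: op_arrow_invK|exact: op_arrowK].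
  + by rewrite hd_premut_anti tf; case: c.
  + by rewrite tl_premut_anti hf; case: c.
- by split; [exact: opser_potential|exact: opser_reduced].
- by split; [exact: opser_potential|exact: opser_trivial].
split.
  split.
  - move=> a u v; rewrite /= !unopserE.
    rewrite (@antiser_linear K Q0 _ (sumq _ _)) // ls.
    exact: (antiser_linear (@hd_op_arrow Q0 k Q) (@tl_op_arrow Q0 k Q)).
  - rewrite /= unopser1 s1; exact: (antiser1 K (@hd_op_arrow Q0 k Q) (@tl_op_arrow Q0 k Q)).
  - by move=> u v; rewrite /= unopserM sM premut_opM.
  - move=> j; rewrite /= unopser_vtx sv.
    exact: (antiser_vtx K (@hd_op_arrow Q0 k Q) (@tl_op_arrow Q0 k Q)).
  apply: bij_comp.
    exists (antiser (@op_arrow_inv Q0 k Q)) => u.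
      apply: antiserK; [exact: hd_op_arrow|exact: tl_op_arrow|exact: op_arrow_invK].
    apply: (antiserK (f := @op_arrow_inv Q0 k Q));
      [exact: hd_premut_anti|exact: tl_premut_anti|exact: op_arrowK].
  apply: bij_comp bs _.
  exact: (Bijective (@unopserK K Q0 (sumq (redQ s) (trivQ s))) (@opserK K Q0 _)).
rewrite /= -[unopser _]/(unopser (sinl (opq (trivQ s)) (opser (redS s)) +
  sinr (opq (redQ s)) (opser (trivS s)) : series K (opq (sumq (redQ s) (trivQ s))))).
rewrite unopserE (@antiserD K Q0 _ (sumq _ _)) // -!unopserE unopser_sinl unopser_sinr !opserK.
apply: cyc_equiv_trans (premut_op_cyc_equiv ce) _.
exact: premutation_op_cyc_equiv pT hT hTop.
Qed.

End OppositeSplitting.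

Theorem theorem8p1 (K : fieldType) (Q0 : finType) (Q : quiver Q0)
    (hQ : loopfree Q) (S : series K Q) (hS : is_potential S)
    (k : Q0) (h2 : no_2cycle_at k Q)
    (* the potentials of the premutations of (Q, S) and of (Q^op, S^op) at k *)
    (T : series K (premut k Q)) (hT : is_premutation S T)
    (Top : series K (premut k (opq Q))) (hTop : is_premutation (opser S) Top)
    (s : splitting K (premut k Q)) (hs : is_splitting T s) :
  (is_splitting Top (op_splitting s) /\
   red_qp (op_splitting s) = op_qp (red_qp s)) /\
  forall (D : decorated K Q), is_decorated_Pmodule S D ->
  forall (d : description) (rho : rho_type k S D) (sigma : sigma_type k S D),
    is_retraction rho -> is_section sigma ->
  forall (d' : description)
    (rho' : rho_type k (opser S) (decorated_dual D))
    (sigma' : sigma_type k (opser S) (decorated_dual D)),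
    is_retraction rho' -> is_section sigma' ->
  decorated_iso
    (mutation d' rho' sigma' (op_splitting s))
    (decorated_dual (mutation d rho sigma s)).
Proof.
(* The equality of mutated QPs holds by conversion, since [op_splitting] takes the opposite of the
   reduced part as its reduced part. *)
split; first by split=> //; exact: op_splittingP hT hTop hs.
move=> D hD d rho sigma hrho hsigma d' rho' sigma' hrho' hsigma'.
split; last exact: Vbar_action_dual hD.
have [f bf fE] := Mbar_action_dual hQ hD d hrho hsigma d' hrho' hsigma'.
exists f; split=> // u x.
(* Reversal commutes with the embedding of the reduced part, so u acts as the opposite of the image
   of [unopser u] under the given splitting. *)
have -> : act (dmod (mutation d' rho' sigma' (op_splitting s))) u x =
  act (Mbar_action d' rho' sigma')
    (premut_op (split_map (sinl (trivQ s) (unopser u)))) x.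
  rewrite -unopser_sinl //.
exact: fE.
Qed.
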